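(* Let $\delta$ be an $I\times J$ matrix of free polynomials in $d$ variables, and assume that $B_\delta(B(\mathcal H))$ is balanced. Then every bounded non-commutative function $f$ on $B_\delta(\mathbb M)$ has a unique extension to an NC function on $B_\delta(B(\mathcal H))$, where $\mathbb M^{[d]}$ is embedded into $B(\mathcal H)^d$ by choosing a basis of $\mathcal H$ and identifying an $n\times n$ matrix with the finite rank operator that is $0$ outside the first $n\times n$ block.
   Context: $\mathcal H$ is an infinite-dimensional Hilbert space, $B(\mathcal H)$ is the algebra of bounded linear operators on $\mathcal H$, and $d$ is a positive integer. $B(\mathcal H)^d$ carries the norm topology, and the coordinates of a $d$-tuple are written $x=(x^1,\dots,x^d)$. $\mathbb M_n$ is the set of complex $n\times n$ matrices, and $\mathbb M^{[d]}=\bigcup_{n\ge1}\mathbb M_n^d$. A free polynomial is a polynomial with complex coefficients in $d$ non-commuting variables. For an $I\times J$ matrix $\delta$ of free polynomials, $B_\delta(B(\mathcal H))=\{x\in B(\mathcal H)^d:\|\delta(x)\|<1\}$ and $B_\delta(\mathbb M)=\{x\in\mathbb M^{[d]}:\|\delta(x)\|<1\}$ (operator norms). A set $\Omega$ in a vector space is balanced if $\alpha\Omega\subseteq\Omega$ for every $\alpha\in\mathbb C$ with $|\alpha|\le1$. A non-commutative function $f$ on $B_\delta(\mathbb M)$ is a function that is graded ($x\in\mathbb M_n^d$ implies $f(x)\in\mathbb M_n$) and preserves intertwining: if $L:\mathbb C^m\to\mathbb C^n$ is linear, $x\in\mathbb M_m^d$ and $y\in\mathbb M_n^d$ are both in $B_\delta(\mathbb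 M)$, and $Lx^r=y^rL$ for all $1\le r\le d$, then $Lf(x)=f(y)L$. Bounded means $\sup\|f(x)\|<\infty$ over $x\in B_\delta(\mathbb M)$. An NC function on $B_\delta(B(\mathcal H))$ is a locally bounded function $F:B_\delta(B(\mathcal H))\to B(\mathcal H)$ that is intertwining preserving: whenever $x,y$ are in the domain and $L\in B(\mathcal H)$ satisfies $Lx^r=y^rL$ for all $r$, then $LF(x)=F(y)L$.
   Formalization: ''Extension'' is taken to mean that F(x) agrees with f(x) on the first n×n block (F(x)P_n = f(x)); requiring F(x) to be 0 outside the block is impossible when f(0)≠0 (e.g. f=1), and follows when f(0)=0. *)

(* Defs.v *)
From HB Require Import structures.
From mathcomp Require Import all_boot all_order all_algebra.
From mathcomp Require Import sesquilinear complex finmap.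
From mathcomp Require Import ring.
From mathcomp Require Import all_classical all_reals all_analysis.

Set Implicit Arguments.
Unset Strict Implicit.
Unset Printing Implicit Defensive.

Import Order.TTheory GRing.Theory Num.Theory.
Import numFieldNormedType.Exports.

Local Open Scope classical_set_scope.
Local Open Scope complex_scope.
Local Open Scope ring_scope.

Definition infinite_dimensional (K : fieldType) (V : lmodType K) :=
  forall n : nat, exists v : 'I_n -> V,
    forall c : 'I_n -> K, \sum_i c i *: v i = 0 -> forall i, c i = 0.

HB.mixin Record isInfHilbert (R : realType) H
    & CompleteNormedModule R[i] H := {
  inner : {dot H for Num.conj} ;
  sqr_norm_inner : forall v : H, `|v| ^+ 2 = inner v v ;
  hilbert_infinite_dimensional : infinite_dimensional H
}.

#[short(type="infHilbertType")]
HB.structure Definition InfHilbert (R : realType) :=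
  {H of CompleteNormedModule R[i] H & isInfHilbert R H}.

Definition opnorm (R : realType) (V W : Type) (NV : V -> R) (NW : W -> R)
    (T : V -> W) : R :=
  sup [set NW (T v) | v in [set v | NV v <= 1]].

Definition l2norm (R : realType) (V : Type) (N : V -> R) (J : nat)
    (v : 'I_J -> V) : R :=
  Num.sqrt (\sum_j N (v j) ^+ 2).

(* In normed spaces over R[i] the library's norm `|v| lies in R[i] *)
Definition rnorm (R : realType) (V : normedZmodType R[i]) (v : V) : R :=
  complex.Re `|v|.

Section RealNorm.
Variables (R : realType) (V : normedModType R[i]).
Implicit Types (u v : V) (c : R[i]).

Lemma rnormE (W : normedZmodType R[i]) (w : W) : `|w| = (rnorm w)%:C.
Proof. by rewrite /rnorm RRe_real ?normr_real. Qed.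

Lemma rnorm_ge0 (W : normedZmodType R[i]) (w : W) : 0 <= rnorm w.
Proof. by rewrite -lecR -rnormE normr_ge0. Qed.

Lemma rnorm0 (W : normedZmodType R[i]) : rnorm (0 : W) = 0.
Proof. by rewrite /rnorm normr0. Qed.

Lemma rnorm_eq0 (W : normedZmodType R[i]) (w : W) : rnorm w = 0 -> w = 0.
Proof. by move=> v0; apply: normr0_eq0; rewrite rnormE v0. Qed.

Lemma rnormD u v : rnorm (u + v) <= rnorm u + rnorm v.
Proof. by rewrite -lecR rmorphD /= -!rnormE ler_normD. Qed.

Lemma rnormZ c v : rnorm (c *: v) = rnorm c * rnorm v.
Proof. by apply: (@complexI R); rewrite rmorphM /= -!rnormE normrZ. Qed.

End RealNorm.

Section BoundedOperators.
Variables (R : realType) (H : infHilbertType R).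
Implicit Types (f : H -> H) (v : H) (c : R[i]).

Definition bounded_linear : {pred H -> H} :=
  fun f => `[< linear f /\ exists M : R, forall v, rnorm (f v) <= M * rnorm v >].

Lemma bounded_linearP f : reflect
  (linear f /\ exists2 M : R, 0 <= M & forall v, rnorm (f v) <= M * rnorm v)
  (f \in bounded_linear).
Proof.
apply: (iffP (asboolP _)) => -[lf]; last by case=> M _ fM; split; last exists M.
case=> M fM; split => //; exists `|M|; rewrite ?normr_ge0 // => v.
by rewrite (le_trans (fM v)) // ler_wpM2r ?rnorm_ge0 // ler_norm.
Qed.

Fact bounded_linear_submod_closed : submod_closed bounded_linear.
Proof.
split.
  apply/bounded_linearP; split.
    by move=> a u v; rewrite -[LHS]/(0 : H) -[RHS]/(a *: 0 + 0 : H) scaler0 addr0.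
  by exists 0 => // v; rewrite -[X in rnorm X]/(0 : H) rnorm0 mul0r.
move=> a f g /bounded_linearP[lf [M M0 fM]] /bounded_linearP[lg [N N0 gN]].
apply/bounded_linearP; split.
  move=> b u v; rewrite -[LHS]/(a *: f _ + g _) -[RHS]/(b *: (a *: _ + _) + (a *: _ + _)).
  rewrite lf lg !scalerDr !scalerA mulrC -!addrA.
  by congr (_ + _); rewrite addrCA.
have na0 := rnorm_ge0 a.
exists (rnorm a * M + N); first by rewrite addr_ge0 ?mulr_ge0.
move=> v; rewrite (le_trans (rnormD _ _)) // mulrDl lerD //.
by rewrite rnormZ -mulrA ler_wpM2l.
Qed.

HB.instance Definition _ :=
  GRing.isSubmodClosed.Build R[i] (H -> H) bounded_linear
    bounded_linear_submod_closed.

Record bop := BOp { bop_fun :> H -> H ; _ : bop_fun \in bounded_linear }.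

HB.instance Definition _ := [isSub for bop_fun].
HB.instance Definition _ := [Choice of bop by <:].
HB.instance Definition _ := [SubChoice_isSubLmodule of bop by <:].


Implicit Types (S T : bop).

Lemma bopP S T : S =1 T -> S = T.
Proof. by move=> ST; apply: val_inj; apply/funext. Qed.

Lemma bop_linear T : linear T.
Proof. by case: T => f /= /bounded_linearP[]. Qed.

HB.instance Definition _ T :=
  GRing.isLinear.Build R[i] H H *:%R (bop_fun T) (bop_linear T).

Lemma bop_bounded T :
  exists2 M : R, 0 <= M & forall v, rnorm (T v) <= M * rnorm v.
Proof. by case: T => f /= /bounded_linearP[]. Qed.

Fact bop_one_subproof : (@id H) \in bounded_linear.
Proof.
by apply/bounded_linearP; split=> //; exists 1 => // v; rewrite mul1r.
Qed.

Fact bop_mul_subproof S T : (S \o T) \in bounded_linear.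
Proof.
apply/bounded_linearP; split; first by move=> a u v; rewrite /= !linearP.
have [M M0 SM] := bop_bounded S; have [N N0 TN] := bop_bounded T.
exists (M * N) => [|v]; first exact: mulr_ge0.
by rewrite -mulrA (le_trans (SM _)) // ler_wpM2l.
Qed.

Definition bop_one : bop := BOp bop_one_subproof.
Definition bop_mul S T : bop := BOp (bop_mul_subproof S T).

Fact bop_mulA : associative bop_mul.
Proof. by move=> S T U; apply: bopP. Qed.
Fact bop_mul1 : left_id bop_one bop_mul.
Proof. by move=> S; apply: bopP. Qed.
Fact bop_mulr1 : right_id bop_one bop_mul.
Proof. by move=> S; apply: bopP. Qed.
Fact bop_mulDl : left_distributive bop_mul +%R.
Proof. by move=> S T U; apply: bopP. Qed.
Fact bop_mulDr : right_distributive bop_mul +%R.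
Proof. by move=> S T U; apply: bopP => v; rewrite /= linearD. Qed.
Fact bop_one_neq0 : bop_one != 0.
Proof.
apply/eqP => /(congr1 bop_fun) /= id0.
have [v /(_ (fun=> 1)) vP] := @hilbert_infinite_dimensional R H 1.
have /vP/(_ ord0)/eqP : \sum_(i < 1) (1 : R[i]) *: v i = 0.
  by rewrite big_ord1 scale1r; have := congr1 (@^~ (v ord0)) id0.
by rewrite oner_eq0.
Qed.

HB.instance Definition _ := GRing.Zmodule_isNzRing.Build bop
  bop_mulA bop_mul1 bop_mulr1 bop_mulDl bop_mulDr bop_one_neq0.

Fact bop_scalerAl (c : R[i]) S T : c *: (S * T) = c *: S * T.
Proof. by apply: bopP. Qed.
HB.instance Definition _ := GRing.Lmodule_isLalgebra.Build R[i] bop bop_scalerAl.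

Fact bop_scalerAr (c : R[i]) S T : c *: (S * T) = S * (c *: T).
Proof. by apply: bopP => v; rewrite /= linearZ. Qed.
HB.instance Definition _ := GRing.Lalgebra_isAlgebra.Build R[i] bop bop_scalerAr.

Definition bop_norm T : R := opnorm (@rnorm R H) (@rnorm R H) T.

Lemma bop_norm_has_sup T :
  has_sup [set rnorm (T v) | v in [set v | rnorm v <= 1]].
Proof.
split; first by exists (rnorm (T 0)), 0 => //=; rewrite rnorm0.
have [M M0 TM] := bop_bounded T; exists M => _ [v /= v1 <-].
by rewrite (le_trans (TM v)) // ler_piMr.
Qed.

Lemma bop_norm_ub T v : rnorm v <= 1 -> rnorm (T v) <= bop_norm T.
Proof.
by move=> v1; apply: sup_upper_bound (bop_norm_has_sup T) _ _; exists v.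
Qed.

Lemma bop_norm_le T M :
  (forall v, rnorm v <= 1 -> rnorm (T v) <= M) -> bop_norm T <= M.
Proof.
move=> TM; apply: sup_le_ub; first by case: (bop_norm_has_sup T).
by move=> _ [v /= v1 <-]; exact: TM.
Qed.

Lemma bop_norm_ge0 T : 0 <= bop_norm T.
Proof. by rewrite (le_trans (rnorm_ge0 (T 0))) // bop_norm_ub // rnorm0. Qed.

Fact bop_normD S T : (bop_norm (S + T))%:C <= (bop_norm S)%:C + (bop_norm T)%:C.
Proof.
rewrite -rmorphD /= lecR; apply: bop_norm_le => v v1.
by rewrite (le_trans (rnormD _ _)) // lerD // bop_norm_ub.
Qed.

Fact bop_normZ_le c T : bop_norm (c *: T) <= rnorm c * bop_norm T.
Proof.
apply: bop_norm_le => v v1; rewrite [X in rnorm X]/= rnormZ.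
by rewrite ler_wpM2l ?bop_norm_ub ?rnorm_ge0.
Qed.

Fact bop_normZ c T : (bop_norm (c *: T))%:C = `|c| * (bop_norm T)%:C.
Proof.
rewrite (rnormE c) -rmorphM /=; congr (_%:C); apply/le_anti; rewrite bop_normZ_le /=.
have [->|c0] := eqVneq c 0.
  by rewrite rnorm0 mul0r bop_norm_ge0.
have nc0 : 0 < rnorm c.
  rewrite lt_neqAle rnorm_ge0 andbT eq_sym.
  by apply: contra_neq c0 => /rnorm_eq0.
have ncV : (rnorm c)^-1 = rnorm c^-1.
  by apply: (@complexI R); rewrite -rnormE normfV rnormE fmorphV.
by rewrite -ler_pdivlMl // ncV -{1}[T](scalerK c0) bop_normZ_le.
Qed.

Fact bop_norm0_eq0 T : (bop_norm T)%:C = 0 -> T = 0.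
Proof.
move=> /(@complexI R) T0; apply: bopP => v /=.
have [->|v0] := eqVneq v 0; first by rewrite linear0.
have nv0 : 0 < rnorm v.
  by rewrite lt_neqAle rnorm_ge0 andbT eq_sym; apply: contra_neq v0 => /rnorm_eq0.
have : rnorm (T ((rnorm v)^-1%:C *: v)) <= 0.
  rewrite -T0 bop_norm_ub // rnormZ /rnorm normc_def /= expr0n /= addr0 sqrtr_sqr.
  by rewrite ger0_norm ?invr_ge0 ?rnorm_ge0 // mulVf // gt_eqF.
rewrite linearZ /= => Tv0; apply: rnorm_eq0.
have /rnorm_eq0/eqP : rnorm ((rnorm v)^-1%:C *: T v) = 0.
  by apply/le_anti; rewrite Tv0 rnorm_ge0.
rewrite scaler_eq0 => /orP[/eqP/(@complexI R)/eqP|/eqP->]; last exact: rnorm0.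
by rewrite invr_eq0 gt_eqF.
Qed.

HB.instance Definition _ := Lmodule_isNormed.Build R[i] bop
  bop_normD bop_normZ bop_norm0_eq0.

Lemma bop_normE T : `|T| = (bop_norm T)%:C.
Proof. by []. Qed.

Lemma CauchySchwarz_inner (u v : H) : `|inner u v| <= `|u| * `|v|.
Proof.
have [->|v0] := eqVneq v 0; first by rewrite linear0r !normr0 mulr0.
have v2 : 0 < `|v| ^+ 2 by rewrite exprn_gt0 // normr_gt0.
have innerC : inner v u = (inner u v)^*%R by rewrite hermC expr0 mul1r.
rewrite -(@ler_pXn2r _ 2) ?nnegrE ?mulr_ge0 // exprMn.
rewrite -subr_ge0 -(pmulr_rge0 _ v2).
set p := inner u v; rewrite -/p in innerC.
suff <- : `| (`|v| ^+ 2) *: u - p *: v| ^+ 2 =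
    `|v| ^+ 2 * (`|u| ^+ 2 * `|v| ^+ 2 - `|p| ^+ 2) by rewrite exprn_ge0.
rewrite sqr_norm_inner.
rewrite linearBl linearBr linearBr /= !linearZl_LR !linearZr_LR /=.
rewrite -!sqr_norm_inner -/p innerC.
have -> : Num.conj (`|v| ^+ 2) = `|v| ^+ 2 :> R[i].
  by apply/CrealP; rewrite rpredX // normr_real.
rewrite (normCK p) /GRing.scale /=.
ring.
Qed.

Fact rank_one_subproof (a b : H) :
  (fun v => inner v b *: a) \in bounded_linear.
Proof.
apply/bounded_linearP; split.
  by move=> c u v; rewrite linearPl /= scalerDl scalerA.
exists (rnorm b * rnorm a) => [|v]; first by rewrite mulr_ge0 ?rnorm_ge0.
rewrite -lecR !rmorphM /= -!rnormE normrZ [leRHS]mulrC mulrA.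
by rewrite ler_wpM2r // CauchySchwarz_inner.
Qed.

Definition rank_one (a b : H) : bop := BOp (rank_one_subproof a b).

End BoundedOperators.

(* A free polynomial is its family of coefficients, indexed by the words in the
   letters 'I_d; the letters of a word are multiplied from left to right. *)
Definition freepoly (R : realType) (d : nat) :=
  {fsfun seq 'I_d -> R[i] with 0}.

Definition freepoly_eval (R : realType) (d : nat) (A : lalgType R[i])
    (p : freepoly R d) (x : 'rV[A]_d) : A :=
  \sum_(w <- finsupp p) p w *: \prod_(r <- w) x 0 r.

Definition freemx_eval (R : realType) (d I J : nat) (A : lalgType R[i])
    (delta : 'M[freepoly R d]_(I, J)) (x : 'rV[A]_d) : 'M[A]_(I, J) :=
  \matrix_(i, j) freepoly_eval (delta i j) x.

(* The norm of a matrix T of operators on V, acting from the J-fold to the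
   I-fold Hilbert direct sum of V. *)
Definition block_opnorm (R : realType) (V : zmodType) (N : V -> R) (I J : nat)
    (T : 'I_I -> 'I_J -> V -> V) : R :=
  opnorm (@l2norm R V N J) (@l2norm R V N I) (fun v i => \sum_j T i j (v j)).

Definition euclid_norm (R : realType) (n : nat) (v : 'cV[R[i]]_n) : R :=
  l2norm (@rnorm R R[i]) (fun i => v i 0).

(* The library norm on matrices is the largest absolute value of an entry,
   not the operator norm. *)
Definition mx_opnorm (R : realType) (n : nat) (X : 'M[R[i]]_n) : R :=
  opnorm (@euclid_norm R n) (@euclid_norm R n) (mulmx X).

Definition Bdelta_op (R : realType) (H : infHilbertType R) (d I J : nat)
    (delta : 'M[freepoly R d]_(I, J)) : set 'rV[bop H]_d :=
  [set x | block_opnorm (@rnorm R H)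
             (fun i j => bop_fun (freemx_eval delta x i j)) < 1].

Definition Bdelta_mx (R : realType) (d I J : nat)
    (delta : 'M[freepoly R d]_(I, J)) (n : nat) : set 'rV['M[R[i]]_n.+1]_d :=
  [set x | block_opnorm (@euclid_norm R n.+1)
             (fun i j => mulmx (freemx_eval delta x i j)) < 1].

Definition balanced (R : realType) (d : nat) (V : lmodType R[i])
    (Omega : set 'rV[V]_d) :=
  forall a : R[i], `|a| <= 1 ->
    forall x, Omega x -> Omega (\row_r (a *: x 0 r)).

(* A graded function on the tuples of square matrices of positive size; the
   argument n stands for the size n.+1. *)
Definition graded_fun (R : realType) (d : nat) :=
  forall n : nat, 'rV['M[R[i]]_n.+1]_d -> 'M[R[i]]_n.+1.

Definition nc_function_mx (R : realType) (d I J : nat)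
    (delta : 'M[freepoly R d]_(I, J)) (f : graded_fun R d) :=
  forall (m n : nat) (L : 'M[R[i]]_(n.+1, m.+1))
    (x : 'rV['M[R[i]]_m.+1]_d) (y : 'rV['M[R[i]]_n.+1]_d),
    Bdelta_mx delta x -> Bdelta_mx delta y ->
    (forall r, L *m x 0 r = y 0 r *m L) ->
    L *m f m x = f n y *m L.

Definition bounded_mx (R : realType) (d I J : nat)
    (delta : 'M[freepoly R d]_(I, J)) (f : graded_fun R d) :=
  exists M : R, forall (n : nat) (x : 'rV['M[R[i]]_n.+1]_d),
    Bdelta_mx delta x -> mx_opnorm (f n x) <= M.

Definition locally_bounded_on (R : realType) (T : topologicalType)
    (V : normedModType R[i]) (Omega : set T) (F : T -> V) :=
  forall x, Omega x -> bounded_near F (within Omega (nbhs x)).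

Definition nc_function_op (R : realType) (H : infHilbertType R) (d : nat)
    (Omega : set 'rV[bop H]_d) (F : 'rV[bop H]_d -> bop H) :=
  locally_bounded_on Omega F /\
  (forall (L : bop H) (x y : 'rV[bop H]_d), Omega x -> Omega y ->
    (forall r, L * x 0 r = y 0 r * L) -> L * F x = F y * L).

Definition orthonormal_basis (R : realType) (H : infHilbertType R) (B : eqType)
    (e : B -> H) :=
  (forall b c, inner (e b) (e c) = (b == c)%:R) /\
  (forall v, (forall b, inner v (e b) = 0) -> v = 0).

(* The first n basis vectors are u 0, ..., u n.-1 *)
Definition embed_mx (R : realType) (H : infHilbertType R) (u : nat -> H)
    (n : nat) (X : 'M[R[i]]_n) : bop H :=
  \sum_(i < n) \sum_(j < n) X i j *: rank_one (u i) (u j).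

Definition embed_tuple (R : realType) (H : infHilbertType R) (u : nat -> H)
    (d n : nat) (x : 'rV['M[R[i]]_n]_d) : 'rV[bop H]_d :=
  \row_r embed_mx u (x 0 r).

(* F agrees with f on the first block: embed_mx u 1 is the projection onto
   the span of the first n.+1 basis vectors. Outside of the first block, F
   cannot be required to vanish: the tuple 0 of any size is mapped to the
   same operator tuple 0, and intertwining forces F 0 to be a scalar
   operator, namely the one of the scalar f 0. *)
Definition extends (R : realType) (H : infHilbertType R) (u : nat -> H)
    (d I J : nat) (delta : 'M[freepoly R d]_(I, J)) (f : graded_fun R d)
    (F : 'rV[bop H]_d -> bop H) :=
  forall (n : nat) (x : 'rV['M[R[i]]_n.+1]_d), Bdelta_mx delta x ->
    F (embed_tuple u x) * embed_mx u (1 : 'M[R[i]]_n.+1) = embed_mx u (f n x).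

(* Main.v *)
(** If the ball is nonempty it contains 0. By intertwining with truncated Fock
tuples, [f] is given on nilpotent tuples by one series [sum_w c_w x^w]; let
[f_l] be its homogeneous part of degree [l].

For [x] in the ball of B(H) all rotations of [x] are in the ball, uniformly by
compactness of the circle, and Fourier analysis shows that so is [x (x) S], with
[S] the unilateral shift. Its restriction to the cyclic subspace of
[xi (x) e_0] has finite-dimensional homogeneous pieces, hence a copy [z] on a
sequence of basis vectors of [H], whose truncations [z_N] to degrees [< N] are
matrices in the ball. The degree [l] component of [f(z_N) k_0] is [f_l(x) xi], so
[|f_l(x) xi| <= M |xi|]. As the ball is open, [x = t x'] with [t < 1] and [x'] in
the ball, so [F = sum_l f_l] converges.

Uniqueness: [sum_l t^l Gam_l] intertwines the model [z] of [x'] with [t x'], so an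
NC function at [t x'] is determined by its values at [z], hence at the matrices
[z_N]. Extension: [t x'] and [z_N] are coupled by a small off-diagonal corner, and
the bound on [f] gives [f(t x') = F(t x')] as [N] grows.

If the ball of B(H) is empty, [F] only has to interpolate [f], and a tuple of
matrices in the ball is determined by its embedding. *)

Require Import Defs.
From mathcomp Require Import all_boot all_order all_algebra.
From mathcomp Require Import sesquilinear complex finmap cyclic separable cyclotomic.
From mathcomp Require Import ring lra.
From mathcomp Require Import all_classical all_reals all_analysis.

Set Implicit Arguments.
Unset Strict Implicit.
Unset Printing Implicit Defensive.

Import Order.TTheory GRing.Theory Num.Theory.
Import numFieldNormedType.Exports.

Local Open Scope classical_set_scope.
Local Open Scope complex_scope.
Local Open Scope ring_scope.

(** * Hilbert space geometry and bounded operators *)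

(** The obstacle is that [f] is known on matrices only, while cutting an operator tuple [x] down to
    a finite block may leave the ball: a projection need not intertwine [x] with its compression.
    Tensoring with the shift removes the obstacle. The model raises degrees, so the vectors of
    degree [>= N] form an invariant subspace, and projecting onto degrees [< N] does intertwine the
    model with its truncation; every free polynomial, hence [delta], is compressed along. The
    truncation is also nilpotent, so [f] is a finite sum there and no analyticity of [f] has to be
    established beforehand. Two constraints follow. The copy of the model fills only part of [H]; on
    the rest the tuple is 0 and [delta] acts through its constant terms, so 0 must lie in the ball.
    And the intertwiner from the model of [x'] to [t x'] does not survive truncation exactly: it
    fails in the top degree, by a term of size [t ^ N]. A corner of fixed size [gamma] can absorb a
    failure of size [gamma], so the intertwiner is first magnified by [gamma / t ^ N]; this factor
    is what turns the mere boundedness of [f] into convergence. *)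

Section Hilbert.
Variables (R : realType) (H : infHilbertType R).
Implicit Types (u v w : H) (c : R[i]).

Lemma innerC u v : inner v u = (inner u v)^*.
Proof. by rewrite hermC expr0 mul1r. Qed.

Lemma innerZl c u v : inner (c *: u) v = c * inner u v.
Proof. by rewrite linearZl_LR. Qed.

Lemma innerZr c u v : inner u (c *: v) = c^* * inner u v.
Proof. by rewrite linearZr_LR. Qed.

Lemma innerDl u v w : inner (u + v) w = inner u w + inner v w.
Proof. by rewrite linearDl. Qed.

Lemma innerDr u v w : inner w (u + v) = inner w u + inner w v.
Proof. by rewrite linearDr. Qed.

Lemma innerBr u v w : inner w (u - v) = inner w u - inner w v.
Proof. by rewrite linearBr. Qed.

Lemma innerBl u v w : inner (u - v) w = inner u w - inner v w.
Proof. by rewrite linearBl. Qed.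

Lemma inner_suml (I : Type) (r : seq I) (P : pred I) (F : I -> H) v :
  inner (\sum_(i <- r | P i) F i) v = \sum_(i <- r | P i) inner (F i) v.
Proof.
elim/big_rec2: _ => [|i a b _ <-]; first by rewrite linear0l.
by rewrite linearDl.
Qed.

Lemma inner_sumr (I : Type) (r : seq I) (P : pred I) (F : I -> H) v :
  inner v (\sum_(i <- r | P i) F i) = \sum_(i <- r | P i) inner v (F i).
Proof. by rewrite linear_sumr. Qed.

Definition sqn (W : normedZmodType R[i]) (w : W) : R := rnorm w ^+ 2.

Lemma sqn_ge0 (W : normedZmodType R[i]) (w : W) : 0 <= sqn w.
Proof. by rewrite sqr_ge0. Qed.

Lemma sqn0 (W : normedZmodType R[i]) : sqn (0 : W) = 0.
Proof. by rewrite /sqn rnorm0 expr0n. Qed.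

Lemma sqn_eq0 (W : normedZmodType R[i]) (w : W) : sqn w = 0 -> w = 0.
Proof. by move=> /eqP; rewrite sqrf_eq0 => /eqP/rnorm_eq0. Qed.

Lemma rnormN (W : normedZmodType R[i]) (w : W) : rnorm (- w) = rnorm w.
Proof. by rewrite /rnorm normrN. Qed.

Lemma rnorm_real (a : R) : rnorm (a%:C) = `|a|.
Proof. by rewrite /rnorm normc_def /= expr0n addr0 sqrtr_sqr. Qed.

Lemma rnormM c c' : rnorm (c * c') = rnorm c * rnorm c'.
Proof. by apply: (@complexI R); rewrite rmorphM /= -!rnormE normrM. Qed.

Lemma rnorm1 : rnorm (1 : R[i]) = 1.
Proof. by rewrite -[1]/(1%:C) rnorm_real normr1. Qed.

Lemma rnormX c n : rnorm (c ^+ n) = rnorm c ^+ n.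
Proof.
elim: n => [|n IH]; first by rewrite !expr0 rnorm1.
by rewrite !exprS rnormM IH.
Qed.

Lemma rnorm_conj c : rnorm (c^*) = rnorm c.
Proof. by rewrite /rnorm norm_conjC. Qed.

Lemma sqn_mulconj c : c * c^* = (sqn c)%:C.
Proof. by rewrite -normCK rnormE -rmorphXn. Qed.

Lemma sqnZ c v : sqn (c *: v) = sqn c * sqn v.
Proof. by rewrite /sqn rnormZ exprMn. Qed.

Lemma rnorm_sum (W : normedModType R[i]) (I : Type) (r : seq I) (P : pred I) (F : I -> W) :
  rnorm (\sum_(i <- r | P i) F i) <= \sum_(i <- r | P i) rnorm (F i).
Proof.
elim/big_rec2: _ => [|i a b _ h]; first by rewrite rnorm0.
by rewrite (le_trans (rnormD _ _)) // lerD2l.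
Qed.

Lemma rnorm_le_sqn (W : normedZmodType R[i]) (w : W) (a : R) : 0 <= a ->
  (rnorm w <= a) = (sqn w <= a ^+ 2).
Proof. by move=> a0; rewrite ler_pXn2r ?nnegrE ?rnorm_ge0. Qed.

Lemma innerE v : inner v v = (sqn v)%:C.
Proof. by rewrite -sqr_norm_inner rnormE -rmorphXn. Qed.

Lemma inner_eq0 v : inner v v = 0 -> v = 0.
Proof. by rewrite innerE => /(@complexI R)/sqn_eq0. Qed.

Lemma rnorm_inner u v : rnorm (inner u v) <= rnorm u * rnorm v.
Proof. by rewrite -lecR rmorphM /= -!rnormE CauchySchwarz_inner. Qed.

Lemma sqnD_orth u v : inner u v = 0 -> sqn (u + v) = sqn u + sqn v.
Proof.
move=> uv; apply: (@complexI R); rewrite rmorphD /= -!innerE innerDl !innerDr.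
by rewrite uv (innerC u v) uv conjC0 addr0 add0r.
Qed.

Lemma sqn_le2 u v : sqn (u + v) <= 2 * sqn u + 2 * sqn v.
Proof.
have := rnormD u v; have := rnorm_ge0 (u + v); rewrite /sqn.
move: (rnorm (u + v)) (rnorm u) (rnorm v) => a b c a0 abc.
have := sqr_ge0 (b - c); have : a ^+ 2 <= (b + c) ^+ 2.
  by rewrite ler_pXn2r ?nnegrE // (le_trans a0).
by nra.
Qed.

Lemma sqn_sum_orth (I : eqType) (r : seq I) (P : pred I) (F : I -> H) :
  uniq r -> (forall i j, i != j -> inner (F i) (F j) = 0) ->
  sqn (\sum_(i <- r | P i) F i) = \sum_(i <- r | P i) sqn (F i).
Proof.
move=> + orF; elim: r => [|i r IH]; first by rewrite !big_nil sqn0.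
rewrite cons_uniq => /andP[ir ur]; rewrite !big_cons; case: ifP => Pi; last exact: IH.
rewrite sqnD_orth ?IH // inner_sumr big_seq_cond big1 // => j /andP[jr _].
by rewrite orF //; apply: contraNneq ir => ->.
Qed.

Definition orthonormal_family (I : eqType) (g : I -> H) :=
  forall i j, inner (g i) (g j) = (i == j)%:R.

Lemma orthonormal_sqn (I : eqType) (g : I -> H) i : orthonormal_family g -> sqn (g i) = 1.
Proof. by move=> og; apply: (@complexI R); rewrite -innerE og eqxx. Qed.

Lemma sqn_orthonormal (I : eqType) (g : I -> H) (r : seq I) (P : pred I) (c : I -> R[i]) :
  orthonormal_family g -> uniq r ->
  sqn (\sum_(i <- r | P i) c i *: g i) = \sum_(i <- r | P i) sqn (c i).
Proof.
move=> og ur; rewrite sqn_sum_orth //.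
  by apply: eq_bigr => i _; rewrite sqnZ orthonormal_sqn ?mulr1.
by move=> i j ij; rewrite innerZl innerZr og (negbTE ij) !mulr0.
Qed.

Lemma inner_orthonormal (I : eqType) (g : I -> H) (r : seq I) (c : I -> R[i]) i :
  orthonormal_family g -> uniq r -> i \in r ->
  inner (\sum_(j <- r) c j *: g j) (g i) = c i.
Proof.
move=> og ur ir; rewrite inner_suml (bigD1_seq i) //= innerZl og eqxx mulr1.
by rewrite big1 ?addr0 // => j ji; rewrite innerZl og (negbTE ji) mulr0.
Qed.

Lemma pythagoras_orthonormal (I : eqType) (g : I -> H) (r : seq I) v :
  orthonormal_family g -> uniq r ->
  sqn v = \sum_(i <- r) sqn (inner v (g i)) +
          sqn (v - \sum_(i <- r) inner v (g i) *: g i).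
Proof.
move=> og ur; set p := \sum_(i <- r) inner v (g i) *: g i.
have -> : sqn v = sqn (p + (v - p)) by rewrite addrC subrK.
rewrite (@sqnD_orth p) ?sqn_orthonormal //.
rewrite {1}/p inner_suml big_seq big1 // => i ir.
rewrite innerZl innerBr (innerC p (g i)) inner_orthonormal //.
by rewrite -innerC subrr mulr0.
Qed.

Lemma bessel (I : eqType) (g : I -> H) (r : seq I) v :
  orthonormal_family g -> uniq r -> \sum_(i <- r) sqn (inner v (g i)) <= sqn v.
Proof.
by move=> og ur; rewrite (pythagoras_orthonormal v og ur) lerDl sqn_ge0.
Qed.

Lemma sqn_innerC u v : sqn (inner u v) = sqn (inner v u).
Proof. by rewrite innerC /sqn rnorm_conj. Qed.

End Hilbert.

Section GramSchmidt.
Variables (R : realType) (H : infHilbertType R).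
Implicit Types (u v w : H) (c : R[i]).

(** A total function with a bound, so that the induction of [gram_schmidt_nat] can add a vector
    without changing the index type. *)
Definition orthonormal_upto (n : nat) (g : nat -> H) :=
  forall i j, (i < n)%N -> (j < n)%N -> inner (g i) (g j) = (i == j)%:R.

Lemma orthonormal_upto_ord n (g : nat -> H) :
  orthonormal_upto n g <-> orthonormal_family (fun i : 'I_n => g i).
Proof.
split=> [og i j|og i j ilt jlt]; first by rewrite og.
by have := og (Ordinal ilt) (Ordinal jlt).
Qed.

(** A dimension count without dimensions: if [u 0, ..., u n] all lay in the span of the [n] vectors
    [g i], the double sum of [|<u k, g i>|^2] would be [n.+1] when summed over [i] first, and at
    most [n] by Bessel when summed over [k] first. *)
Lemma exists_orthonormal_extension (u : nat -> H) n (g : nat -> H) :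
  orthonormal_family u -> orthonormal_upto n g ->
  exists h : H, sqn h = 1 /\ forall i, (i < n)%N -> inner h (g i) = 0.
Proof.
move=> ou /orthonormal_upto_ord og.
pose p v := \sum_(i < n) inner v (g i) *: g i.
have [k kP] : exists k, u k - p (u k) != 0.
  apply: contrapT => /forallNP up.
  have e1 k : 1 = \sum_(i < n) sqn (inner (u k) (g i)).
    rewrite -(orthonormal_sqn k ou).
    rewrite [LHS](pythagoras_orthonormal (u k) og (index_enum_uniq _)).
    by move: (up k) => /negP; rewrite negbK => /eqP ->; rewrite sqn0 addr0.
  have : (n.+1%:R : R) <= n%:R.
    have -> : (n.+1%:R : R) = \sum_(k < n.+1) \sum_(i < n) sqn (inner (u k) (g i)).
      by rewrite -[in LHS](card_ord n.+1) -sumr_const; apply: eq_bigr => k _; exact: e1.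
    rewrite exchange_big /= -[in leRHS](card_ord n) -sumr_const.
    apply: ler_sum => i _; rewrite -(orthonormal_sqn i og).
    rewrite (eq_bigr (fun k : 'I_n.+1 => sqn (inner (g i) (u k)))); last first.
      by move=> k _; rewrite sqn_innerC.
    rewrite -(big_mkord xpredT (fun k => sqn (inner (g i) (u k)))).
    exact: bessel ou (iota_uniq _ _).
  by rewrite ler_nat ltnn.
pose h := u k - p (u k).
have h0 : 0 < rnorm h.
  by rewrite lt_neqAle rnorm_ge0 andbT eq_sym; apply: contra_neq kP => /rnorm_eq0.
exists ((rnorm h)^-1%:C *: h); split.
  by rewrite sqnZ /sqn rnorm_real normfV (gtr0_norm h0) -exprMn mulVf ?expr1n // gt_eqF.
move=> i ilt; rewrite innerZl innerBl.
rewrite (inner_orthonormal (fun i : 'I_n => inner (u k) (g i)) og (index_enum_uniq _)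
  (mem_index_enum (Ordinal ilt))).
by rewrite subrr mulr0.
Qed.

Lemma gram_schmidt_nat (u : nat -> H) (v : nat -> H) n :
  orthonormal_family u -> exists g : nat -> H, orthonormal_upto n g /\
    forall i, (i < n)%N -> v i = \sum_(j < n) inner (v i) (g j) *: g j.
Proof.
move=> ou; elim: n => [|n [g [og gP]]]; first by exists u; split.
pose r := v n - \sum_(j < n) inner (v n) (g j) *: g j.
have og' := (orthonormal_upto_ord n g).1 og.
have rg i : (i < n)%N -> inner r (g i) = 0.
  move=> ilt; rewrite innerBl.
  have := inner_orthonormal (fun i : 'I_n => inner (v n) (g i)) og' (index_enum_uniq _)
    (mem_index_enum (Ordinal ilt)).
  by move=> /= ->; rewrite subrr.
(* When [v n] depends on the earlier vectors, any unit vector orthogonal to them is adjoined, so the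
   family keeps one vector per index. *)
have [h [h1 [hg hr]]] : exists h : H, sqn h = 1 /\
   (forall i, (i < n)%N -> inner h (g i) = 0) /\ r = inner (v n) h *: h.
  have [r0|r0] := eqVneq r 0.
    have [h [h1 hg]] := exists_orthonormal_extension ou og.
    exists h; split=> //; split=> //.
    suff -> : inner (v n) h = 0 by rewrite r0 scale0r.
    have -> : v n = \sum_(j < n) inner (v n) (g j) *: g j.
      by apply/eqP; rewrite -subr_eq0 -/r r0.
    rewrite inner_suml big1 // => i _.
    by rewrite innerZl (innerC h) hg // conjC0 mulr0.
  have nr0 : 0 < rnorm r.
    by rewrite lt_neqAle rnorm_ge0 andbT eq_sym; apply: contra_neq r0 => /rnorm_eq0.
  exists ((rnorm r)^-1%:C *: r); split.
    by rewrite sqnZ /sqn rnorm_real normfV (gtr0_norm nr0) -exprMn mulVf ?expr1n // gt_eqF.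
  split=> [i ilt|]; first by rewrite innerZl rg ?mulr0.
  rewrite innerZr; have -> : inner (v n) r = (sqn r)%:C.
    have -> : v n = r + \sum_(j < n) inner (v n) (g j) *: g j by rewrite subrK.
    rewrite innerDl innerE inner_suml big1 ?addr0 // => i _.
    by rewrite innerZl (innerC r) rg // conjC0 mulr0.
  rewrite scalerA mulrAC [_^* * _]mulrC sqn_mulconj -rmorphM /=.
  rewrite /sqn rnorm_real normfV (gtr0_norm nr0) -exprMn mulVf ?gt_eqF //.
  by rewrite expr1n scale1r.
pose g' i := if (i < n)%N then g i else h.
have g'E (i : 'I_n) : g' i = g i by rewrite /g' ltn_ord.
have g'n : g' n = h by rewrite /g' ltnn.
exists g'; split.
  move=> i j; rewrite !ltnS /g' => ilt jlt; case: (ltnP i n) => i_n; case: (ltnP j n) => j_n.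
  - exact: og.
  - by rewrite innerC hg // conjC0 ltn_eqF // (leq_trans i_n).
  - by rewrite hg // gtn_eqF // (leq_trans j_n).
  - by rewrite innerE h1; have -> : i = j by [apply/eqP;
    rewrite eqn_leq (leq_trans ilt) ?(leq_trans jlt)]; rewrite eqxx.
move=> i; rewrite ltnS leq_eqVlt => /orP[/eqP ->|ilt].
  rewrite big_ord_recr /= g'n -hr /r addrC; under eq_bigr do rewrite g'E.
  by rewrite subrK.
rewrite big_ord_recr /= g'n; under eq_bigr do rewrite g'E.
rewrite -gP //; suff -> : inner (v i) h = 0 by rewrite scale0r addr0.
rewrite gP // inner_suml big1 // => j _.
by rewrite innerZl (innerC h) hg // conjC0 mulr0.
Qed.

Lemma gram_schmidt (u : nat -> H) (T : finType) (v : T -> H) :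
  orthonormal_family u -> exists g : T -> H, orthonormal_family g /\
    forall t, v t = \sum_t' inner (v t) (g t') *: g t'.
Proof.
move=> ou.
pose v' n := if insub n is Some i then v (enum_val (i : 'I_#|T|)) else 0.
have [g [/orthonormal_upto_ord og gP]] := gram_schmidt_nat v' #|T| ou.
exists (fun t => g (enum_rank t)); split=> [i j|t].
  by rewrite og (inj_eq enum_rank_inj).
have := gP (enum_rank t) (ltn_ord _).
rewrite /v' valK enum_rankK {1}(reindex enum_rank) //.
by exists enum_val => i _; rewrite ?enum_rankK ?enum_valK.
Qed.

End GramSchmidt.

Section BoundedOperatorCalculus.
Variables (R : realType) (H : infHilbertType R).
Implicit Types (u v w : H) (c : R[i]) (S T : bop H).

Lemma bop_sumE (I : Type) (r : seq I) (P : pred I) (F : I -> bop H) v :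
  (\sum_(i <- r | P i) F i) v = \sum_(i <- r | P i) F i v.
Proof. by elim/big_rec2: _ => [//|i a b _ <-]. Qed.

Lemma bop_mulE S T v : (S * T) v = S (T v). Proof. by []. Qed.
Lemma bop_addE S T v : (S + T) v = S v + T v. Proof. by []. Qed.
Lemma bop_oppE T v : (- T) v = - T v. Proof. by []. Qed.
Lemma bop_scaleE c T v : (c *: T) v = c *: T v. Proof. by []. Qed.
Lemma bop_oneE v : (1 : bop H) v = v. Proof. by []. Qed.
Lemma bop_zeroE v : (0 : bop H) v = 0. Proof. by []. Qed.
Definition bopE := (bop_mulE, bop_addE, bop_oppE, bop_scaleE, bop_oneE, bop_zeroE).

Lemma rank_oneE (a b : H) v : rank_one a b v = inner v b *: a. Proof. by []. Qed.

Lemma mul_rank_one T (a b : H) : T * rank_one a b = rank_one (T a) b.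
Proof. by apply: bopP => v; rewrite bopE !rank_oneE linearZ. Qed.

Lemma rank_one0 (b : H) : rank_one 0 b = 0.
Proof. by apply: bopP => v; rewrite rank_oneE scaler0. Qed.

Lemma rank_oneZl c (a b : H) : rank_one (c *: a) b = c *: rank_one a b.
Proof. by apply: bopP => v; rewrite bopE !rank_oneE scalerA mulrC -scalerA. Qed.

(** A relation, not an operation: no Riesz representation is involved, and the operators that need
    an adjoint come with an explicit one. *)
Definition adjoint_of S T := forall u v, inner (S u) v = inner u (T v).

Lemma adjoint_rank_one (a b : H) : adjoint_of (rank_one a b) (rank_one b a).
Proof. by move=> u v; rewrite !rank_oneE innerZl innerZr -innerC mulrC. Qed.

Lemma adjoint_sum (I : Type) (r : seq I) (P : pred I) (F G : I -> bop H) :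
  (forall i, adjoint_of (F i) (G i)) ->
  adjoint_of (\sum_(i <- r | P i) F i) (\sum_(i <- r | P i) G i).
Proof.
move=> FG u v; rewrite !bop_sumE inner_suml inner_sumr.
by apply: eq_bigr => i _; exact: FG.
Qed.

Lemma adjoint_sym S T : adjoint_of S T -> adjoint_of T S.
Proof. by move=> ST u v; rewrite innerC -ST -innerC. Qed.

Lemma adjoint_mul S T S' T' : adjoint_of S S' -> adjoint_of T T' ->
  adjoint_of (S * T) (T' * S').
Proof. by move=> hS hT u v; rewrite !bop_mulE hS hT. Qed.

Lemma rnorm_bop_le T v : rnorm (T v) <= rnorm T * rnorm v.
Proof.
have [->|v0] := eqVneq v 0; first by rewrite linear0 !rnorm0 mulr0.
have nv0 : 0 < rnorm v.
  by rewrite lt_neqAle rnorm_ge0 andbT eq_sym; apply: contra_neq v0 => /rnorm_eq0.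
rewrite -ler_pdivrMr //.
have := @bop_norm_ub _ _ T ((rnorm v)^-1%:C *: v).
rewrite linearZ !rnormZ /= rnorm_real normfV (gtr0_norm nv0) mulVf ?gt_eqF //.
by move=> /(_ (lexx _)); rewrite mulrC.
Qed.

Lemma rnorm_bop_ub T (C : R) : 0 <= C ->
  (forall v, rnorm (T v) <= C * rnorm v) -> rnorm T <= C.
Proof.
move=> C0 TC; apply: bop_norm_le => v v1.
by rewrite (le_trans (TC v)) // ler_piMr.
Qed.

Lemma rnorm_bop_mul S T : rnorm (S * T) <= rnorm S * rnorm T.
Proof.
apply: rnorm_bop_ub => [|v]; first by rewrite mulr_ge0 ?rnorm_ge0.
rewrite bop_mulE (le_trans (rnorm_bop_le _ _)) // -mulrA.
by rewrite ler_wpM2l ?rnorm_ge0 ?rnorm_bop_le.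
Qed.

Lemma sqn_bop_le T v : sqn (T v) <= sqn T * sqn v.
Proof.
by rewrite -exprMn ler_pXn2r ?nnegrE ?mulr_ge0 ?rnorm_ge0 ?rnorm_bop_le.
Qed.

(** [S] is a partial isometry: [|S v|^2 = <v, T S v>] is at most [|v| |T S v|], and
    [|T S v| = |S v|]. *)
Lemma sqn_adjoint S T : adjoint_of S T -> S * T * S = S -> forall v, sqn (S v) <= sqn v.
Proof.
move=> ST STS v.
have e : inner v (T (S v)) = (sqn (S v))%:C by rewrite -ST innerE.
have e2 : sqn (T (S v)) = sqn (S v).
  apply: (@complexI R); rewrite -!innerE (adjoint_sym ST) -!bop_mulE STS //.
have := rnorm_inner v (T (S v)); rewrite e rnorm_real ger0_norm ?sqn_ge0 //.
have -> : rnorm (T (S v)) = rnorm (S v).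
  by apply/eqP; rewrite -(@eqrXn2 _ 2) ?rnorm_ge0 //; apply/eqP; exact: e2.
rewrite /sqn expr2; have := rnorm_ge0 (S v); rewrite le_eqVlt => /orP[/eqP <-|s0].
  by rewrite mul0r sqr_ge0.
by rewrite ler_pM2r // => h; rewrite -expr2 ler_pXn2r ?nnegrE ?rnorm_ge0.
Qed.

(** Norm convergence in [H], phrased with the real-valued norm so that squeezing and limits of sums
    take place in [R]. *)
Definition cvs (x : nat -> H) (l : H) := (fun n => rnorm (x n - l)) @ \oo --> (0 : R).

Lemma cvs_eps x l : (forall e : R, 0 < e -> exists N, forall n, (N <= n)%N ->
  rnorm (x n - l) < e) <-> cvs x l.
Proof.
split=> [h|/cvgrPdist_lt h e e0].
  apply/cvgrPdist_lt => e e0; have [N hN] := h _ e0; exists N => // n /= Nn.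
  by rewrite sub0r normrN ger0_norm ?rnorm_ge0 // hN.
have [N _ hN] := h _ e0; exists N => n Nn; have := hN n Nn.
by rewrite sub0r normrN ger0_norm ?rnorm_ge0.
Qed.

Lemma cvs_dom (x : nat -> H) l (a : nat -> R) : (forall n, rnorm (x n - l) <= a n) ->
  a @ \oo --> (0 : R) -> cvs x l.
Proof.
move=> xa a0; apply: (@squeeze_cvgr _ _ _ _ (fun=> 0) a) => //; last exact: cvg_cst.
by apply: nearW => n; rewrite rnorm_ge0 xa.
Qed.

Lemma cvs_unique x l l' : cvs x l -> cvs x l' -> l = l'.
Proof.
move=> xl xl'; apply/eqP; rewrite -subr_eq0; apply/eqP/rnorm_eq0/le_anti.
rewrite rnorm_ge0 andbT.
have /cvgrPdist_le h : (fun n => rnorm (x n - l) + rnorm (x n - l')) @ \oo --> (0 + 0 : R).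
  exact: cvgD.
apply/ler_addgt0Pr => e e0; have [N _ /(_ N (leqnn _))] := h e e0.
rewrite !add0r normrN ger0_norm ?addr_ge0 ?rnorm_ge0 // => h'.
rewrite (le_trans _ h') // -(rnormN (x N - l)) (le_trans _ (rnormD _ _)) //.
by rewrite opprB addrA subrK.
Qed.

Lemma cvs_bop T x l : cvs x l -> cvs (fun n => T (x n)) (T l).
Proof.
move=> xl; apply: (@cvs_dom _ _ (fun n => rnorm T * rnorm (x n - l))).
  by move=> n; rewrite -linearB rnorm_bop_le.
by rewrite -[0](mulr0 (rnorm T)); apply: cvgM => //; exact: cvg_cst.
Qed.

Lemma cvsD x y l m : cvs x l -> cvs y m -> cvs (fun n => x n + y n) (l + m).
Proof.
move=> xl ym; apply: (@cvs_dom _ _ (fun n => rnorm (x n - l) + rnorm (y n - m))).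
  by move=> n; rewrite opprD addrACA rnormD.
by rewrite -[0](addr0 0); apply: cvgD.
Qed.

Lemma cvsZ c x l : cvs x l -> cvs (fun n => c *: x n) (c *: l).
Proof.
move=> xl; apply: (@cvs_dom _ _ (fun n => rnorm c * rnorm (x n - l))).
  by move=> n; rewrite -scalerBr rnormZ.
by rewrite -[0](mulr0 (rnorm c)); apply: cvgM => //; exact: cvg_cst.
Qed.

Lemma cvs_cst l : cvs (fun=> l) l.
Proof. by rewrite /cvs subrr rnorm0; exact: cvg_cst. Qed.

Lemma cvs_near N x l : (forall n, (N <= n)%N -> x n = l) -> cvs x l.
Proof.
move=> xl; apply/cvs_eps => e e0; exists N => n Nn.
by rewrite xl // subrr rnorm0.
Qed.

Lemma cvs_sqn x l : cvs x l -> (fun n => sqn (x n)) @ \oo --> sqn l.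
Proof.
move=> xl; have h : (fun n => rnorm (x n)) @ \oo --> rnorm l.
  apply/cvgrPdist_le => e e0; have /cvgrPdist_le/(_ e e0)[N _ hN] := xl.
  exists N => // n /= Nn; have := hN n Nn.
  rewrite /= sub0r normrN ger0_norm ?rnorm_ge0 //; apply: le_trans.
  rewrite ler_norml lerBrDr lerBlDr.
  have := rnormD (x n - l) l; rewrite subrK => h1.
  have := rnormD (l - x n) (x n); rewrite subrK -opprB rnormN => h2.
  by apply/andP; split; lra.
rewrite /sqn (_ : (fun n => rnorm (x n) ^+ 2) = (fun n => rnorm (x n) * rnorm (x n))).
  by rewrite expr2; apply: cvgM.
by apply/funext => n; rewrite expr2.
Qed.

Lemma cvs_sqn_le x l (C : R) : cvs x l -> (forall n, sqn (x n) <= C) -> sqn l <= C.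
Proof.
move=> /cvs_sqn xl xC; rewrite -(cvg_lim _ xl) //.
by apply: limr_le; [apply/cvg_ex; exists (sqn l)|apply: nearW].
Qed.

(** For an orthogonal series, [a] is the sequence of squared norms of the partial sums. Once [a] is
    within [e ^+ 2] of its supremum, the increments of [x] are smaller than [e]. *)
Lemma cvs_complete x (a : nat -> R) (A : R) : (forall n, a n <= A) ->
  (forall m n, (m <= n)%N -> sqn (x n - x m) <= a n - a m) -> exists l, cvs x l.
Proof.
move=> aA xa.
have hs : has_sup (range a).
  by split; [exists (a 0%N), 0%N | exists A => _ [n _ <-]].
have ca e : 0 < e -> exists N, forall n, (N <= n)%N -> rnorm (x n - x N) < e.
  move=> e0; have [|_ [N _ <-] hN] := @sup_adherent _ (range a) (e ^+ 2) _ hs.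
    by rewrite exprn_gt0.
  exists N => n Nn; rewrite -(@ltr_pXn2r _ 2) ?nnegrE ?rnorm_ge0 ?(ltW e0) //.
  rewrite (le_lt_trans (xa _ _ Nn)) // ltrBlDr.
  rewrite (@le_lt_trans _ _ (sup (range a))) //; last by rewrite addrC -ltrBlDr.
  by apply: sup_upper_bound => //; exists n.
have /cauchy_cvgP/cvg_ex[l xl] : cauchy (x @ \oo).
  apply/cauchyP => e e0.
  have eR : e = (complex.Re e)%:C by rewrite RRe_real // gtr0_real.
  rewrite eR ltcR in e0; have [N hN] := ca _ e0.
  exists (x N); exists N => // n /= Nn.
  by rewrite -ball_normE /ball_ /= eR distrC rnormE ltcR hN.
exists l; apply/cvs_eps => e e0.
have : 0 < e%:C by rewrite ltcR.
move/cvgrPdist_lt: xl => /[apply] -[N _ hN]; exists N => n Nn.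
by have := hN n Nn; rewrite distrC /= rnormE ltcR.
Qed.

Lemma bop_limit (T : nat -> bop H) (C : R) : 0 <= C ->
  (forall n v, sqn (T n v) <= C * sqn v) ->
  (forall v, exists l, cvs (fun n => T n v) l) ->
  exists S, (forall v, cvs (fun n => T n v) (S v)) /\ forall v, sqn (S v) <= C * sqn v.
Proof.
move=> C0 TC Tc.
pose s v := sval (cid (Tc v)).
have sP v : cvs (fun n => T n v) (s v) := svalP (cid (Tc v)).
have sC v : sqn (s v) <= C * sqn v by apply: cvs_sqn_le (sP v) _ => n; exact: TC.
have sB : s \in @bounded_linear R H.
  apply/bounded_linearP; split.
    move=> c u v; apply: cvs_unique (sP _) _.
    have := cvsD (cvsZ c (sP u)) (sP v).
    by congr (cvs _ _); apply/funext => n; rewrite linearP.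
  exists (Num.sqrt C) => [|v]; first exact: sqrtr_ge0.
  rewrite rnorm_le_sqn ?mulr_ge0 ?sqrtr_ge0 ?rnorm_ge0 // exprMn sqr_sqrtr //.
by exists (BOp sB).
Qed.

End BoundedOperatorCalculus.

(** * The ball of delta *)

Section OperatorNorm.
Variables (R : realType) (V W : lmodType R[i]) (NV : V -> R) (NW : W -> R).
Variables (T : V -> W) (K : R).
Hypotheses (NV0 : forall v, 0 <= NV v) (NW0 : forall w, 0 <= NW w).
Hypotheses (NVZ : forall (a : R) v, NV (a%:C *: v) = `|a| * NV v)
  (NWZ : forall (a : R) w, NW (a%:C *: w) = `|a| * NW w).
Hypothesis TZ : forall (a : R) v, T (a%:C *: v) = a%:C *: T v.
Hypothesis TK : forall v, NW (T v) <= K * NV v.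

Let N0 : NV 0 = 0.
Proof. by rewrite -(scale0r (0 : V)) -[0 : R[i]]/((0 : R)%:C) NVZ normr0 mul0r. Qed.

Let has_supT : has_sup [set NW (T v) | v in [set v | NV v <= 1]].
Proof.
split; first by exists (NW (T 0)), 0 => //=; rewrite N0.
exists `|K| => _ [v /= v1 <-]; rewrite (le_trans (TK v)) //.
by rewrite (le_trans (ler_norm _)) // normrM ler_piMr // ger0_norm.
Qed.

Lemma opnorm_ub v : NW (T v) <= opnorm NV NW T * NV v.
Proof.
have [v0|v0] := eqVneq (NV v) 0; first by have := TK v; rewrite v0 !mulr0.
have nv0 : 0 < NV v by rewrite lt_neqAle NV0 eq_sym v0.
rewrite -ler_pdivrMr //.
have -> : NW (T v) / NV v = NW (T ((NV v)^-1%:C *: v)).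
  by rewrite TZ NWZ ger0_norm ?invr_ge0 // mulrC.
apply: sup_upper_bound => //; exists ((NV v)^-1%:C *: v) => //=.
by rewrite NVZ ger0_norm ?invr_ge0 // mulVf.
Qed.

Lemma opnorm_le (M : R) : 0 <= M -> (forall v, NW (T v) <= M * NV v) -> opnorm NV NW T <= M.
Proof.
move=> M0 TM; apply: sup_le_ub; first by case: has_supT.
by move=> _ [v /= v1 <-]; rewrite (le_trans (TM v)) // ler_piMr.
Qed.

Lemma opnorm_ge0 : 0 <= opnorm NV NW T.
Proof.
rewrite (le_trans (NW0 (T 0))) //; apply: sup_upper_bound => //.
by exists 0 => //=; rewrite N0.
Qed.

(** The quadratic form of the bound can be added up over orthogonal pieces, which the supremum
    cannot. The a priori bound [K] guarantees that the supremum defining [opnorm] is a genuine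
    one. *)
Lemma opnorm_lt1P : opnorm NV NW T < 1 <->
  exists rho, [/\ 0 <= rho, rho < 1 & forall v, NW (T v) ^+ 2 <= rho * NV v ^+ 2].
Proof.
split=> [T1|[rho [rho0 rho1 TM]]].
  exists (opnorm NV NW T ^+ 2); split; first by rewrite sqr_ge0.
    by rewrite expr_lt1 // opnorm_ge0.
  move=> v; rewrite -exprMn ler_pXn2r ?nnegrE ?opnorm_ub //.
  by rewrite mulr_ge0 ?opnorm_ge0.
apply: (@le_lt_trans _ _ (Num.sqrt rho)); last by rewrite -sqrtr1 ltr_sqrt.
apply: opnorm_le => [|v]; first exact: sqrtr_ge0.
rewrite -(@ler_pXn2r _ 2) ?nnegrE ?mulr_ge0 ?sqrtr_ge0 //.
by rewrite exprMn sqr_sqrtr.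
Qed.

End OperatorNorm.

Section L2.
Variables (R : realType) (V : lmodType R[i]) (N : V -> R).
Hypothesis NZ : forall (a : R) v, N (a%:C *: v) = `|a| * N v.

Lemma sqr_l2norm J (v : 'I_J -> V) : l2norm N v ^+ 2 = \sum_j N (v j) ^+ 2.
Proof. by rewrite sqr_sqrtr // sumr_ge0 // => j _; rewrite sqr_ge0. Qed.

Lemma l2normZ J (a : R) (v : 'I_J -> V) : l2norm N (a%:C *: v) = `|a| * l2norm N v.
Proof.
rewrite /l2norm -sqrtr_sqr -sqrtrM ?sqr_ge0 // mulr_sumr.
by congr Num.sqrt; apply: eq_bigr => j _; rewrite [X in N X]/= NZ exprMn real_normK ?num_real.
Qed.

End L2.

Section FreePolynomials.
Variables (R : realType) (d : nat).
Implicit Types (A : lalgType R[i]) (p : freepoly R d).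

Definition word A (x : 'rV[A]_d) (w : seq 'I_d) : A := \prod_(r <- w) x 0 r.

Definition scale_tuple (V : lmodType R[i]) (a : R[i]) (x : 'rV[V]_d) : 'rV[V]_d :=
  \row_r (a *: x 0 r).

Lemma word_nil A (x : 'rV[A]_d) : word x [::] = 1.
Proof. by rewrite /word big_nil. Qed.

Lemma word_cons A (x : 'rV[A]_d) r w : word x (r :: w) = x 0 r * word x w.
Proof. by rewrite /word big_cons. Qed.

Lemma word_scale (A : algType R[i]) a (x : 'rV[A]_d) w :
  word (scale_tuple a x) w = a ^+ size w *: word x w.
Proof.
elim: w => [|r w IH]; first by rewrite !word_nil scale1r.
by rewrite !word_cons IH mxE -scalerAl -scalerAr scalerA exprS.
Qed.

Lemma word_intertwine A (L : A) (x y : 'rV[A]_d) w :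
  (forall r, L * x 0 r = y 0 r * L) -> L * word x w = word y w * L.
Proof.
move=> Lxy; elim: w => [|r w IH]; first by rewrite !word_nil mulr1 mul1r.
by rewrite !word_cons mulrA Lxy -mulrA IH mulrA.
Qed.

Lemma eval_intertwine (A : algType R[i]) (L : A) (x y : 'rV[A]_d) p :
  (forall r, L * x 0 r = y 0 r * L) -> L * freepoly_eval p x = freepoly_eval p y * L.
Proof.
move=> Lxy; rewrite /freepoly_eval mulr_sumr mulr_suml; apply: eq_bigr => w _.
by rewrite -scalerAr -scalerAl; congr (_ *: _); exact: word_intertwine.
Qed.

End FreePolynomials.

Section Delta.
Variables (R : realType) (H : infHilbertType R) (d I J : nat).
Variable delta : 'M[freepoly R d]_(I, J).
Implicit Types (x y z : 'rV[bop H]_d) (v : 'I_J -> H).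

Definition delta_vec x v (i : 'I_I) : H := \sum_j freepoly_eval (delta i j) x (v j).

(** [rho] bounds the square of the norm of [delta x]; a tuple is in the ball when some [rho < 1] is
    admissible. *)
Definition delta_contr (rho : R) x :=
  forall v, \sum_i sqn (delta_vec x v i) <= rho * \sum_j sqn (v j).

Lemma freepoly_evalE (p : freepoly R d) x u :
  freepoly_eval p x u = \sum_(w <- finsupp p) p w *: word x w u.
Proof. by rewrite /freepoly_eval bop_sumE; apply: eq_bigr => w _. Qed.

Lemma delta_contr_mono rho rho' x : rho <= rho' -> delta_contr rho x -> delta_contr rho' x.
Proof.
move=> rr dx v; rewrite (le_trans (dx v)) // ler_wpM2r // sumr_ge0 // => j _.
exact: sqn_ge0.
Qed.

Lemma sqn_sum_le n (F : 'I_n -> H) : sqn (\sum_i F i) <= 2 ^+ n * \sum_i sqn (F i).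
Proof.
elim: n F => [|n IH] F; first by rewrite !big_ord0 sqn0 mulr0.
rewrite !big_ord_recr /= (le_trans (sqn_le2 _ _)) // mulrDr exprS -mulrA lerD //.
  by rewrite ler_wpM2l.
by rewrite ler_wpM2r ?sqn_ge0 // ler_peMr // exprn_ege1 // ler1n.
Qed.

Lemma delta_contr_bounded x : exists2 K : R, 0 <= K & delta_contr K x.
Proof.
pose C : R := \sum_i \sum_j sqn (freepoly_eval (delta i j) x).
have C0 : 0 <= C by apply: sumr_ge0 => i _; apply: sumr_ge0 => j _; exact: sqn_ge0.
exists (2 ^+ J * C) => [|v]; first by rewrite mulr_ge0.
rewrite /C mulrAC mulr_sumr; apply: ler_sum => i _.
rewrite (le_trans (sqn_sum_le _)) // -mulrA ler_wpM2l // mulr_sumr.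
apply: ler_sum => j _; rewrite (le_trans (sqn_bop_le _ _)) // mulrC ler_wpM2r ?sqn_ge0 //.
by rewrite (bigD1 j) //= lerDl sumr_ge0 // => k _; rewrite sqn_ge0.
Qed.

Lemma Bdelta_opP x : Bdelta_op delta x <->
  exists rho, [/\ 0 <= rho, rho < 1 & delta_contr rho x].
Proof.
have [K K0 bd] := delta_contr_bounded x.
pose T i j := bop_fun (freemx_eval delta x i j).
have TE v i : \sum_j T i j (v j) = delta_vec x v i.
  by apply: eq_bigr => j _; rewrite /T mxE.
have NZ (a : R) (h : H) : rnorm (a%:C *: h) = `|a| * rnorm h by rewrite rnormZ rnorm_real.
have E := @opnorm_lt1P R ('I_J -> H) ('I_I ->
  H) (@l2norm R H (@rnorm R H) J) (@l2norm R H (@rnorm R H) I)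
  (fun v i => \sum_j T i j (v j)) (Num.sqrt K).
have {}E := E (fun=> sqrtr_ge0 _) (fun=> sqrtr_ge0 _) (@l2normZ _ _ _ NZ J) (@l2normZ _ _ _
  NZ I).
have {}E : Bdelta_op delta x <-> _ := E _ _.
rewrite E.
  split=> -[rho [r0 r1 rP]]; exists rho; split=> // v.
    have := rP v; rewrite !sqr_l2norm; apply: le_trans.
    by apply: ler_sum => i _; rewrite TE.
  rewrite !sqr_l2norm; apply: le_trans (rP v).
  by apply: ler_sum => i _; rewrite TE.
- move=> a v; apply/funext => i; rewrite -[RHS]/(_ *: \sum_j T i j (v j)) scaler_sumr.
  by apply: eq_bigr => j _; rewrite /T -linearZ.
- move=> v; rewrite -(@ler_pXn2r _ 2) ?nnegrE ?mulr_ge0 ?sqrtr_ge0 //.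
  rewrite exprMn !sqr_l2norm sqr_sqrtr // (le_trans _ (bd v)) //.
  by apply: ler_sum => i _; rewrite TE.
Qed.

Lemma rnorm_word (R0 : R) x w : 0 <= R0 -> (forall r, rnorm (x 0 r) <= R0) ->
  rnorm (word x w) <= R0 ^+ size w.
Proof.
move=> R00 xR; elim: w => [|r w IH].
  by rewrite word_nil expr0; apply: rnorm_bop_ub => // v; rewrite mul1r.
rewrite word_cons exprS (le_trans (rnorm_bop_mul _ _)) //.
by rewrite ler_pM ?rnorm_ge0.
Qed.

Lemma word_lipschitz (R0 : R) w : 0 <= R0 -> exists2 C : R, 0 <= C &
  forall x y (eta : R), 0 <= eta -> (forall r, rnorm (x 0 r) <= R0) ->
    (forall r, rnorm (y 0 r) <= R0) -> (forall r, rnorm (y 0 r - x 0 r) <= eta) ->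
    rnorm (word y w - word x w) <= C * eta.
Proof.
move=> R00; elim: w => [|r w [C C0 IH]].
  by exists 0 => // x y eta *; rewrite !word_nil subrr rnorm0 mul0r.
exists (R0 * C + R0 ^+ size w) => [|x y eta eta0 xR yR xy].
  by rewrite addr_ge0 ?mulr_ge0 ?exprn_ge0.
have -> : word y (r :: w) - word x (r :: w) =
    y 0 r * (word y w - word x w) + (y 0 r - x 0 r) * word x w.
  by rewrite !word_cons mulrBr mulrBl addrA subrK.
rewrite [leRHS]mulrDl (le_trans (rnormD _ _)) // lerD //.
  rewrite (le_trans (rnorm_bop_mul _ _)) // -mulrA.
  by rewrite ler_pM ?rnorm_ge0 // IH.
rewrite (le_trans (rnorm_bop_mul _ _)) // mulrC.
by rewrite ler_pM ?rnorm_ge0 ?rnorm_word.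
Qed.

Lemma eval_lipschitz (R0 : R) (p : freepoly R d) : 0 <= R0 -> exists2 C : R, 0 <= C &
  forall x y (eta : R), 0 <= eta -> (forall r, rnorm (x 0 r) <= R0) ->
    (forall r, rnorm (y 0 r) <= R0) -> (forall r, rnorm (y 0 r - x 0 r) <= eta) ->
    rnorm (freepoly_eval p y - freepoly_eval p x) <= C * eta.
Proof.
move=> R00.
pose CP w := cid2 (word_lipschitz w R00); pose C w := s2val (CP w).
exists (\sum_(w <- finsupp p) rnorm (p w) * C w) => [|x y eta eta0 xR yR xy].
  by apply: sumr_ge0 => w _; rewrite mulr_ge0 ?rnorm_ge0 // /C; case: (CP w).
rewrite /freepoly_eval -sumrB mulr_suml (le_trans (rnorm_sum _ _ _)) //.
apply: ler_sum => w _; rewrite -scalerBr rnormZ -mulrA ler_wpM2l ?rnorm_ge0 //.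
by rewrite /C; case: (CP w) => /= c _; apply.
Qed.

Lemma sqnD_le (theta : R) (u w : H) : 0 < theta ->
  sqn (u + w) <= (1 + theta) * sqn u + (1 + theta^-1) * sqn w.
Proof.
move=> t0; have := rnormD u w; have := rnorm_ge0 (u + w); rewrite /sqn.
move: (rnorm (u + w)) (rnorm u) (rnorm w) => a b c a0 abc.
have h : a ^+ 2 <= (b + c) ^+ 2 by rewrite ler_pXn2r ?nnegrE // (le_trans a0).
rewrite (le_trans h) // -subr_ge0.
have -> : (1 + theta) * b ^+ 2 + (1 + theta^-1) * c ^+ 2 - (b + c) ^+ 2
  = theta^-1 * (theta * b - c) ^+ 2 by field; rewrite gt_eqF.
by rewrite mulr_ge0 ?invr_ge0 ?(ltW t0) ?sqr_ge0.
Qed.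

(** The ball is open, with constants that depend on the tuple only through [R0] and [rho]. This
    uniformity later allows one size of perturbation for all truncations of a model. *)
Lemma delta_contr_perturb (R0 rho : R) : 0 <= R0 -> 0 <= rho -> rho < 1 ->
  exists eta rho', [/\ 0 < eta, 0 <= rho', rho' < 1 &
   forall x y, (forall r, rnorm (x 0 r) <= R0) ->
    (forall r, rnorm (y 0 r - x 0 r) <= eta) -> delta_contr rho x -> delta_contr rho' y].
Proof.
move=> R00 rho0 rho1.
have R1 : 0 <= R0 + 1 by rewrite addr_ge0.
pose CP i j := cid2 (eval_lipschitz (delta i j) R1); pose C i j := s2val (CP i j).
pose K : R := 2 ^+ J * \sum_i \sum_j C i j ^+ 2.
have K0 : 0 <= K.
  by rewrite mulr_ge0 ?exprn_ge0 // sumr_ge0 // => i _; rewrite sumr_ge0 // => j _;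
    rewrite sqr_ge0.
(* The unperturbed part costs [(1 + theta) * rho], and [eta] is chosen to keep the rest below
   [(1 - rho) / 4]. The sum stays below [(3 + rho) / 4], with [(1 - rho) ^ 2 / 2] to spare. *)
pose theta := (1 - rho) / 2.
have t0 : 0 < theta by rewrite divr_gt0 // subr_gt0.
pose A := (1 + theta^-1) * K.
have A0 : 0 <= A by rewrite mulr_ge0 // addr_ge0 ?invr_ge0 ?(ltW t0).
pose eta := Num.min 1 ((1 - rho) / 4 / (A + 1)).
have A1 : 0 < A + 1 by rewrite ltr_wpDl.
have eta0 : 0 < eta by rewrite lt_min ltr01 !divr_gt0 // subr_gt0.
have eta1 : eta <= 1 by rewrite ge_min lexx.
have Aeta : A * eta ^+ 2 <= (1 - rho) / 4.
  have : eta * (A + 1) <= (1 - rho) / 4.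
    by rewrite -ler_pdivlMr // ge_min lexx orbT.
  apply: le_trans; rewrite expr2 mulrC -mulrA ler_wpM2l ?(ltW eta0) //.
  by rewrite (@le_trans _ _ A) ?lerDl // mulrC ler_piMr.
exists eta, ((3 + rho) / 4); split => //; try lra.
move=> x y xR yx dx v.
have yR r : rnorm (y 0 r) <= R0 + 1.
  rewrite -[y 0 r](subrK (x 0 r)) addrC (le_trans (rnormD _ _)) // lerD //.
  exact: le_trans (yx r) eta1.
have xR' r : rnorm (x 0 r) <= R0 + 1 by rewrite (le_trans (xR r)) // lerDl.
pose D i := delta_vec y v i - delta_vec x v i.
have S0 : 0 <= \sum_j sqn (v j) by rewrite sumr_ge0 // => j _; rewrite sqn_ge0.
have DP : \sum_i sqn (D i) <= K * eta ^+ 2 * \sum_j sqn (v j).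
  have -> : K * eta ^+ 2 * \sum_j sqn (v j) =
      \sum_i 2 ^+ J * \sum_j ((C i j * eta) ^+ 2 * \sum_j sqn (v j)).
    rewrite -mulr_sumr /K -!mulrA; congr (_ * _); rewrite mulr_suml.
    apply: eq_bigr => i _; rewrite mulr_suml; apply: eq_bigr => j _.
    by ring.
 apply: ler_sum => i _; rewrite /D /delta_vec -sumrB.
  rewrite (le_trans (sqn_sum_le _)) // ler_wpM2l ?exprn_ge0 //.
  apply: ler_sum => j _; rewrite -bop_oppE -bop_addE (le_trans (sqn_bop_le _ _)) //.
  have [C0 CL] : 0 <= C i j /\ rnorm (freepoly_eval (delta i j) y - freepoly_eval (delta i j)
    x) <= C i j * eta.
    by rewrite /C; case: (CP i j) => /= c c0 cP; split=> //; apply: cP => //; exact: ltW.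
  rewrite ler_pM ?sqn_ge0 // -?rnorm_le_sqn ?mulr_ge0 ?(ltW eta0) //.
  by rewrite (bigD1 j) //= lerDl sumr_ge0 // => k _; rewrite sqn_ge0.
have : \sum_i sqn (delta_vec y v i) <=
   (1 + theta) * \sum_i sqn (delta_vec x v i) + (1 + theta^-1) * \sum_i sqn (D i).
  rewrite !mulr_sumr -big_split; apply: ler_sum => i _ /=.
  have -> : delta_vec y v i = delta_vec x v i + D i by rewrite addrC subrK.
  exact: sqnD_le.
move=> h; apply: (le_trans h).
have h1 : (1 + theta) * \sum_i sqn (delta_vec x v i) <= (1 + theta) * rho * \sum_j sqn (v j).
  by rewrite -mulrA ler_wpM2l // addr_ge0 ?(ltW t0).
have h2 : (1 + theta^-1) * \sum_i sqn (D i) <= (1 - rho) / 4 * \sum_j sqn (v j).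
  apply: (@le_trans _ _ (A * eta ^+ 2 * \sum_j sqn (v j))); last by rewrite ler_wpM2r.
  have -> : A * eta ^+ 2 * \sum_j sqn (v j) = (1 +
    theta^-1) * (K * eta ^+ 2 * \sum_j sqn (v j)).
    by rewrite /A !mulrA.
  by rewrite ler_wpM2l // addr_ge0 // invr_ge0 ltW.
apply: (le_trans (lerD h1 h2)); rewrite -mulrDl ler_wpM2r //.
have := sqr_ge0 (1 - rho); rewrite /theta; nra.
Qed.

(** Applied to tuples that are block diagonal for the projection [Q]. Often the second block is 0,
    and its hypothesis then amounts to contractivity at the tuple 0. *)
Lemma delta_contr_split (Q : bop H) rho x :
  (forall u, sqn u = sqn (Q u) + sqn (u - Q u)) ->
  (forall v, \sum_i sqn (Q (delta_vec x v i)) <= rho * \sum_j sqn (Q (v j))) ->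
  (forall v, \sum_i sqn (delta_vec x v i - Q (delta_vec x v i)) <=
    rho * \sum_j sqn (v j - Q (v j))) ->
  delta_contr rho x.
Proof.
move=> QP h1 h2 v; under eq_bigr do rewrite QP.
rewrite big_split /= (le_trans (lerD (h1 v) (h2 v))) // -mulrDr -big_split /=.
by under eq_bigr do rewrite -QP.
Qed.

Lemma delta_vec_intertwine (L : bop H) x y v i :
  (forall r, L * x 0 r = y 0 r * L) ->
  L (delta_vec x v i) = delta_vec y (fun j => L (v j)) i.
Proof.
move=> Lxy; rewrite /delta_vec linear_sum; apply: eq_bigr => j _ /=.
by rewrite -!bop_mulE (eval_intertwine _ Lxy).
Qed.

End Delta.

(** * Rotations and the shift *)

Section Circle.
Variables (R : realType) (H : infHilbertType R) (d I J : nat).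
Variable delta : 'M[freepoly R d]_(I, J).
Implicit Types (x y z : 'rV[bop H]_d).

Lemma tuple_norm_bound x : exists2 C : R, 0 <= C & forall r, rnorm (x 0 r) <= C.
Proof.
exists (\sum_r rnorm (x 0 r)) => [|r]; first by apply: sumr_ge0 => r _; exact: rnorm_ge0.
by rewrite (bigD1 r) //= lerDl sumr_ge0 // => k _; exact: rnorm_ge0.
Qed.

(** For [s = 1] and [s = -1], the upper and lower half circle parametrized by the real part, which
    reduces compactness of the circle to that of [[-1, 1]]. *)
Let arc (s a : R) : R[i] := (a +i* (s * Num.sqrt (1 - a ^+ 2))).

Let rnorm_sub (a b a' b' : R) : rnorm ((a +i* b) - (a' +i* b')) <= `|a - a'| + `|b - b'|.
Proof.
have -> : (a +i* b) - (a' +i* b') = (a - a')%:C + (0 +i* (b - b')).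
  by apply/eqP; rewrite eq_complex /= addr0 add0r !eqxx.
rewrite (le_trans (rnormD (_ : R[i]^o) _)) // rnorm_real.
by rewrite /rnorm normc_def /= expr0n add0r sqrtr_sqr.
Qed.

(** Near each point of the arc one [rho' < 1] serves, and then so does every larger [rho]. Stated as
    a property of all [rho] close to 1 from the left, the claim is local, and the near-covering form
    of compactness makes it uniform. *)
Lemma delta_contr_arc (s : R) x :
  (forall a, a \in `[-1, 1] -> Bdelta_op delta (scale_tuple (arc s a) x)) ->
  \forall rho \near 1^'-, forall a, a \in `[-1, 1] ->
    delta_contr delta rho (scale_tuple (arc s a) x).
Proof.
move=> hx; have [C C0 xC] := tuple_norm_bound x.
have /compact_near_coveringP cK := @segment_compact R (-1) 1.
have : \forall rho \near 1^'-, [set` `[(-1 : R),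
  1]] `<=` (fun a => delta_contr delta rho (scale_tuple (arc s a) x)).
  apply: cK => a aK.
  have /Bdelta_opP[rho [rho0 rho1 hrho]] := hx a aK.
  have [C' C'0 xC'] := tuple_norm_bound (scale_tuple (arc s a) x).
  have [eta [rho' [eta0 rho'0 rho'1 hp]]] :=
    @delta_contr_perturb R H d I J delta C' rho C'0 rho0 rho1.
  have near_a : \forall b \near a,
    (`|b - a| + `|s * Num.sqrt (1 - b ^+ 2) - s * Num.sqrt (1 - a ^+ 2)|) * C <= eta.
    have : (fun b => (`|b - a| + `|s * Num.sqrt (1 - b ^+ 2) - s * Num.sqrt (1 - a ^+ 2)|) *
      C) @ a --> (`|a - a| + `|s * Num.sqrt (1 - a ^+ 2) - s * Num.sqrt (1 - a ^+ 2)|) * C.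
      apply: cvgMl; apply: cvgD; apply: cvg_norm; apply: cvgB; try exact: cvg_cst.
        exact: cvg_id.
      apply: cvgMr; apply: continuous_cvg; first exact: sqrt_continuous.
      by apply: cvgB; [exact: cvg_cst|apply: exprn_continuous].
    rewrite !subrr normr0 addr0 mul0r => /cvgr_le; exact.
  near=> b rho1' => /=.
  apply: (@delta_contr_mono _ _ _ _ _ _ rho').
    near: rho1'; near=> t; apply: ltW; near: t; exact: nbhs_left_gt.
  apply: (hp (scale_tuple (arc s a) x)) => // r.
  rewrite !mxE -scalerBl rnormZ (le_trans _ (near near_a b _)) //.
  by rewrite ler_pM ?rnorm_ge0 //; exact: rnorm_sub.
by apply: filterS => rho h a; exact: h.
Unshelve. all: by end_near.
Qed.

Lemma delta_contr_circle x :
  (forall a : R[i], rnorm a = 1 -> Bdelta_op delta (scale_tuple a x)) ->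
  exists rho, [/\ 0 <= rho, rho < 1 &
    forall a : R[i], rnorm a = 1 -> delta_contr delta rho (scale_tuple a x)].
Proof.
move=> hx.
have arc1 s a : s ^+ 2 = 1 -> a \in `[-1, 1] -> rnorm (arc s a) = 1.
  move=> s1 /[!in_itv] /= /andP[a1 a2]; rewrite /rnorm normc_def /= exprMn s1 mul1r.
  rewrite sqr_sqrtr; first by rewrite addrC subrK sqrtr1.
  by nra.
have h1 := @delta_contr_arc 1 x (fun a ha => hx _ (arc1 1 a (expr1n _ _) ha)).
have h2 := @delta_contr_arc (-1) x (fun a ha => hx _ (arc1 (-1) a (etrans (sqrrN _) (expr1n _
  _)) ha)).
have h3 : \forall rho \near (1 : R)^'-, 0 <= rho.
  by near=> t; apply: ltW; near: t; exact: nbhs_left_gt.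
have h4 : \forall rho \near (1 : R)^'-, rho < 1 by exact: nbhs_left_lt.
have [rho [[r0 r1] [H1 H2]]] := filter_ex (filterI (filterI h3 h4) (filterI h1 h2)).
exists rho; split => //.
case=> a b ab1.
have ab2 : a ^+ 2 + b ^+ 2 = 1.
  move: ab1; rewrite /rnorm normc_def /= => h.
  by rewrite -[LHS]sqr_sqrtr ?addr_ge0 ?sqr_ge0 // h expr1n.
have aK : a \in `[-1, 1].
  by rewrite in_itv /= -ler_norml -(@ler_pXn2r _ 2) ?nnegrE // real_normK ?num_real // expr1n
    -ab2 lerDl sqr_ge0.
have [b0|b0] := lerP 0 b.
  have -> : (a +i* b) = arc 1 a.
    by rewrite /arc mul1r -ab2 addrC addKr sqrtr_sqr ger0_norm.
  exact: H1.
have -> : (a +i* b) = arc (-1) a.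
  by rewrite /arc mulN1r -ab2 addrC addKr sqrtr_sqr ltr0_norm // opprK.
exact: H2.
Unshelve. all: by end_near.
Qed.

End Circle.

Section RootsOfUnity.
Variables (R : realType).

Lemma primitive_root_exists n : (0 < n)%N -> exists w : R[i], n.-primitive_root w.
Proof.
move=> n_gt0; pose p : {poly R[i]} := 'X^n - 1; have [r Dp] := closed_field_poly_normal p.
rewrite (monicP _) ?monicXnsubC // scale1r in Dp.
have rn1 : all n.-unity_root r by apply/allP => z; rewrite -root_prod_XsubC -Dp.
have sz_r : (n < (size r).+1)%N by rewrite -(size_prod_XsubC r id) -Dp size_XnsubC.
have [|z] := hasP (has_prim_root n_gt0 rn1 _ sz_r); last by exists z.
by rewrite -separable_prod_XsubC -Dp separable_Xn_sub_1 // pnatr_eq0 -lt0n.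
Qed.

Lemma real_complex_nat n : real_complex R n%:R = n%:R.
Proof. by elim: n => [|n IH] //; rewrite !mulrSr rmorphD /= IH. Qed.

Lemma rnorm_unity (w : R[i]) n : (0 < n)%N -> w ^+ n = 1 -> rnorm w = 1.
Proof.
move=> n0 wn; apply/eqP; rewrite -(@pexpr_eq1 _ _ n) ?rnorm_ge0 //.
by rewrite -rnormX wn rnorm1.
Qed.

Lemma sum_unity (w : R[i]) n : w ^+ n = 1 -> w != 1 -> \sum_(a < n) w ^+ a = 0.
Proof.
move=> wn w1; apply/eqP; rewrite -(mulrI_eq0 _ (mulfI (_ : w - 1 != 0))) ?subr_eq0 //.
by rewrite -subrX1 wn subrr.
Qed.

End RootsOfUnity.

Section Shift.
Variables (R : realType) (H : infHilbertType R) (d I J : nat).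
Variable delta : 'M[freepoly R d]_(I, J).
Implicit Types (x y z : 'rV[bop H]_d).

(** Orthogonality of the characters of [Z/M]: each cross term is a full sum of powers of a root of
    unity other than 1. *)
Lemma parseval (M : nat) (w : R[i]) (y : 'I_M -> H) : M.-primitive_root w ->
  \sum_(a < M) sqn (\sum_(s < M) (w ^+ a) ^+ s *: y s) = M%:R * \sum_s sqn (y s).
Proof.
move=> wM; have M0 := prim_order_gt0 wM; have w1 := prim_expr_order wM.
have nw : rnorm w = 1 by exact: rnorm_unity w1.
have ww : w * w^* = 1 by rewrite sqn_mulconj /sqn nw expr1n.
apply: (@complexI R); rewrite rmorphM !rmorph_sum /= mulr_sumr.
under eq_bigr do rewrite -innerE inner_suml.
rewrite exchange_big /=; apply: eq_bigr => s _.
under eq_bigr do rewrite inner_sumr.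
rewrite exchange_big /= (bigD1 s) //= [X in _ + X]big1 ?addr0.
  rewrite (eq_bigr (fun=> (sqn (y s))%:C)) => [|a _].
    by rewrite sumr_const card_ord -[in LHS]mulr_natl -real_complex_nat.
  rewrite innerZl innerZr mulrA sqn_mulconj innerE -rmorphM /=.
  by rewrite /sqn !rnormX nw !expr1n mul1r.
move=> t ts; pose z := w ^+ s * (w^*) ^+ t.
rewrite (eq_bigr (fun a : 'I_M => z ^+ a * inner (y s) (y t))) => [|a _]; last first.
  rewrite innerZl innerZr mulrA /z exprMn -!exprM; congr (_ * _).
  by rewrite rmorphXn /= ![(a * _)%N]mulnC.
rewrite -mulr_suml sum_unity ?mul0r //.
  by rewrite /z exprMn -!exprM ![(_ * M)%N]mulnC !exprM -rmorphXn /= w1 rmorph1 !expr1n mulr1.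
apply: contra ts => /eqP z1; rewrite -val_eqE /=.
have : w ^+ s = w ^+ t.
  by rewrite -[LHS]mulr1 -(expr1n _ t) -ww mulrC exprMn -mulrA [_ * w ^+ s]mulrC -/z z1 mulr1.
move/eqP; rewrite (eq_prim_root_expr wM) !modn_small // eq_sym; exact.
Qed.

(** The degree [l] component of [delta (x (x) S)] applied to the vectors with components [u j l]:
    under [x (x) S] a word raises the degree by its length. *)
Definition shift_vec x (u : 'I_J -> nat -> H) (i : 'I_I) (l : nat) : H :=
  \sum_j \sum_(w <- finsupp (delta i j) | (size w <= l)%N)
     delta i j w *: word x w (u j (l - size w)%N).

Lemma sum_shift (V : nmodType) (G : nat -> nat -> V) k M :
  (forall l, (M <= l + k)%N -> G (l + k)%N l = 0) ->
  \sum_(l < M) G (l + k)%N l = \sum_(s < M | (k <= s)%N) G s (s - k)%N.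
Proof.
move=> G0.
rewrite -(big_mkord (fun s => (k <= s)%N) (fun s => G s (s - k)%N)).
rewrite -(big_mkord xpredT (fun l => G (l + k)%N l)).
have [kM|Mk] := leqP k M; last first.
  rewrite big_nat big1 => [|l _]; last by rewrite G0 // (leq_trans (ltnW Mk)) // leq_addl.
  rewrite big_nat_cond big_pred0 // => s; apply/negP => /andP[/= sM ks].
  by have := leq_trans Mk (leq_trans ks (ltnW sM)); rewrite ltnn.
rewrite [RHS](big_cat_nat (leq0n _) kM) /= [X in _ = X + _]big_nat_cond [X in _ = X +
  _]big_pred0 ?add0r.
  rewrite [LHS](big_cat_nat (leq0n _) (leq_subr k M)) /= [X in _ +
    X = _]big_nat_cond [X in _ + X = _]big1 ?addr0.
    rewrite -[RHS]/(\sum_(0 + k <= s < M | (k <=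
      s)%N) G s (s - k)%N) big_addn [RHS]big_mkcond /=; apply: eq_bigr => l _.
    by rewrite leq_addl addnK.
  by move=> l /andP[/andP[/= h _] _]; rewrite G0 // addnC -leq_subLR.
by move=> s; apply/negP => /andP[/= sk ks]; have := leq_trans sk ks; rewrite ltnn.
Qed.

Lemma delta_degree : exists D, forall i j w, w \in finsupp (delta i j) -> (size w <= D)%N.
Proof.
exists (\max_i \max_j \max_(w <- finsupp (delta i j)) size w)%N => i j w wd.
rewrite (leq_trans _ (leq_bigmax i)) // (leq_trans _ (leq_bigmax j)) //.
exact: leq_bigmax_seq.
Qed.

Lemma word_scaleE x (a : R[i]) w v : word (scale_tuple a x) w v = a ^+ size w *: word x w v.
Proof. by rewrite word_scale. Qed.

(** Read [a] as a variable: [delta (a x)] maps the polynomial with coefficients [u j l] to the one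
    with coefficients [shift_vec]. As its degree is below [N + D <= M], no coefficient is lost. *)
Lemma delta_vec_scale x (a : R[i]) (u : 'I_J -> nat -> H) i M N D :
  (forall j w, w \in finsupp (delta i j) -> (size w <= D)%N) ->
  (forall j l, (N <= l)%N -> u j l = 0) -> (N + D <= M)%N ->
  delta_vec delta (scale_tuple a x) (fun j => \sum_(l < M) a ^+ l *: u j l) i =
  \sum_(s < M) a ^+ s *: shift_vec x u i s.
Proof.
move=> dD u0 NDM; rewrite /delta_vec /shift_vec.
under [RHS]eq_bigr do rewrite scaler_sumr.
rewrite [RHS]exchange_big /=; apply: eq_bigr => j _.
rewrite freepoly_evalE.
under [RHS]eq_bigr do rewrite scaler_sumr big_mkcond.
rewrite [RHS]exchange_big /= big_seq [RHS]big_seq; apply: eq_bigr => w wd.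
rewrite -big_mkcond /= word_scaleE linear_sum !scaler_sumr.
rewrite -(sum_shift (G := fun s t => a ^+ s *: (delta i j w *: word x w (u j t)))).
  apply: eq_bigr => l _; rewrite /=;
    have -> : word x w (a ^+ l *: u j l) = a ^+ l *: word x w (u j l) by rewrite linearZ.
  by rewrite !scalerA exprD; congr (_ *: _); ring.
move=> l Ml; rewrite u0 ?linear0 ?scaler0 //.
by rewrite -(leq_add2r D) (leq_trans NDM) // (leq_trans Ml) // leq_add2l (dD j).
Qed.

(* [x (x) S] is as contractive under [delta] as the rotations of [x]: cut [u] at
   degree [N] and apply Parseval over [Z/M], where [M > N + deg delta] excludes
   any wrap-around. *)
Lemma shift_contr (rho : R) x (u : 'I_J -> nat -> H) N :
  (forall a : R[i], rnorm a = 1 -> delta_contr delta rho (scale_tuple a x)) ->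
  \sum_(l < N) \sum_i sqn (shift_vec x u i l) <= rho * \sum_(l < N) \sum_j sqn (u j l).
Proof.
move=> hx; have [D dD] := delta_degree.
pose u' j l := if (l < N)%N then u j l else 0.
have u'0 j l : (N <= l)%N -> u' j l = 0 by rewrite /u' leqNgt => /negbTE ->.
pose M := (N + D).+1.
have [w wM] := @primitive_root_exists R M isT.
have nw a : rnorm (w ^+ a) = 1.
  by rewrite rnormX (rnorm_unity (prim_order_gt0 wM) (prim_expr_order wM)) expr1n.
have NM : (N <= M)%N by rewrite /M leqW // leq_addr.
have key : M%:R * \sum_(l < M) \sum_i sqn (shift_vec x u' i l) <=
  M%:R * (rho * \sum_(l < M) \sum_j sqn (u' j l)).
  have EL : M%:R * \sum_(l < M) \sum_i sqn (shift_vec x u' i l) =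
      \sum_(a < M) \sum_i sqn (\sum_(s < M) (w ^+ a) ^+ s *: shift_vec x u' i s).
    rewrite exchange_big [RHS]exchange_big /= mulr_sumr; apply: eq_bigr => i _.
    by rewrite (parseval (fun s : 'I_M => shift_vec x u' i s) wM).
  have ER : M%:R * \sum_(l < M) \sum_j sqn (u' j l) =
      \sum_(a < M) \sum_j sqn (\sum_(s < M) (w ^+ a) ^+ s *: u' j s).
    rewrite exchange_big [RHS]exchange_big /= mulr_sumr; apply: eq_bigr => j _.
    by rewrite (parseval (fun s : 'I_M => u' j s) wM).
  rewrite EL mulrCA ER mulr_sumr; apply: ler_sum => a _.
  have := hx _ (nw a) (fun j => \sum_(l < M) (w ^+ a) ^+ l *: u' j l).
  apply: le_trans; apply: ler_sum => i _.
  by rewrite (delta_vec_scale _ _ (dD i) u'0) // /M leqW.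
rewrite ler_pM2l ?ltr0n // in key.
(* On the left the degrees from [N] on are dropped; below [N], [shift_vec] reads only components of
   degree [< N], where [u'] and [u] agree. *)
apply: le_trans (le_trans key _) => {key}.
  rewrite -!(big_mkord xpredT (fun l => \sum_i sqn (shift_vec x _ i l))).
  rewrite [leRHS](big_cat_nat (leq0n _) NM) /= (_ : \sum_(0 <= l < N) _ =
    \sum_(0 <= l < N) \sum_i sqn (shift_vec x u' i l)).
    by rewrite lerDl sumr_ge0 // => l _; rewrite sumr_ge0 // => i _; exact: sqn_ge0.
  apply: eq_big_nat => l /= lN; apply: eq_bigr => i _; congr sqn.
  apply: eq_bigr => j _; apply: eq_bigr => v _; rewrite /u'.
  by rewrite (leq_ltn_trans (leq_subr _ _) lN).
rewrite -!(big_mkord xpredT (fun l => \sum_j sqn (_ j l))).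
rewrite (big_cat_nat (leq0n _) NM) /= [X in _ * (_ + X)]big_nat_cond [X in _ * (_ +
  X)]big1 ?addr0.
  rewrite le_eqVlt; apply/orP; left; apply/eqP; congr (_ * _).
  by apply: eq_big_nat => l /= lN; apply: eq_bigr => j _; rewrite /u' lN.
move=> l /andP[/andP[Nl _] _]; rewrite big1 // => j _.
by rewrite u'0 // sqn0.
Qed.

End Shift.

(** * Graded models *)

Section OrthogonalSeries.
Variables (R : realType) (H : infHilbertType R).

Lemma orthogonal_series (F : nat -> bop H) (C : R) : 0 <= C ->
  (forall v i j, i != j -> inner (F i v) (F j v) = 0) ->
  (forall n v, \sum_(j < n) sqn (F j v) <= C * sqn v) ->
  exists S : bop H, (forall v, cvs (fun n => \sum_(j < n) F j v) (S v)) /\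
    forall v, sqn (S v) <= C * sqn v.
Proof.
move=> C0 orF FC.
have sqnF m n v : sqn (\sum_(m <= j < n) F j v) = \sum_(m <= j < n) sqn (F j v).
  by rewrite sqn_sum_orth ?iota_uniq // => i j ij; exact: orF.
have [n v|v|S [ScvS SC]] := @bop_limit _ _ (fun n => \sum_(j < n) F j) C C0.
- by rewrite bop_sumE -(big_mkord xpredT (fun j => F j v)) sqnF big_mkord.
- apply: (@cvs_complete _ _ _ (fun n => \sum_(j < n) sqn (F j v)) (C * sqn v)) => // m n mn.
  rewrite !bop_sumE -!(big_mkord xpredT (fun j => F j v)) -!(big_mkord xpredT (fun j => sqn
    (F j v))).
  by rewrite !(big_cat_nat (leq0n _) mn) /= ![_ + \sum_(m <= _ < n) _]addrC !addrK sqnF.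
exists S; split=> // v; move: (ScvS v); congr (cvs _ _).
by apply/funext => n; rewrite bop_sumE.
Qed.

Lemma cvs_bop_eq (T : bop H) x l N c : cvs x l ->
  (forall n, (N <= n)%N -> T (x n) = c) -> T l = c.
Proof. by move=> /(cvs_bop T) xl h; apply: cvs_unique xl (cvs_near h). Qed.

Lemma cvsS (x : nat -> H) l : cvs x l -> cvs (fun n => x n.+1) l.
Proof.
move=> /cvs_eps h; apply/cvs_eps => e /h[N hN]; exists N => n Nn.
by apply: hN; exact: leqW.
Qed.

Lemma adjoint_inj (S S' T : bop H) : adjoint_of S T -> adjoint_of S' T -> S = S'.
Proof.
move=> hS hS'; apply: bopP => u; apply/eqP; rewrite -subr_eq0; apply/eqP/inner_eq0.
by rewrite innerBl hS hS' subrr.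
Qed.

Lemma projection_pythagoras (Q : bop H) u : adjoint_of Q Q -> Q * Q = Q ->
  sqn u = sqn (Q u) + sqn (u - Q u).
Proof.
move=> hQ QQ; have {1}-> : u = Q u + (u - Q u) by rewrite addrC subrK.
by rewrite sqnD_orth // hQ linearB /= -bop_mulE QQ subrr linear0r.
Qed.

Lemma rnorm_le1 (Q : bop H) : (forall u, sqn (Q u) <= sqn u) -> rnorm Q <= 1.
Proof.
move=> h; apply: rnorm_bop_ub => // v; rewrite mul1r.
by rewrite rnorm_le_sqn ?rnorm_ge0 //; exact: h.
Qed.

End OrthogonalSeries.

Section GradedModel.
Variables (R : realType) (H : infHilbertType R) (d : nat).
Variables (x : 'rV[bop H]_d) (Gam GamS : nat -> bop H).

(* [Gam j] reads off a component of degree [j] and [GamS j] puts it back, in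
   pairwise orthogonal subspaces for distinct [j]; [x] maps the range of [Gam j]
   into the range of [Gam j.+1]. *)
Definition graded_model :=
  [/\ forall j, adjoint_of (GamS j) (Gam j),
      forall i j, i != j -> Gam i * GamS j = 0,
      forall j, Gam j * GamS j * Gam j = Gam j &
      forall r j, Gam j.+1 * GamS j.+1 * x 0 r * Gam j = x 0 r * Gam j].

(* [z] is the copy, on the range of the [GamS j], of [x (x) S] with [S] the
   unilateral shift. *)
Definition shift_of (z : 'rV[bop H]_d) :=
  forall r, [/\ forall v : H, cvs (fun n => \sum_(j < n) GamS j.+1 (x 0 r (Gam j v))) (z 0 r
    v),
      forall j, Gam j.+1 * z 0 r = x 0 r * Gam j, Gam 0 * z 0 r = 0 &
      rnorm (z 0 r) <= rnorm (x 0 r)].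

Hypothesis mG : graded_model.

Let adjG j : adjoint_of (GamS j) (Gam j). Proof. by case: mG. Qed.
Let orthG i j : i != j -> Gam i * GamS j = 0. Proof. by case: mG => _ h _ _; exact: h. Qed.
Let GGG j : Gam j * GamS j * Gam j = Gam j. Proof. by case: mG. Qed.
Let Gx r j : Gam j.+1 * GamS j.+1 * x 0 r * Gam j = x 0 r * Gam j.
Proof. by case: mG. Qed.

(** The adjoint of the identity [GGG]. *)
Let SGS j : GamS j * Gam j * GamS j = GamS j.
Proof.
apply: (@adjoint_inj _ _ _ _ (Gam j)) => //; rewrite -[X in adjoint_of _ X]GGG.
rewrite -mulrA; apply: adjoint_mul => //; rewrite -[X in adjoint_of X]/(Gam j * GamS j).
by apply: adjoint_mul => //; exact: adjoint_sym.
Qed.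

Lemma sqn_GamS j v : sqn (GamS j v) <= sqn v.
Proof. exact: sqn_adjoint (adjG j) (SGS j) v. Qed.

Lemma sqn_Gam j v : sqn (Gam j v) <= sqn v.
Proof. exact: sqn_adjoint (adjoint_sym (adjG j)) (GGG j) v. Qed.

(** Each term is the orthogonal projection onto the range of [GamS j], so this projects onto the
    degrees [< N] of the copy. *)
Definition gproj (N : nat) : bop H := \sum_(j < N) GamS j * Gam j.

Lemma Gam_gproj j N : Gam j * gproj N = if (j < N)%N then Gam j else 0.
Proof.
rewrite /gproj mulr_sumr -(big_mkord xpredT (fun i => Gam j * (GamS i * Gam i))).
case: ltnP => jN.
  rewrite (bigD1_seq j) ?mem_index_iota ?iota_uniq //= mulrA GGG big1 ?addr0 // => i ij.
  by rewrite mulrA orthG ?mul0r // eq_sym.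
rewrite big_nat_cond big1 // => i /andP[/= iN _].
by rewrite mulrA orthG ?mul0r // gtn_eqF // (leq_trans iN).
Qed.

Lemma gproj_GamS j N : gproj N * GamS j = if (j < N)%N then GamS j else 0.
Proof.
rewrite /gproj mulr_suml -(big_mkord xpredT (fun i => GamS i * Gam i * GamS j)).
case: ltnP => jN.
  rewrite (bigD1_seq j) ?mem_index_iota ?iota_uniq //= SGS big1 ?addr0 // => i ij.
  by rewrite -mulrA orthG ?mulr0.
rewrite big_nat_cond big1 // => i /andP[/= iN _].
by rewrite -mulrA orthG ?mulr0 // ltn_eqF // (leq_trans iN).
Qed.

Lemma gproj_idem N : gproj N * gproj N = gproj N.
Proof.
rewrite {2}/gproj mulr_sumr; apply: eq_bigr => j _.
by rewrite mulrA gproj_GamS ltn_ord.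
Qed.

Lemma gproj_adj N : adjoint_of (gproj N) (gproj N).
Proof.
apply: adjoint_sum => j; apply: adjoint_mul => //; exact: adjoint_sym.
Qed.

Lemma sqn_gproj N v : sqn (gproj N v) = \sum_(j < N) sqn (Gam j v).
Proof.
rewrite /gproj bop_sumE sqn_sum_orth ?index_enum_uniq //; last first.
  by move=> i j ij; rewrite !bop_mulE adjG -bop_mulE orthG // bop_zeroE linear0r.
apply: eq_bigr => j _; apply: (@complexI R); rewrite -!innerE !bop_mulE adjG.
by rewrite -!bop_mulE GGG.
Qed.

Lemma sum_sqn_Gam N v : \sum_(j < N) sqn (Gam j v) <= sqn v.
Proof.
by rewrite -sqn_gproj (projection_pythagoras v (gproj_adj N) (gproj_idem N)) lerDl sqn_ge0.
Qed.

(** [Q] projects onto the closed span of all degrees. Only Pythagoras is carried over to the limit,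
    that being what [delta_contr_split] asks for. *)
Lemma graded_projection : exists Q : bop H,
  [/\ forall v, cvs (fun n => gproj n v) (Q v), forall j, Gam j * Q = Gam j &
      forall u, sqn u = sqn (Q u) + sqn (u - Q u)].
Proof.
have [|v i j ij|n v|Q [QcvS _]] := @orthogonal_series _ _ (fun j => GamS j * Gam j) 1.
- exact: ler01.
- by rewrite !bop_mulE adjG -bop_mulE orthG // bop_zeroE linear0r.
- rewrite mul1r (le_trans _ (sum_sqn_Gam n v)) //; apply: ler_sum => j _.
  by rewrite bop_mulE sqn_GamS.
have QP v : cvs (fun n => gproj n v) (Q v).
  by move: (QcvS v); congr (cvs _ _); apply/funext => n; rewrite /gproj bop_sumE.
exists Q; split=> // [j|u].
  apply: bopP => v; rewrite bop_mulE;
    apply: (@cvs_bop_eq _ _ (Gam j) _ _ j.+1 _ (QP v)) => n jn.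
  by rewrite -bop_mulE Gam_gproj jn.
have h1 := cvs_sqn (QP u).
have h2 : cvs (fun n => u - gproj n u) (u - Q u).
  rewrite -scaleN1r; have := cvsD (cvs_cst u) (cvsZ (-1) (QP u)).
  by congr (cvs _ _); apply/funext => n; rewrite scaleN1r.
have h3 : (fun n => sqn (gproj n u) + sqn (u - gproj n u)) @ \oo --> sqn (Q u) + sqn (u - Q u).
  by apply: cvgD h1 (cvs_sqn h2).
have E : (fun n => sqn (gproj n u) + sqn (u - gproj n u)) = fun=> sqn u.
  by apply/funext => n; rewrite [RHS](projection_pythagoras u (gproj_adj n) (gproj_idem n)).
by rewrite -(cvg_lim _ h3) // E lim_cst.
Qed.

(** The terms [GamS j.+1 * x 0 r * Gam j] have orthogonal ranges, and their squared norms at [v] add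
    up to at most [|x 0 r|^2 |v|^2]. That [x 0 r] maps the range of [Gam j] into that of [Gam j.+1]
    ensures that [Gam j.+1] recovers the term exactly. *)
Lemma graded_shift : exists z : 'rV[bop H]_d, shift_of z.
Proof.
suff h r : exists zr : bop H, [/\ forall v,
  cvs (fun n => \sum_(j < n) GamS j.+1 (x 0 r (Gam j v))) (zr v),
      forall j, Gam j.+1 * zr = x 0 r * Gam j, Gam 0 * zr = 0 &
      rnorm zr <= rnorm (x 0 r)].
  by exists (\row_r sval (cid (h r))) => r; rewrite mxE; exact: (svalP (cid (h r))).
have [|v i j ij|n v|zr [zcvS zC]] :=
  @orthogonal_series _ _ (fun j => GamS j.+1 * x 0 r * Gam j) (sqn (x 0 r)).
- exact: sqn_ge0.
- by rewrite !bop_mulE adjG -(bop_mulE (Gam i.+1)) orthG // bop_zeroE linear0r.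
- rewrite (@le_trans _ _ (\sum_(j < n) sqn (x 0 r) * sqn (Gam j v))) //.
    apply: ler_sum => j _; rewrite !bop_mulE (le_trans (sqn_GamS _ _)) //.
    exact: sqn_bop_le.
  by rewrite -mulr_sumr ler_wpM2l ?sqn_ge0 ?sum_sqn_Gam.
exists zr; split=> //.
- move=> j; apply: bopP => v; rewrite bop_mulE;
  apply: (@cvs_bop_eq _ _ (Gam j.+1) _ _ j.+1 _ (zcvS v)) => n jn.
  have T i : Gam j.+1 ((GamS i.+1 * x 0 r * Gam i) v) =
    (Gam j.+1 * GamS i.+1 * x 0 r * Gam i) v by [].
  rewrite linear_sum /= (bigD1 (Ordinal jn)) //= T Gx big1 ?addr0 // => i ij.
  by rewrite T orthG ?mul0r // eqSS eq_sym.
- apply: bopP => v; rewrite bop_mulE;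
  apply: (@cvs_bop_eq _ _ (Gam 0) _ _ 0 _ (zcvS v)) => n jn.
  have T i : Gam 0 ((GamS i.+1 * x 0 r * Gam i) v) =
    (Gam 0 * GamS i.+1 * x 0 r * Gam i) v by [].
  by rewrite linear_sum /= big1 // => i _; rewrite T orthG ?mul0r.
apply: rnorm_bop_ub => [|v]; first exact: rnorm_ge0.
by rewrite rnorm_le_sqn ?mulr_ge0 ?rnorm_ge0 // exprMn; exact: zC.
Qed.

Variable z : 'rV[bop H]_d.
Hypothesis zP : shift_of z.

Lemma Gam_word l w : Gam l * word z w =
  if (size w <= l)%N then word x w * Gam (l - size w)%N else 0.
Proof.
elim: w l => [|r w IH] l; first by rewrite !word_nil mulr1 mul1r subn0.
rewrite !word_cons mulrA; have [_ h1 h0 _] := zP r.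
case: l => [|l]; first by rewrite h0 mul0r.
rewrite h1 -mulrA IH /= ltnS subSS; case: ifP => _; last by rewrite mulr0.
by rewrite mulrA.
Qed.

Definition gtrunc (N : nat) : 'rV[bop H]_d := \row_r (gproj N * z 0 r).

(** Since [z] raises degrees, what lies in degrees [>= N] stays there. Hence [gproj N] intertwines
    [z] with [gtrunc N], which makes truncation compatible with words and with [delta]. *)
Lemma gproj_z N r : gproj N * z 0 r = gproj N * z 0 r * gproj N.
Proof.
rewrite /gproj mulr_suml mulr_suml; apply: eq_bigr => -[[|j] jN] _ /=;
  rewrite -!mulrA; have [_ h1 h0 _] := zP r.
  by rewrite [Gam 0 * (z 0 r * _)]mulrA !h0 mul0r mulr0.
rewrite [Gam _ * (z 0 r * _)]mulrA !h1 -mulrA; congr (_ * (_ * _)).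
by rewrite Gam_gproj (ltnW jN).
Qed.

Lemma gtrunc_gproj N r : gproj N * z 0 r = gtrunc N 0 r * gproj N.
Proof. by rewrite mxE -gproj_z. Qed.

Lemma gproj_gtrunc N r : gproj N * gtrunc N 0 r = gtrunc N 0 r.
Proof. by rewrite mxE mulrA gproj_idem. Qed.

Lemma gtrunc_commute N r : gproj N * gtrunc N 0 r = gtrunc N 0 r * gproj N.
Proof. by rewrite gproj_gtrunc -gtrunc_gproj mxE. Qed.

Lemma word_gtrunc N w : gproj N * word z w = word (gtrunc N) w * gproj N.
Proof. by apply: word_intertwine => r; exact: gtrunc_gproj. Qed.

Lemma gtrunc_nilpotent N w : (0 < N)%N -> (N <= size w)%N -> word (gtrunc N) w = 0.
Proof.
move=> N0 Nw; have -> : word (gtrunc N) w = word (gtrunc N) w * gproj N.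
  case/lastP: w Nw => [|w r _]; first by case: N N0.
  rewrite -cats1 /word big_cat big_seq1 /= -mulrA; congr (_ * _).
  by rewrite -gtrunc_gproj mxE.
rewrite -word_gtrunc /gproj mulr_suml big1 // => j _.
by rewrite -mulrA Gam_word leqNgt (leq_trans (ltn_ord j)) // mulr0.
Qed.

Lemma rnorm_gtrunc N r : rnorm (gtrunc N 0 r) <= rnorm (x 0 r).
Proof.
rewrite mxE (le_trans (rnorm_bop_mul _ _)) // -[leRHS]mul1r.
have [_ _ _ zx] := zP r; rewrite ler_pM ?rnorm_ge0 //; apply: rnorm_le1 => u.
by rewrite (projection_pythagoras u (gproj_adj N) (gproj_idem N)) lerDl sqn_ge0.
Qed.

Section Contractive.
Variables (I J : nat) (delta : 'M[freepoly R d]_(I, J)) (rho : R).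
Hypotheses (rho0 : 0 <= rho)
  (circ : forall a : R[i], rnorm a = 1 -> delta_contr delta rho (scale_tuple a x))
  (contr0 : delta_contr delta rho (0 : 'rV[bop H]_d)).

Lemma Gam_delta_vec v i l : Gam l (delta_vec delta z v i) =
  shift_vec delta x (fun j l => Gam l (v j)) i l.
Proof.
rewrite /delta_vec linear_sum; apply: eq_bigr => j _ /=.
rewrite freepoly_evalE linear_sum [RHS]big_mkcond; apply: eq_bigr => w _ /=.
rewrite linearZ /= -bop_mulE Gam_word; case: ifP => // _.
by rewrite bop_zeroE scaler0.
Qed.

(** On the range of [Q], [delta z] acts degree by degree as [shift_vec], so [shift_contr] applies up
    to every degree [N] and the bound passes to the limit. On the complement [z] vanishes and
    [contr0] takes over. *)
Lemma delta_contr_shift : delta_contr delta rho z.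
Proof.
have [Q [QP GQ Qpyth]] := graded_projection.
have zQ r : z 0 r * Q = z 0 r.
  have [zc _ _ _] := zP r; apply: bopP => v; rewrite bop_mulE.
  apply: cvs_unique (zc _) _; move: (zc v); congr (cvs _ _); apply/funext => n.
  by apply: eq_bigr => j _; rewrite -(bop_mulE (Gam j) Q v) GQ.
have Qz r : Q * z 0 r = z 0 r.
  have [zc h1 h0 _] := zP r; apply: bopP => v; rewrite bop_mulE.
  apply: cvs_unique (cvsS (QP _)) _; move: (zc v); congr (cvs _ _); apply/funext => n.
  rewrite /gproj big_ord_recl bop_addE bop_sumE -!bop_mulE -mulrA h0 mulr0 bop_zeroE add0r.
  by apply: eq_bigr => j _; rewrite lift0 bop_mulE -(bop_mulE (Gam _) (z 0 r)) h1.
apply: (delta_contr_split Qpyth) => v.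
  have cvgL : (fun N => \sum_i sqn (gproj N (delta_vec delta z v i))) @ \oo --> \sum_i sqn (Q
    (delta_vec delta z v i)).
    apply: (@cvg_big _ _ +%R) => [|i _]; last exact: cvs_sqn.
    exact: add_continuous.
  rewrite -(cvg_lim _ cvgL) //; apply: limr_le; first by apply/cvg_ex; eexists; exact: cvgL.
  apply: nearW => N; under eq_bigr do rewrite sqn_gproj.
  rewrite exchange_big /=.
  under eq_bigr do under eq_bigr do rewrite Gam_delta_vec.
  rewrite (le_trans (shift_contr _ _ circ)) // ler_wpM2l // exchange_big /=.
  apply: ler_sum => j _; rewrite -[leRHS]/(sqn (Q (v j))).
  rewrite (le_trans _ (sum_sqn_Gam N (Q (v j)))) //; apply: ler_sum => l _.
  by rewrite -(bop_mulE (Gam l) Q) GQ.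
have h u : u - Q u = (1 - Q) u by [].
have hi r : (1 - Q) * z 0 r = (0 : 'rV[bop H]_d) 0 r * (1 - Q).
  by rewrite mxE mul0r mulrBl mul1r Qz subrr.
under eq_bigr do rewrite h (delta_vec_intertwine _ _ _ hi).
exact: contr0 (fun j => (1 - Q) (v j)).
Qed.

Lemma delta_contr_gtrunc N : delta_contr delta rho (gtrunc N).
Proof.
have pyth u := projection_pythagoras u (gproj_adj N) (gproj_idem N).
apply: (delta_contr_split pyth) => v.
  rewrite (le_trans _ (delta_contr_shift (fun j => gproj N (v j)))) //.
  apply: ler_sum => i _; rewrite (delta_vec_intertwine _ _ _ (gtrunc_commute N)).
  set w := delta_vec _ z _ _; suff <- : gproj N w =
    delta_vec delta (gtrunc N) (fun j => gproj N (v j)) i.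
    by rewrite (pyth w) lerDl sqn_ge0.
  rewrite /w (delta_vec_intertwine _ _ _ (gtrunc_gproj N)).
  by congr delta_vec; apply/funext => j; rewrite -bop_mulE gproj_idem.
have h u : u - gproj N u = (1 - gproj N) u by [].
have hi r : (1 - gproj N) * gtrunc N 0 r = (0 : 'rV[bop H]_d) 0 r * (1 - gproj N).
  by rewrite [X in X * (1 - _)]mxE mul0r mulrBl mul1r gproj_gtrunc subrr.
under eq_bigr do rewrite h (delta_vec_intertwine _ _ _ hi).
exact: contr0 (fun j => (1 - gproj N) (v j)).
Qed.

End Contractive.
End GradedModel.

Section BlockProjection.
Variables (R : realType) (H : infHilbertType R) (u : nat -> H).
Hypothesis ou : orthonormal_family u.

Definition block_proj (n : nat) : bop H := \sum_(i < n) rank_one (u i) (u i).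

Lemma block_proj_basis n i : block_proj n (u i) = if (i < n)%N then u i else 0.
Proof.
rewrite /block_proj bop_sumE; under eq_bigr do rewrite rank_oneE.
rewrite -(big_mkord xpredT (fun j => inner (u i) (u j) *: u j)).
case: ltnP => ilt.
  rewrite (bigD1_seq i) ?mem_index_iota ?iota_uniq //= ou eqxx scale1r.
  by rewrite big1 ?addr0 // => j ji; rewrite ou eq_sym (negbTE ji) scale0r.
rewrite big_nat_cond big1 // => j /andP[/= jn _].
by rewrite ou gtn_eqF ?scale0r // (leq_trans jn).
Qed.

Lemma block_proj_adj n : adjoint_of (block_proj n) (block_proj n).
Proof. by apply: adjoint_sum => i; exact: adjoint_rank_one. Qed.

Lemma rank_one_mul_adj (a b : H) (S T : bop H) : adjoint_of S T ->
  rank_one a b * T = rank_one a (S b).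
Proof.
by move=> ST; apply: bopP => v; rewrite bop_mulE !rank_oneE (adjoint_sym ST).
Qed.

Lemma block_proj_mul n m : (n <= m)%N -> block_proj m * block_proj n = block_proj n.
Proof.
move=> nm; rewrite {2}/block_proj mulr_sumr; apply: eq_bigr => i _.
by rewrite mul_rank_one block_proj_basis (leq_trans (ltn_ord i)).
Qed.

Lemma block_proj_mulr n m : (n <= m)%N -> block_proj n * block_proj m = block_proj n.
Proof.
move=> nm; rewrite {1}/block_proj mulr_suml; apply: eq_bigr => i _.
by rewrite (rank_one_mul_adj _ _ (block_proj_adj m)) block_proj_basis (leq_trans (ltn_ord i)).
Qed.

Lemma block_proj_idem n : block_proj n * block_proj n = block_proj n.
Proof. exact: block_proj_mul. Qed.

End BlockProjection.

Section ConcreteModel.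
Variables (R : realType) (H : infHilbertType R) (u : nat -> H) (d : nat).
Hypothesis ou : orthonormal_family u.
Variables (x : 'rV[bop H]_d) (xi : H) (o : nat).
Hypothesis xi1 : sqn xi = 1.

(* The degree-[j] piece is spanned in [H] by orthonormal vectors [gvec j w],
   [size w = j], with [x 0 r] mapping degree [j] to degree [j.+1]; its copy sits
   on the basis vectors [kvec w], which avoid the first [o] ones. *)
Definition kvec (w : seq 'I_d) : H := u (o + choice.pickle w).

Lemma kvec_orthonormal : orthonormal_family kvec.
Proof.
move=> v w; rewrite ou eqn_add2l; congr (nat_of_bool _)%:R.
by rewrite (inj_eq (pcan_inj choice.pickleK)).
Qed.

(** The vectors [x 0 r (g t)] are indexed by the words [r :: t] of length [j.+1]; Gram-Schmidt
    returns one orthonormal vector per word even when they are dependent. *)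
Lemma next_degree j (g : seq 'I_d -> H) : exists g' : seq 'I_d -> H,
  orthonormal_family (fun t : j.+1.-tuple 'I_d => g' t) /\
  forall r (t : j.-tuple 'I_d), x 0 r (g t) =
    \sum_(t' : j.+1.-tuple 'I_d) inner (x 0 r (g t)) (g' t') *: g' t'.
Proof.
have [g' [og' g'P]] := gram_schmidt (fun t : j.+1.-tuple 'I_d => x 0 (thead t) (g (behead
  t))) ou.
(* The default value at words of another length is never read. *)
pose g'' (w : seq 'I_d) := if insub w is Some t then g' t else 0.
have g''E (t : j.+1.-tuple 'I_d) : g'' t = g' t by rewrite /g'' valK.
exists g''; split=> [t t'|r t]; first by rewrite !g''E.
under eq_bigr do rewrite !g''E.
exact: (g'P [tuple of r :: t]).
Qed.

(** A function of all words and not of tuples of length [j], so that the recursion has a type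
    independent of [j]. *)
Definition gvec := fix gvec (j : nat) : seq 'I_d -> H :=
  if j is j'.+1 then sval (cid (next_degree j' (gvec j'))) else fun=> xi.

Lemma gvec_orthonormal j : orthonormal_family (fun t : j.-tuple 'I_d => gvec j t).
Proof.
case: j => [|j]; last by case: (svalP (cid (next_degree j (gvec j)))).
move=> t t'; rewrite (tuple0 t) (tuple0 t') eqxx /= innerE xi1 //.
Qed.

Lemma gvec_next j r (t : j.-tuple 'I_d) : x 0 r (gvec j t) =
    \sum_(t' : j.+1.-tuple 'I_d) inner (x 0 r (gvec j t)) (gvec j.+1 t') *: gvec j.+1 t'.
Proof. by case: (svalP (cid (next_degree j (gvec j)))) => _; exact. Qed.

Definition Gam (j : nat) : bop H := \sum_(t : j.-tuple 'I_d) rank_one (gvec j t) (kvec t).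
Definition GamS (j : nat) : bop H := \sum_(t : j.-tuple 'I_d) rank_one (kvec t) (gvec j t).

Lemma Gam_kvec j w : Gam j (kvec w) = if size w == j then gvec j w else 0.
Proof.
rewrite /Gam bop_sumE; under eq_bigr do rewrite rank_oneE kvec_orthonormal.
case: eqP => [wj|wj].
  have wj' : size w == j by apply/eqP.
  rewrite (bigD1 (Tuple wj')) //= eqxx scale1r big1 ?addr0 // => t tw.
  have -> : (w == t) = false; last by rewrite scale0r.
  by apply/negbTE; apply: contra tw => /eqP tw; apply/eqP/val_inj.
rewrite big1 // => t _.
have -> : (w == t) = false; last by rewrite scale0r.
by apply/eqP => wt; apply: wj; rewrite wt size_tuple.
Qed.

Lemma GamS_gvec j (t : j.-tuple 'I_d) : GamS j (gvec j t) = kvec t.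
Proof.
rewrite /GamS bop_sumE; under eq_bigr do rewrite rank_oneE.
rewrite (bigD1 t) //= (gvec_orthonormal t t) eqxx scale1r big1 ?addr0 // => t' tt'.
by rewrite (gvec_orthonormal t t') eq_sym (negbTE tt') scale0r.
Qed.

Lemma Gam_GamS j v : (Gam j * GamS j) v =
  \sum_(t : j.-tuple 'I_d) inner v (gvec j t) *: gvec j t.
Proof.
rewrite /GamS mulr_sumr bop_sumE; apply: eq_bigr => t _.
by rewrite mul_rank_one rank_oneE Gam_kvec size_tuple eqxx.
Qed.

Lemma concrete_model : graded_model x Gam GamS.
Proof.
split=> [j|i j ij|j|r j].
- by apply: adjoint_sum => t; exact: adjoint_rank_one.
- rewrite /GamS mulr_sumr big1 // => t _.
  by rewrite mul_rank_one Gam_kvec size_tuple eq_sym (negbTE ij) rank_one0.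
- rewrite {2}/Gam mulr_sumr; apply: eq_bigr => t _; rewrite mul_rank_one.
  by rewrite !bop_mulE GamS_gvec Gam_kvec size_tuple eqxx.
set A := _ * _ * x 0 r; rewrite /Gam !mulr_sumr; apply: eq_bigr => t _.
by rewrite !mul_rank_one /A bop_mulE Gam_GamS -gvec_next.
Qed.

Lemma Gam0_kvec : Gam 0 (kvec [::]) = xi.
Proof. by rewrite Gam_kvec eqxx. Qed.

Lemma GamS0_xi : GamS 0 xi = kvec [::].
Proof. exact: (GamS_gvec [tuple]). Qed.

(** There are finitely many words of length [< N], so these degrees sit in a finite block: this is
    how truncated models become matrices. *)
Lemma Gam_block N : exists n0, forall n j, (n0 <= n)%N -> (j < N)%N ->
  block_proj u n * GamS j = GamS j /\ Gam j * block_proj u n = Gam j.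
Proof.
exists (\max_(j < N) \max_(t : j.-tuple 'I_d) (o + choice.pickle (val t)).+1) => n j n0n jN.
have tn (t : j.-tuple 'I_d) : (o + choice.pickle (val t) < n)%N.
  apply: leq_trans n0n; rewrite (leq_trans _ (leq_bigmax (Ordinal jN))) //=.
  exact: (leq_bigmax (F := fun t : j.-tuple 'I_d => (o + choice.pickle (val t)).+1) t).
split.
  rewrite /GamS mulr_sumr; apply: eq_bigr => t _.
  by rewrite mul_rank_one block_proj_basis // tn.
rewrite /Gam mulr_suml; apply: eq_bigr => t _.
by rewrite (rank_one_mul_adj _ _ (block_proj_adj u n)) block_proj_basis // tn.
Qed.

(** The first [o] basis vectors stay free, so that a tuple of matrices of size [o] can be placed
    beside the model. *)
Lemma Gam_offset j : block_proj u o * GamS j = 0 /\ Gam j * block_proj u o = 0.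
Proof.
have h w : (o + choice.pickle w < o)%N = false by rewrite ltnNge leq_addr.
split.
  rewrite /GamS mulr_sumr big1 // => t _.
  by rewrite mul_rank_one block_proj_basis // h rank_one0.
rewrite /Gam mulr_suml big1 // => t _.
rewrite (rank_one_mul_adj _ _ (block_proj_adj u o)) block_proj_basis // h.
by apply: bopP => v; rewrite rank_oneE linear0r scale0r.
Qed.

End ConcreteModel.

(** * Matrices as operators *)

Section Embedding.
Variables (R : realType) (H : infHilbertType R) (u : nat -> H).
Hypothesis ou : orthonormal_family u.

Definition vec n (c : 'cV[R[i]]_n) : H := \sum_i c i 0 *: u i.
Definition coords n (v : H) : 'cV[R[i]]_n := \col_i inner v (u i).
(** On square matrices this unfolds to [embed_mx]; intertwiners between different sizes are
    rectangular. *)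
Definition embed_rect p q (X : 'M[R[i]]_(p, q)) : bop H :=
  \sum_i \sum_j X i j *: rank_one (u i) (u j).
Definition compress p q (T : bop H) : 'M[R[i]]_(p, q) := \matrix_(i, j) inner (T (u j)) (u i).

Let ouo n : orthonormal_family (fun i : 'I_n => u i).
Proof. by move=> i j; rewrite ou. Qed.

Lemma vecK n (c : 'cV[R[i]]_n) : coords n (vec c) = c.
Proof.
apply/colP => i; rewrite mxE /vec.
exact: (inner_orthonormal (fun i => c i 0) (@ouo n) (index_enum_uniq _) (mem_index_enum i)).
Qed.

Lemma coordsK n v : vec (coords n v) = block_proj u n v.
Proof. by rewrite /vec /block_proj bop_sumE; apply: eq_bigr => i _; rewrite mxE rank_oneE. Qed.

Lemma vecD n (c c' : 'cV[R[i]]_n) : vec (c + c') = vec c + vec c'.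
Proof. by rewrite /vec -big_split; apply: eq_bigr => i _; rewrite mxE scalerDl. Qed.

Lemma vecZ n a (c : 'cV[R[i]]_n) : vec (a *: c) = a *: vec c.
Proof. by rewrite /vec scaler_sumr; apply: eq_bigr => i _; rewrite mxE scalerA. Qed.

Lemma vec0 n : vec (0 : 'cV[R[i]]_n) = 0.
Proof. by rewrite /vec big1 // => i _; rewrite mxE scale0r. Qed.

Lemma vec_sum n (I : Type) (r : seq I) (P : pred I) (F : I -> 'cV[R[i]]_n) :
  vec (\sum_(i <- r | P i) F i) = \sum_(i <- r | P i) vec (F i).
Proof. by elim/big_rec2: _ => [|i a b _ <-]; rewrite ?vec0 ?vecD. Qed.

Lemma embed_rectE p q (X : 'M[R[i]]_(p, q)) v : embed_rect X v = vec (X *m coords q v).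
Proof.
rewrite /embed_rect /vec bop_sumE; apply: eq_bigr => i _.
rewrite bop_sumE mxE scaler_suml; apply: eq_bigr => j _.
by rewrite bop_scaleE rank_oneE scalerA mxE.
Qed.

Lemma embed_rect_vec p q (X : 'M[R[i]]_(p, q)) c : embed_rect X (vec c) = vec (X *m c).
Proof. by rewrite embed_rectE vecK. Qed.

Lemma embed_rect_mul p q r (X : 'M[R[i]]_(p, q)) (Y : 'M[R[i]]_(q, r)) :
  embed_rect X * embed_rect Y = embed_rect (X *m Y).
Proof. by apply: bopP => v; rewrite bop_mulE !embed_rectE vecK mulmxA. Qed.

Lemma embed_rect1 n : embed_rect (1%:M : 'M[R[i]]_n) = block_proj u n.
Proof. by apply: bopP => v; rewrite embed_rectE mul1mx coordsK. Qed.

Lemma compressK p q T : embed_rect (compress p q T) = block_proj u p * T * block_proj u q.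
Proof.
apply: bopP => v; rewrite embed_rectE !bop_mulE -!coordsK; congr vec.
apply/colP => i; rewrite !mxE /vec linear_sum inner_suml; apply: eq_bigr => j _ /=.
by rewrite linearZ /= innerZl !mxE mulrC.
Qed.

Lemma embed_rectK p q (X : 'M[R[i]]_(p, q)) : compress p q (embed_rect X) = X.
Proof.
apply/matrixP => i j; rewrite mxE embed_rectE.
have -> : coords q (u j) = delta_mx j 0.
  by apply/colP => k; rewrite !mxE ou eqxx andbT eq_sym.
rewrite -colE; have := vecK (col j X) => /colP/(_ i); rewrite !mxE => <-.
by [].
Qed.

Lemma compress_mul p q r (S T : bop H) :
  compress p q S *m compress q r T = compress p r (S * block_proj u q * T).
Proof.
apply/matrixP => i j; rewrite !mxE !bop_mulE -coordsK /vec linear_sum inner_suml.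
by apply: eq_bigr => k _ /=; rewrite linearZ /= innerZl !mxE mulrC.
Qed.

Lemma embed_rect_proj p q (X : 'M[R[i]]_(p, q)) :
  block_proj u p * embed_rect X = embed_rect X /\ embed_rect X * block_proj u q = embed_rect X.
Proof. by rewrite -!embed_rect1 !embed_rect_mul mul1mx mulmx1. Qed.

Lemma euclid_normE n (c : 'cV[R[i]]_n) : euclid_norm c = rnorm (vec c).
Proof.
rewrite /euclid_norm /l2norm -[RHS]ger0_norm ?rnorm_ge0 // -sqrtr_sqr; congr Num.sqrt.
by rewrite -[LHS](sqn_orthonormal xpredT (fun i => c i 0) (@ouo n) (index_enum_uniq _)).
Qed.

Let euclid_normZ n (a : R) (c : 'cV[R[i]]_n) : euclid_norm (a%:C *: c) = `|a| * euclid_norm c.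
Proof. by rewrite !euclid_normE vecZ rnormZ rnorm_real. Qed.

Lemma rnorm_embed_le n (X : 'M[R[i]]_n) (M : R) v : mx_opnorm X <= M ->
  rnorm (embed_rect X v) <= M * rnorm v.
Proof.
move=> XM; have h := @opnorm_ub R 'cV[R[i]]_n 'cV[R[i]]_n (@euclid_norm R n) (@euclid_norm R
  n) (mulmx X) (rnorm (embed_rect X)).
have h0 : 0 <= mx_opnorm X.
  apply: (@opnorm_ge0 R 'cV[R[i]]_n 'cV[R[i]]_n _ _ _ (rnorm (embed_rect X))) => [w|w|a c|c].
  - exact: sqrtr_ge0.
  - exact: sqrtr_ge0.
  - exact: euclid_normZ.
  - by rewrite !euclid_normE -embed_rect_vec rnorm_bop_le.
rewrite embed_rectE -euclid_normE.
apply: (@le_trans _ _ (mx_opnorm X * euclid_norm (coords n v))).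
  apply: h => [c|c|c|a c|c].
  - exact: sqrtr_ge0.
  - exact: euclid_normZ.
  - exact: euclid_normZ.
  - by rewrite -scalemxAr.
  - by rewrite !euclid_normE -embed_rect_vec rnorm_bop_le.
rewrite ler_pM // ?sqrtr_ge0 // euclid_normE coordsK.
rewrite rnorm_le_sqn ?rnorm_ge0 // -[leRHS]/(sqn v) (projection_pythagoras v (block_proj_adj
  u n) (block_proj_idem ou n)).
by rewrite lerDl sqn_ge0.
Qed.

Variables (d I J : nat) (delta : 'M[freepoly R d]_(I, J)).

Lemma word_embed n (X : 'rV['M[R[i]]_n.+1]_d) w c :
  word (embed_tuple u X) w (vec c) = vec (word X w *m c).
Proof.
elim: w => [|r w IH]; first by rewrite !word_nil mul1mx.
by rewrite !word_cons bop_mulE IH mxE embed_rect_vec mulmxA.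
Qed.

Lemma eval_embed n (X : 'rV['M[R[i]]_n.+1]_d) p c :
  freepoly_eval p (embed_tuple u X) (vec c) = vec (freepoly_eval p X *m c).
Proof.
rewrite freepoly_evalE /freepoly_eval mulmx_suml vec_sum; apply: eq_bigr => w _.
by rewrite word_embed -scalemxAl vecZ.
Qed.

Lemma delta_vec_embed n (X : 'rV['M[R[i]]_n.+1]_d) v i :
  delta_vec delta (embed_tuple u X) (fun j => vec (v j)) i =
  vec (\sum_j freepoly_eval (delta i j) X *m v j).
Proof. by rewrite vec_sum; apply: eq_bigr => j _; rewrite eval_embed. Qed.

(** Only vectors of the block are tested. The embedded tuple is 0 on the complement, which is why
    [Bdelta_op_of_mx] also requires 0 in the ball. *)
Lemma Bdelta_mxP n (X : 'rV['M[R[i]]_n.+1]_d) : Bdelta_mx delta X <->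
  exists rho, [/\ 0 <= rho, rho < 1 & forall v : 'I_J -> 'cV_n.+1,
    \sum_i sqn (delta_vec delta (embed_tuple u X) (fun j => vec (v j)) i) <=
    rho * \sum_j sqn (vec (v j))].
Proof.
have [K K0 bd] := delta_contr_bounded delta (embed_tuple u X).
pose N := @euclid_norm R n.+1.
have E := @opnorm_lt1P R ('I_J -> 'cV[R[i]]_n.+1) ('I_I ->
  'cV[R[i]]_n.+1) (@l2norm R _ N J) (@l2norm R _ N I)
  (fun v i => \sum_j freemx_eval delta X i j *m (v j)) (Num.sqrt K).
have {}E := E (fun=> sqrtr_ge0 _) (fun=> sqrtr_ge0 _) (@l2normZ _ _ _ (@euclid_normZ n.+1) J)
  (@l2normZ _ _ _ (@euclid_normZ n.+1) I).
have {}E : Bdelta_mx delta X <-> _ := E _ _.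
have TE v i : N (\sum_j freemx_eval delta X i j *m (v j)) ^+ 2 =
  sqn (delta_vec delta (embed_tuple u X) (fun j => vec (v j)) i).
  rewrite /N euclid_normE delta_vec_embed; congr (rnorm (vec _) ^+ 2).
  by apply: eq_bigr => j _; rewrite mxE.
have VE v : \sum_(j < J) N (v j) ^+ 2 = \sum_j sqn (vec (v j)).
  by apply: eq_bigr => j _; rewrite /N euclid_normE.
rewrite E.
  split=> -[rho [r0 r1 rP]]; exists rho; split=> // v; have := rP v.
    by rewrite !sqr_l2norm VE; under eq_bigr do rewrite TE.
  by rewrite !sqr_l2norm VE; under [X in _ -> X <= _]eq_bigr do rewrite TE.
- move=> a v; apply/funext => i; rewrite -[RHS]/(_ *: \sum_j _ *m (v j)) scaler_sumr.
  by apply: eq_bigr => j _; rewrite -scalemxAr.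
- move=> v; rewrite -(@ler_pXn2r _ 2) ?nnegrE ?mulr_ge0 ?sqrtr_ge0 //.
  rewrite exprMn !sqr_l2norm sqr_sqrtr // VE (le_trans _ (bd (fun j => vec (v j)))) //.
  by apply: ler_sum => i _; rewrite TE.
Qed.

Lemma Bdelta_mx_of_op n (X : 'rV['M[R[i]]_n.+1]_d) :
  Bdelta_op delta (embed_tuple u X) -> Bdelta_mx delta X.
Proof.
move=> /Bdelta_opP[rho [r0 r1 h]]; by apply/Bdelta_mxP; exists rho; split.
Qed.

Lemma embed_tuple_proj n (X : 'rV['M[R[i]]_n.+1]_d) r :
  block_proj u n.+1 * embed_tuple u X 0 r = embed_tuple u X 0 r * block_proj u n.+1.
Proof. by rewrite mxE; have [-> ->] := embed_rect_proj (X 0 r). Qed.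

Lemma Bdelta_op_of_mx n (X : 'rV['M[R[i]]_n.+1]_d) : Bdelta_op delta (0 : 'rV[bop H]_d) ->
  Bdelta_mx delta X -> Bdelta_op delta (embed_tuple u X).
Proof.
move=> /Bdelta_opP[rho0 [_ rho01 h0]] /Bdelta_mxP[rho [r0 r1 h]]; apply/Bdelta_opP.
exists (Num.max rho rho0); split; [by rewrite le_max r0|by rewrite gt_max r1|].
have S0 (w : 'I_J -> H) : 0 <= \sum_j sqn (w j) by rewrite sumr_ge0 // => j _; rewrite sqn_ge0.
have pyth v := projection_pythagoras v (block_proj_adj u n.+1) (block_proj_idem ou n.+1).
apply: (delta_contr_split pyth) => v.
  under eq_bigr do rewrite (delta_vec_intertwine _ _ _ (embed_tuple_proj X)).
  under [X in _ <= _ * X]eq_bigr do rewrite -coordsK.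
  rewrite (le_trans _ (le_trans (h (fun j => coords n.+1 (v j))) _)) //.
    apply: ler_sum => i _; rewrite le_eqVlt; apply/orP; left; apply/eqP.
    by congr sqn; congr delta_vec; apply/funext => j; rewrite coordsK.
  by rewrite ler_wpM2r // le_max lexx.
have hh w : w - block_proj u n.+1 w = (1 - block_proj u n.+1) w by [].
have hi r : (1 - block_proj u n.+1) * embed_tuple u X 0 r =
  (0 : 'rV[bop H]_d) 0 r * (1 - block_proj u n.+1).
  rewrite [X in X * (1 - _)]mxE mul0r mulrBl mul1r mxE.
  by have [-> _] := embed_rect_proj (X 0 r); rewrite subrr.
under eq_bigr do rewrite hh (delta_vec_intertwine _ _ _ hi).
rewrite (le_trans (h0 (fun j => (1 - block_proj u n.+1) (v j)))) //.
by rewrite ler_wpM2r ?le_max ?lexx ?orbT //; exact: S0.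
Qed.

Section Transport.
Variables (f : graded_fun R d) (M : R).
Hypotheses (hf : nc_function_mx delta f)
  (hM : forall n (x : 'rV['M[R[i]]_n.+1]_d), Bdelta_mx delta x -> mx_opnorm (@f n x) <= M)
  (hM0 : 0 <= M).

Definition in_block n (y : 'rV[bop H]_d) :=
  forall r, block_proj u n * y 0 r = y 0 r /\ y 0 r * block_proj u n = y 0 r.

(* [f], transported to the operator tuples living on the first basis vectors. *)
Definition lift_fun n (y : 'rV[bop H]_d) : bop H :=
  embed_rect (@f n (\row_r compress n.+1 n.+1 (y 0 r))).

Lemma embed_compress n (y : 'rV[bop H]_d) : in_block n.+1 y ->
  embed_tuple u (\row_r compress n.+1 n.+1 (y 0 r)) = y.
Proof.
move=> yn; apply/rowP => r; rewrite !mxE -[LHS]/(embed_rect _) compressK.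
by have [-> ->] := yn r.
Qed.

Lemma compress_embed n (X : 'rV['M[R[i]]_n.+1]_d) :
  \row_r compress n.+1 n.+1 (embed_tuple u X 0 r) = X.
Proof. by apply/rowP => r; rewrite !mxE embed_rectK. Qed.

Lemma in_block_embed n (X : 'rV['M[R[i]]_n.+1]_d) : in_block n.+1 (embed_tuple u X).
Proof. by move=> r; rewrite mxE; exact: embed_rect_proj. Qed.

Lemma Bdelta_compress n y : in_block n.+1 y -> Bdelta_op delta y ->
  Bdelta_mx delta (\row_r compress n.+1 n.+1 (y 0 r)).
Proof. by move=> yn hy; apply: Bdelta_mx_of_op; rewrite embed_compress. Qed.

Lemma rnorm_lift_fun n y v : in_block n.+1 y -> Bdelta_op delta y ->
  rnorm (lift_fun n y v) <= M * rnorm v.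
Proof. by move=> yn hy; apply: rnorm_embed_le; apply: hM; exact: Bdelta_compress. Qed.

Lemma lift_fun_proj n y : block_proj u n.+1 * lift_fun n y = lift_fun n y /\
   lift_fun n y * block_proj u n.+1 = lift_fun n y.
Proof. exact: embed_rect_proj. Qed.

(** As [L] lives between the two blocks it is the embedding of its rectangular compression, and [hf]
    applies to the latter. *)
Lemma lift_fun_intertwine m n x y (L : bop H) : in_block m.+1 x -> in_block n.+1 y ->
  Bdelta_op delta x -> Bdelta_op delta y ->
  block_proj u n.+1 * L = L -> L * block_proj u m.+1 = L ->
  (forall r, L * x 0 r = y 0 r * L) -> L * lift_fun m x = lift_fun n y * L.
Proof.
move=> xm yn hx hy PL LP Lxy.
have <- : embed_rect (compress n.+1 m.+1 L) = L by rewrite compressK PL LP.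
rewrite !embed_rect_mul; congr embed_rect.
apply: hf; [exact: Bdelta_compress|exact: Bdelta_compress|].
move=> r; rewrite !mxE !compress_mul; congr compress.
by rewrite LP Lxy; have [_ ->] := yn r.
Qed.

End Transport.
End Embedding.

(** * Power series coefficients *)

Section Fock.
Variables (R : realType) (H : infHilbertType R) (u : nat -> H).
Hypothesis ou : orthonormal_family u.
Variable d : nat.

Local Notation k := (@kvec R H u d 0).

Let ok : orthonormal_family k.
Proof. exact: kvec_orthonormal. Qed.

Lemma sum_words (V : nmodType) (F : seq 'I_d -> V) N (w : seq 'I_d) :
  \sum_(j < N) \sum_(t : j.-tuple 'I_d) (if w == t then F t else 0) =
  if (size w < N)%N then F w else 0.
Proof.
have h j : \sum_(t : j.-tuple 'I_d) (if w == t then F t else 0) =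
  if size w == j then F w else 0.
  case: eqP => [wj|wj].
    have wj' : size w == j by apply/eqP.
    rewrite (bigD1 (Tuple wj')) //= eqxx big1 ?addr0 // => t tw.
    by rewrite ifN //; apply: contra tw => /eqP tw; apply/eqP/val_inj.
  by rewrite big1 // => t _; rewrite ifN //; apply/eqP => wt; apply: wj; rewrite wt size_tuple.
under eq_bigr do rewrite h.
rewrite -(big_mkord xpredT (fun j => if size w == j then F w else 0)).
case: ltnP => wN.
  rewrite (bigD1_seq (size w)) ?mem_index_iota ?iota_uniq //= eqxx big1 ?addr0 // => j jw.
  by rewrite ifN // eq_sym.
rewrite big_nat_cond big1 // => j /andP[/= jN _].
by rewrite ifN // gtn_eqF // (leq_trans jN).
Qed.

Definition word_map (N : nat) (F : seq 'I_d -> H) : bop H :=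
  \sum_(j < N) \sum_(t : j.-tuple 'I_d) rank_one (F t) (k t).

Lemma word_mapE N F v :
  word_map N F v = \sum_(j < N) \sum_(t : j.-tuple 'I_d) inner v (k t) *: F t.
Proof.
rewrite /word_map bop_sumE; apply: eq_bigr => j _.
by rewrite bop_sumE; apply: eq_bigr => t _.
Qed.

Lemma word_map_kvec N F w : word_map N F (k w) = if (size w < N)%N then F w else 0.
Proof.
rewrite word_mapE -(sum_words F N w); apply: eq_bigr => j _; apply: eq_bigr => t _.
by rewrite ok; case: eqP => _; rewrite ?scale1r ?scale0r.
Qed.

Lemma mul_word_map N F T : T * word_map N F = word_map N (fun w => T (F w)).
Proof.
rewrite /word_map mulr_sumr; apply: eq_bigr => j _.
by rewrite mulr_sumr; apply: eq_bigr => t _; rewrite mul_rank_one.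
Qed.

Lemma scale_word_map a N F : a *: word_map N F = word_map N (fun w => a *: F w).
Proof.
rewrite /word_map scaler_sumr; apply: eq_bigr => j _.
by rewrite scaler_sumr; apply: eq_bigr => t _; rewrite rank_oneZl.
Qed.

Lemma eq_word_map N F G : (forall w, (size w < N)%N -> F w = G w) ->
  word_map N F = word_map N G.
Proof.
move=> FG; apply: eq_bigr => j _; apply: eq_bigr => t _.
by rewrite FG // size_tuple.
Qed.

Lemma words_in_block N : exists n, forall w, (size w < N)%N -> block_proj u n (k w) = k w.
Proof.
exists (\max_(j < N) \max_(t : j.-tuple 'I_d) (0 + choice.pickle (val t)).+1) => w wN.
rewrite block_proj_basis //; case: ifP => // /negP[].
rewrite (leq_trans _ (leq_bigmax (Ordinal wN))) //=.
exact: (leq_bigmax (F := fun t : (size w).-tuple 'I_d => (0 +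
  choice.pickle (val t)).+1) (in_tuple w)).
Qed.

Lemma word_map_block N F n : (forall w, (size w < N)%N -> block_proj u n (k w) = k w) ->
  word_map N F * block_proj u n = word_map N F.
Proof.
move=> kn; rewrite /word_map mulr_suml; apply: eq_bigr => j _.
rewrite mulr_suml; apply: eq_bigr => t _.
by rewrite (rank_one_mul_adj _ _ (block_proj_adj u n)) kn // size_tuple.
Qed.

(** Left creation operators, cut so that [k w] is killed when [size w = N]. Words of length up to
    [N] survive on the vacuum [k [::]], hence nilpotency of order [N.+1]. *)
Definition fock (N : nat) : 'rV[bop H]_d := \row_r word_map N (fun w => k (r :: w)).

Lemma fock_kvec N r w : fock N 0 r (k w) = if (size w < N)%N then k (r :: w) else 0.
Proof. by rewrite mxE word_map_kvec. Qed.

Lemma word_fock N w : word (fock N) w (k [::]) = if (size w <= N)%N then k w else 0.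
Proof.
elim: w => [|r w IH]; first by rewrite word_nil.
rewrite word_cons bop_mulE IH /=; case: (leqP (size w) N) => wN.
  by rewrite fock_kvec.
by rewrite linear0 ltnNge (ltnW wN).
Qed.

Definition hom_part (c : seq 'I_d -> R[i]) (j : nat) (x : 'rV[bop H]_d) : bop H :=
  \sum_(t : j.-tuple 'I_d) c t *: word x t.

Lemma hom_partE c j x v :
  hom_part c j x v = \sum_(t : j.-tuple 'I_d) c t *: word x t v.
Proof. by rewrite /hom_part bop_sumE; apply: eq_bigr => t _. Qed.

Lemma eq_hom_part c c' j x : (forall w, size w = j -> c w = c' w) ->
  hom_part c j x = hom_part c' j x.
Proof. by move=> cc; apply: eq_bigr => t _; rewrite cc // size_tuple. Qed.

Variables (I J : nat) (delta : 'M[freepoly R d]_(I, J)).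
Hypothesis B0 : Bdelta_op delta (0 : 'rV[bop H]_d).
Variable f : graded_fun R d.
Hypothesis hf : nc_function_mx delta f.

Lemma scaled_fock N : exists en : R * nat,
  [/\ 0 < en.1, in_block u en.2.+1 (scale_tuple en.1%:C (fock N)),
      Bdelta_op delta (scale_tuple en.1%:C (fock N)) &
      forall w, (size w < N.+1)%N -> block_proj u en.2.+1 (k w) = k w].
Proof.
have [n nP] := words_in_block N.+1.
have nP' w : (size w < N.+1)%N -> block_proj u n.+1 (k w) = k w.
  by move=> /nP <-; rewrite -bop_mulE block_proj_mul.
have [C C0 CP] := tuple_norm_bound (fock N).
have [rho [r0 r1 hr]] := (Bdelta_opP _ _).1 B0.
have [eta [rho' [e0 r'0 r'1 hp]]] := @delta_contr_perturb R H d I J delta 0 rho (lexx _) r0 r1.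
have C1 : 0 < C + 1 by rewrite ltr_wpDl.
(* The scaled tuple has entries of norm at most [eta], so it is a small perturbation of the tuple
   0. *)
exists (eta / (C + 1), n); rewrite /=; split; [exact: divr_gt0| | |exact: nP'].
  move=> r; rewrite !mxE -scalerAr -scalerAl; split; congr (_ *: _).
    by rewrite mul_word_map; apply: eq_word_map => w wN; rewrite nP'.
  by rewrite word_map_block // => w wN; rewrite nP' // ltnW.
apply/Bdelta_opP; exists rho'; split=> //; apply: (hp 0) => // r; first by rewrite mxE rnorm0.
rewrite [X in _ - X]mxE subr0 mxE rnormZ rnorm_real gtr0_norm ?divr_gt0 //.
rewrite mulrAC ler_pdivrMr // ler_pM2l // (le_trans (CP r)) // lerDl ler01 //.
Qed.

Section Coefficients.
Variables (eps : nat -> R) (nf : nat -> nat).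
Let sfock N : 'rV[bop H]_d := scale_tuple (eps N)%:C (fock N).
Hypotheses (eps_gt0 : forall N, 0 < eps N)
  (sfock_block : forall N, in_block u (nf N).+1 (sfock N))
  (sfock_Bdelta : forall N, Bdelta_op delta (sfock N))
  (sfock_kvec : forall N w, (size w < N.+1)%N -> block_proj u (nf N).+1 (k w) = k w).

Let epsC_neq0 N : (eps N)%:C != 0 :> R[i].
Proof. by apply/eqP => /(@complexI R) e0; have := eps_gt0 N; rewrite e0 ltxx. Qed.

(** The [k w] component of [f] at the scaled Fock tuple, applied to the vacuum. The word [w] of that
    tuple maps the vacuum to [eps N ^ size w] times [k w], whence the division. *)
Let coef N w : R[i] :=
  inner (lift_fun u f (nf N) (sfock N) (k [::])) (k w) * (eps N)%:C ^- size w.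

Let fock_formula N m y v : in_block u m.+1 y -> Bdelta_op delta y ->
  block_proj u m.+1 v = v -> (forall w, size w = N.+1 -> word y w v = 0) ->
  lift_fun u f m y v = \sum_(j < N.+1) hom_part (coef N) j y v.
Proof.
move=> ym hy vm ynil.
(* The negative powers undo the scaling of the Fock tuple. Intertwining on words of length [N],
   where that tuple is cut, is exactly the vanishing of [word y w v] in length [N.+1]. *)
pose F w := (eps N)%:C ^- size w *: word y w v.
pose L := word_map N.+1 F.
have wm w : block_proj u m.+1 (word y w v) = word y w v.
  case: w => [|r w]; first by rewrite word_nil.
  by rewrite word_cons bop_mulE -bop_mulE; have [-> _] := ym r.
have Lint r : L * sfock N 0 r = y 0 r * L.
  rewrite mul_word_map mxE mxE -scalerAr mul_word_map.
  rewrite [RHS]/word_map big_ord_recr /= [X in _ = _ + X]big1 ?addr0.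
    rewrite -[RHS]/(word_map N (fun w => y 0 r (F w))) scale_word_map.
    apply: eq_word_map => w wN; rewrite word_map_kvec /= ltnS wN /F word_cons.
    rewrite [y 0 r (_ *: _)]linearZ /= scalerA exprS invfM mulrA divff // mul1r //.
  move=> t _; rewrite /F linearZ /= -bop_mulE -word_cons ynil ?scaler0 ?rank_one0 //=.
  by rewrite size_tuple.
have := lift_fun_intertwine ou hf (sfock_block N) ym (sfock_Bdelta N) hy _ _ Lint.
have PL : block_proj u m.+1 * L = L.
  by rewrite mul_word_map; apply: eq_word_map => w _; rewrite /F linearZ /= wm.
have LP : L * block_proj u (nf N).+1 = L by rewrite word_map_block // => w; exact: sfock_kvec.
move=> /(_ PL LP) /(congr1 (fun T : bop H => T (k [::]))); rewrite !bop_mulE.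
have -> : L (k [::]) = v by rewrite word_map_kvec /= /F expr0 invr1 scale1r word_nil.
move=> <-; rewrite word_mapE; apply: eq_bigr => j _.
by rewrite hom_partE; apply: eq_bigr => t _; rewrite /F scalerA.
Qed.

(** The shorter Fock tuple is nilpotent enough for [fock_formula] at the larger [N]; comparing the
    [k w] components of the two expressions for its value on the vacuum identifies the
    coefficients. *)
Let coef_stable N w : (size w <= N)%N -> coef N w = coef (size w) w.
Proof.
move=> wN; set n := size w.
have E : lift_fun u f (nf n) (sfock n) (k [::]) =
  \sum_(j < N.+1) hom_part (coef N) j (sfock n) (k [::]).
  apply: fock_formula; [exact: sfock_block|exact: sfock_Bdelta|exact: sfock_kvec|].
  move=> v vN; rewrite word_scaleE word_fock vN ifN ?scaler0 //.
  by rewrite -ltnNge ltnS.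
rewrite {2}/coef E -/n inner_suml.
under eq_bigr do rewrite hom_partE inner_suml.
rewrite (eq_bigr (fun j : 'I_N.+1 => \sum_(t : j.-tuple 'I_d) (if w == t then coef N t * (eps
  n)%:C ^+ n else 0))).
  by rewrite (sum_words (fun t => coef N t * (eps n)%:C ^+ n)) ltnS wN mulfK // expf_neq0.
move=> j _; apply: eq_bigr => t _.
rewrite word_scaleE word_fock scalerA innerZl.
case: eqP => [<-|wt]; first by rewrite leqnn ok eqxx mulr1.
case: ifP => _; last by rewrite linear0l mulr0.
by rewrite ok; case: eqP => [tw|]; rewrite ?mulr0 //; case: wt.
Qed.

Let coef_expansion N m y v : (0 < N)%N -> in_block u m.+1 y -> Bdelta_op delta y ->
  block_proj u m.+1 v = v -> (forall w, size w = N -> word y w v = 0) ->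
  lift_fun u f m y v = \sum_(j < N) hom_part (fun w => coef (size w) w) j y v.
Proof.
case: N => [//|N] _ ym hy vm ynil.
rewrite (fock_formula ym hy vm ynil); apply: eq_bigr => j _.
rewrite (@eq_hom_part (coef N) (fun w => coef (size w) w) j y); first by [].
by move=> w wj; apply: coef_stable; rewrite wj -ltnS ltn_ord.
Qed.

Lemma nilpotent_expansion_of : exists c : seq 'I_d -> R[i], forall N m y v,
  (0 < N)%N -> in_block u m.+1 y -> Bdelta_op delta y -> block_proj u m.+1 v = v ->
  (forall w, size w = N -> word y w v = 0) ->
  lift_fun u f m y v = \sum_(j < N) hom_part c j y v.
Proof. by exists (fun w => coef (size w) w); exact: coef_expansion. Qed.

End Coefficients.

(* A vector killed by all words of length [N] is the image of the vacuum under an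
   intertwiner from the truncated Fock tuple, so [f] is a polynomial there. *)
Lemma nilpotent_expansion : exists c : seq 'I_d -> R[i], forall N m y v,
  (0 < N)%N -> in_block u m.+1 y -> Bdelta_op delta y -> block_proj u m.+1 v = v ->
  (forall w, size w = N -> word y w v = 0) ->
  lift_fun u f m y v = \sum_(j < N) hom_part c j y v.
Proof.
pose en N := cid (scaled_fock N).
by apply: (@nilpotent_expansion_of (fun N => (sval (en N)).1) (fun N => (sval (en N)).2)) => N;
  case: (svalP (en N)).
Qed.

End Fock.

(** * The extension *)

Section GeometricSeries.
Variables (R : realType) (H : infHilbertType R).

Lemma rnorm_le_sub_geometric (F : nat -> H) (K t : R) : 0 <= K -> 0 <= t -> t < 1 ->
  (forall j, rnorm (F j) <= K * t ^+ j) -> forall m n, (m <= n)%N ->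
  rnorm (\sum_(m <= j < n) F j) <= K / (1 - t) * (t ^+ m - t ^+ n).
Proof.
move=> K0 t0 t1 FK m n mn; have t1' : 1 - t != 0 by rewrite subr_eq0 gt_eqF.
rewrite (le_trans (rnorm_sum _ _ _)) // (@le_trans _ _ (\sum_(m <= j < n) K * t ^+ j)) //.
  by apply: ler_sum => j _.
rewrite le_eqVlt; apply/orP; left; apply/eqP.
elim: n mn => [|n IH]; first by rewrite leqn0 => /eqP ->; rewrite big_geq // subrr mulr0.
rewrite leq_eqVlt => /orP[/eqP ->|]; first by rewrite big_geq // subrr mulr0.
by rewrite ltnS => mn; rewrite big_nat_recr //= IH // exprS; field.
Qed.

Lemma geometric_operator_series (A : nat -> bop H) (K t : R) : 0 <= K -> 0 <= t -> t < 1 ->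
  (forall j v, rnorm (A j v) <= K * t ^+ j * rnorm v) ->
  exists T : bop H, (forall v, cvs (fun n => \sum_(j < n) A j v) (T v)) /\
    rnorm T <= K / (1 - t).
Proof.
move=> K0 t0 t1 AK; have t1' : 0 < 1 - t by rewrite subr_gt0.
have Kt0 : 0 <= K / (1 - t) by rewrite divr_ge0 // ltW.
have E n v : (\sum_(j < n) A j) v = \sum_(0 <= j < n) A j v.
  by rewrite bop_sumE big_mkord.
have AK' v j : rnorm (A j v) <= K * rnorm v * t ^+ j by rewrite mulrAC.
have Kv0 (v : H) : 0 <= K * rnorm v by rewrite mulr_ge0 ?rnorm_ge0.
have [||T [TP TK]] := @bop_limit _ _ (fun n => \sum_(j < n) A j) ((K / (1 - t)) ^+ 2)
  (sqr_ge0 _).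
- move=> n v; rewrite E -exprMn -rnorm_le_sqn ?(mulr_ge0 Kt0) ?rnorm_ge0 //.
  rewrite (le_trans (rnorm_le_sub_geometric (Kv0 v) t0 t1 (AK' v) (leq0n n))) //.
  rewrite expr0 [leRHS]mulrAC ler_piMr ?divr_ge0 ?(ltW t1') //.
  by rewrite gerBl exprn_ge0.
- move=> v; pose K' := K * rnorm v / (1 - t).
  have K'0 : 0 <= K' by rewrite /K' divr_ge0 ?(ltW t1').
  (* The tail estimate is a multiple of [t ^ m - t ^ n], and [(p - q)^2 <= p^2 - q^2] for
     [0 <= q <= p] puts its square in the required form. *)
  apply: (@cvs_complete _ _ _ (fun n => - (K' ^+ 2 * (t ^+ n) ^+ 2)) 0).
    by move=> n; rewrite oppr_le0 mulr_ge0 ?sqr_ge0.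
  move=> m n mn; rewrite !E (big_cat_nat (leq0n _) mn) /= addrAC subrr add0r.
  have h := rnorm_le_sub_geometric (Kv0 v) t0 t1 (AK' v) mn.
  have tnm : t ^+ n <= t ^+ m by rewrite ler_wiXn2l // ltW.
  rewrite (@le_trans _ _ ((K' * (t ^+ m - t ^+ n)) ^+ 2)) //.
    by rewrite -rnorm_le_sqn // mulr_ge0 ?subr_ge0.
  rewrite exprMn opprK [leRHS]addrC -mulrBr ler_wpM2l ?sqr_ge0 //.
  have := exprn_ge0 n t0; move: (t ^+ n) (t ^+ m) tnm => a b ab a0.
  by nra.
exists T; split=> [v|]; first by move: (TP v); congr (cvs _ _); apply/funext => n;
  rewrite bop_sumE.
apply: rnorm_bop_ub => // v; rewrite rnorm_le_sqn ?(mulr_ge0 Kt0) ?rnorm_ge0 //.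
by rewrite exprMn; exact: TK.
Qed.

End GeometricSeries.

Section ModelInBall.
Variables (R : realType) (H : infHilbertType R) (u : nat -> H).
Hypothesis ou : orthonormal_family u.
Variables (d I J : nat) (delta : 'M[freepoly R d]_(I, J)).
Hypothesis B0 : Bdelta_op delta (0 : 'rV[bop H]_d).
Hypothesis hbal : balanced (Bdelta_op (H := H) delta).

Definition blocks_of (Gam GamS : nat -> bop H) (N m : nat) :=
  forall j, (j < N)%N -> block_proj u m * GamS j = GamS j /\ Gam j * block_proj u m = Gam j.

Lemma model_exists x xi o : Bdelta_op delta x -> sqn xi = 1 ->
  exists (Gam GamS : nat -> bop H) z kv, [/\ graded_model x Gam GamS /\ shift_of x Gam GamS z,
    Gam 0 kv = xi /\ GamS 0 xi = kv,
    exists rho, [/\ 0 <= rho, rho < 1, delta_contr delta rho z & forall N,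
      delta_contr delta rho (gtrunc Gam GamS z N)],
    forall N, exists m, (o <= m)%N /\ blocks_of Gam GamS N m.+1 &
    forall j, block_proj u o * GamS j = 0 /\ Gam j * block_proj u o = 0].
Proof.
move=> hx xi1.
have mG := concrete_model ou x o xi1.
have [z zP] := graded_shift mG.
have [rho1 [r0 r1 hr]] : exists rho, [/\ 0 <= rho, rho < 1 &
    forall a : R[i], rnorm a = 1 -> delta_contr delta rho (scale_tuple a x)].
  apply: delta_contr_circle => a a1; apply: (hbal _ hx).
  by rewrite rnormE a1.
have [rho2 [r20 r21 hr2]] := (Bdelta_opP _ _).1 B0.
(* [rho1] serves all rotations of [x], and [rho2] the complement of the model, where the tuple is
   0. *)
pose rho := Num.max rho1 rho2.
have rho0 : 0 <= rho by rewrite le_max r0.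
have circ (a : R[i]) : rnorm a = 1 -> delta_contr delta rho (scale_tuple a x).
  by move=> /hr; apply: delta_contr_mono; rewrite le_max lexx.
have contr0 : delta_contr delta rho (0 : 'rV[bop H]_d).
  by apply: delta_contr_mono hr2; rewrite le_max lexx orbT.
exists (Gam ou x xi o), (GamS ou x xi o), z, (@kvec R H u d o [::]); split.
- by [].
- by split; [exact: Gam0_kvec|exact: GamS0_xi].
- exists rho; split => //; first by rewrite gt_max r1.
    exact: (delta_contr_shift mG zP rho0 circ contr0).
  move=> N; exact: (delta_contr_gtrunc mG zP rho0 circ contr0).
- move=> N; have [m mP] := Gam_block ou x xi o N.
  exists (maxn o m); split; first exact: leq_maxl.
  by move=> j jN; apply: mP => //; rewrite leqW // leq_maxr.
by move=> j; exact: Gam_offset.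
Qed.

Variables (x : 'rV[bop H]_d) (Gam GamS : nat -> bop H) (z : 'rV[bop H]_d) (kv xi : H).
Hypotheses (mG : graded_model x Gam GamS) (zP : shift_of x Gam GamS z).
Hypotheses (G0 : Gam 0 kv = xi) (GS0 : GamS 0 xi = kv).

Lemma Gam_kv j : Gam j kv = if j == 0 then xi else 0.
Proof.
case: j => [|j] //=; rewrite -GS0 -bop_mulE.
by case: mG => _ h _ _; rewrite h.
Qed.

Lemma gproj_kv N : (0 < N)%N -> gproj Gam GamS N kv = kv.
Proof. by move=> N0; rewrite -{1}GS0 -bop_mulE (gproj_GamS mG) N0 GS0. Qed.

Lemma blocks_gproj N m : blocks_of Gam GamS N m ->
  block_proj u m * gproj Gam GamS N = gproj Gam GamS N /\
  gproj Gam GamS N * block_proj u m = gproj Gam GamS N.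
Proof.
move=> bN; rewrite /gproj mulr_sumr mulr_suml; split; apply: eq_bigr => j _;
  have [h1 h2] := bN j (ltn_ord j); first by rewrite mulrA h1.
by rewrite -mulrA h2.
Qed.

Lemma gtrunc_in_block N m : blocks_of Gam GamS N m -> in_block u m (gtrunc Gam GamS z N).
Proof.
move=> /blocks_gproj[PQ QP] r; split; first by rewrite mxE mulrA PQ.
by rewrite mxE (gproj_z mG zP) -mulrA QP.
Qed.

Lemma blocks_kv N m : (0 < N)%N -> blocks_of Gam GamS N m -> block_proj u m kv = kv.
Proof. by move=> N0 bN; rewrite -GS0 -bop_mulE; have [-> _] := bN 0 N0. Qed.

Lemma Gam_hom_part c l j : Gam l (hom_part c j z kv) = if l == j then hom_part c j x xi else 0.
Proof.
rewrite !hom_partE linear_sum /=; case: eqP => [<-|lj].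
  apply: eq_bigr => t _; rewrite linearZ /= -bop_mulE (Gam_word zP) size_tuple leqnn subnn.
  by rewrite bop_mulE G0.
rewrite big1 // => t _; rewrite linearZ /= -bop_mulE (Gam_word zP) size_tuple.
case: leqP => jl; last by rewrite bop_zeroE scaler0.
rewrite bop_mulE Gam_kv ifN ?linear0 ?scaler0 // subn_eq0 -ltnNge ltn_neqAle jl andbT.
by apply/eqP => ?; apply: lj.
Qed.

Variables (f : graded_fun R d) (c : seq 'I_d -> R[i]).
Hypothesis hc : forall N m y v,
  (0 < N)%N -> in_block u m.+1 y -> Bdelta_op delta y -> block_proj u m.+1 v = v ->
  (forall w, size w = N -> word y w v = 0) ->
  lift_fun u f m y v = \sum_(j < N) hom_part c j y v.

Lemma lift_gtrunc N m l : (0 < N)%N -> (l < N)%N -> blocks_of Gam GamS N m.+1 ->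
  Bdelta_op delta (gtrunc Gam GamS z N) ->
  Gam l (lift_fun u f m (gtrunc Gam GamS z N) kv) = hom_part c l x xi.
Proof.
move=> N0 lN bN hB.
rewrite (hc N0 (gtrunc_in_block bN) hB (blocks_kv N0 bN)); last first.
  by move=> w wN; rewrite (gtrunc_nilpotent mG zP) ?wN.
have -> : \sum_(j < N) hom_part c j (gtrunc Gam GamS z N) kv =
    gproj Gam GamS N (\sum_(j < N) hom_part c j z kv).
  rewrite linear_sum; apply: eq_bigr => j _ /=; rewrite !hom_partE linear_sum.
  apply: eq_bigr => t _ /=; rewrite linearZ /= -{1}(gproj_kv N0) -bop_mulE.
  by rewrite -(word_gtrunc mG zP).
rewrite -bop_mulE (Gam_gproj mG) lN linear_sum (bigD1 (Ordinal lN)) //=.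
rewrite Gam_hom_part eqxx big1 ?addr0 // => j jl.
by rewrite Gam_hom_part ifN // eq_sym.
Qed.

End ModelInBall.

Section Extension.
Variables (R : realType) (H : infHilbertType R) (u : nat -> H).
Hypothesis ou : orthonormal_family u.
Variables (d I J : nat) (delta : 'M[freepoly R d]_(I, J)).
Hypothesis B0 : Bdelta_op delta (0 : 'rV[bop H]_d).
Hypothesis hbal : balanced (Bdelta_op (H := H) delta).
Variables (f : graded_fun R d) (M : R).
Hypotheses (hf : nc_function_mx delta f) (hM0 : 0 <= M)
  (hM : forall n (x : 'rV['M[R[i]]_n.+1]_d), Bdelta_mx delta x -> mx_opnorm (@f n x) <= M).
Variable c : seq 'I_d -> R[i].
Hypothesis hc : forall N m (y : 'rV[bop H]_d) v,
  (0 < N)%N -> in_block u m.+1 y -> Bdelta_op delta y -> block_proj u m.+1 v = v ->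
  (forall w, size w = N -> word y w v = 0) ->
  lift_fun u f m y v = \sum_(j < N) hom_part c j y v.
Implicit Types (x y z : 'rV[bop H]_d).

Lemma normalize (xi : H) : xi != 0 ->
  exists eta : H, sqn eta = 1 /\ xi = (rnorm xi)%:C *: eta.
Proof.
move=> xi0; have nx : 0 < rnorm xi.
  by rewrite lt_neqAle rnorm_ge0 andbT eq_sym; apply: contra_neq xi0 => /rnorm_eq0.
exists ((rnorm xi)^-1%:C *: xi); split.
  by rewrite sqnZ /sqn rnorm_real normfV (gtr0_norm nx) -exprMn mulVf ?expr1n // gt_eqF.
by rewrite scalerA -rmorphM /= mulfV ?gt_eqF // scale1r.
Qed.

Lemma hom_part_bound x xi l : Bdelta_op delta x ->
  rnorm (hom_part c l x xi) <= M * rnorm xi.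
Proof.
move=> hx; have [->|xi0] := eqVneq xi 0; first by rewrite linear0 !rnorm0 mulr0.
have [eta [eta1 ->]] := normalize xi0.
rewrite linearZ /= !rnormZ mulrCA ler_wpM2l ?rnorm_ge0 //.
have neta : rnorm eta = 1 by apply/eqP; rewrite -(@pexpr_eq1 _ _ 2) ?rnorm_ge0 //; apply/eqP.
have [Gam [GamS [z [kv [[mG zP] [G0 GS0] [rho [r0 r1 hz hzN]] blk _]]]]] :=
  model_exists ou B0 hbal 0 hx eta1.
have [m [_ bN]] := blk l.+1.
have hB : Bdelta_op delta (gtrunc Gam GamS z l.+1) by apply/Bdelta_opP; exists rho; split.
rewrite -(lift_gtrunc mG zP G0 GS0 hc (ltn0Sn l) (ltnSn l) bN hB).
have G1 v : rnorm (Gam l v) <= rnorm v.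
  by rewrite rnorm_le_sqn ?rnorm_ge0 //; exact: (sqn_Gam mG).
rewrite (le_trans (G1 _)) //.
rewrite (le_trans (rnorm_lift_fun ou hM kv (gtrunc_in_block mG zP bN) hB)) //.
rewrite ler_wpM2l // neta -neta -GS0 rnorm_le_sqn ?rnorm_ge0 //; exact: (sqn_GamS mG).
Qed.

Lemma hom_part_scale (a : R[i]) x j : hom_part c j (scale_tuple a x) =
  a ^+ j *: hom_part c j x.
Proof.
rewrite /hom_part scaler_sumr; apply: eq_bigr => t _.
by rewrite word_scale size_tuple !scalerA mulrC.
Qed.

Lemma scale_tupleK (a : R[i]) x : a != 0 -> scale_tuple a (scale_tuple a^-1 x) = x.
Proof. by move=> a0; apply/rowP => r; rewrite !mxE scalerA divff // scale1r. Qed.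

(** One [t] for a whole neighbourhood of [x], as local boundedness of the sum requires. *)
Lemma Bdelta_shrink x : Bdelta_op delta x -> exists t eta : R,
  [/\ 0 < t, t < 1, 0 < eta & forall y, (forall r, rnorm (y 0 r - x 0 r) <= eta) ->
    Bdelta_op delta (scale_tuple (t%:C)^-1 y)].
Proof.
move=> /Bdelta_opP[rho [r0 r1 hx]]; have [C C0 xC] := tuple_norm_bound x.
have [e [rho' [e0 r'0 r'1 hp]]] := @delta_contr_perturb R H d I J delta C rho C0 r0 r1.
(* With [t = (1 + theta)^-1], the difference [(1 + theta) y - x] is [(1 + theta) (y - x) + theta x].
   The first part is at most [2 * (e / 4)], the second at most [theta * C <= e / 2]. *)
have C1 : 0 < 2 * (C + 1) by rewrite mulr_gt0 // ltr_wpDl.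
pose theta := Num.min 1 (e / (2 * (C + 1))).
have th0 : 0 < theta by rewrite lt_min ltr01 divr_gt0.
have th1 : theta <= 1 by rewrite ge_min lexx.
have thC : theta * C <= e / 2.
  have : theta * (2 * (C + 1)) <= e by rewrite -ler_pdivlMr // ge_min lexx orbT.
  by nra.
have s0 : 0 < 1 + theta by rewrite addr_gt0.
exists (1 + theta)^-1, (e / 4); split.
- by rewrite invr_gt0.
- by rewrite invf_lt1 // ltrDl.
- by rewrite divr_gt0.
move=> y yx; apply/Bdelta_opP; exists rho'; split=> //; apply: (hp x) => // r.
have -> : scale_tuple ((1 + theta)^-1%:C)^-1 y 0 r - x 0 r =
    (1 + theta)%:C *: (y 0 r - x 0 r) + theta%:C *: x 0 r.
  rewrite mxE -fmorphV invrK scalerBr -addrA; congr (_ + _).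
  by rewrite rmorphD /= scalerDl scale1r opprD subrK.
rewrite (le_trans (rnormD _ _)) // !rnormZ !rnorm_real !gtr0_norm //.
have := yx r; have := xC r; have := rnorm_ge0 (y 0 r - x 0 r); have := rnorm_ge0 (x 0 r).
move: (rnorm (y 0 r - x 0 r)) (rnorm (x 0 r)) => a b b0 a0 bC ae.
by nra.
Qed.

Lemma power_series_sum x t : 0 < t -> t < 1 -> Bdelta_op delta (scale_tuple (t%:C)^-1 x) ->
  exists T : bop H, (forall xi, cvs (fun n => \sum_(j < n) hom_part c j x xi) (T xi)) /\
    rnorm T <= M / (1 - t).
Proof.
move=> t0 t1 hx.
apply: (@geometric_operator_series R H (fun j => hom_part c j x) M t hM0 (ltW t0) t1) => j v.
have tC : t%:C != 0 by apply/eqP => /(@complexI R) t0'; move: t0; rewrite t0' ltxx.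
rewrite -[x](scale_tupleK _ tC) hom_part_scale bop_scaleE rnormZ rnormX rnorm_real.
rewrite (gtr0_norm t0) mulrAC [leRHS]mulrC ler_wpM2l ?exprn_ge0 ?(ltW t0) //.
exact: hom_part_bound.
Qed.

(** The hypothesis is under the existential so that choice yields a total function, arbitrary
    outside the ball. *)
Lemma ext_exists x : exists T : bop H, Bdelta_op delta x ->
  forall xi, cvs (fun n => \sum_(j < n) hom_part c j x xi) (T xi).
Proof.
have [hx|hx] := pselect (Bdelta_op delta x); last by exists 0.
have [t [eta [t0 t1 e0 h]]] := Bdelta_shrink hx.
have [|T [TP _]] := @power_series_sum x t t0 t1; last by exists T.
by apply: h => r; rewrite subrr rnorm0 ltW.
Qed.

Definition ext x : bop H := sval (cid (ext_exists x)).

Lemma extP x xi : Bdelta_op delta x ->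
  cvs (fun n => \sum_(j < n) hom_part c j x xi) (ext x xi).
Proof. by move=> hx; exact: (svalP (cid (ext_exists x)) hx). Qed.

Lemma ext_bound x t : 0 < t -> t < 1 -> Bdelta_op delta x ->
  Bdelta_op delta (scale_tuple (t%:C)^-1 x) -> rnorm (ext x) <= M / (1 - t).
Proof.
move=> t0 t1 hx hx'; have [T [TP TM]] := power_series_sum t0 t1 hx'.
by have -> : ext x = T by apply: bopP => v; exact: cvs_unique (extP v hx) (TP v).
Qed.

Lemma ext_intertwine (L : bop H) x y : Bdelta_op delta x -> Bdelta_op delta y ->
  (forall r, L * x 0 r = y 0 r * L) -> L * ext x = ext y * L.
Proof.
move=> hx hy Lxy; apply: bopP => v; rewrite !bop_mulE.
apply: cvs_unique (cvs_bop L (extP v hx)) _; move: (extP (L v) hy); congr (cvs _ _).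
apply/funext => n; rewrite linear_sum; apply: eq_bigr => j _ /=.
rewrite !hom_partE linear_sum; apply: eq_bigr => t _ /=.
by rewrite linearZ /= -!bop_mulE (word_intertwine _ Lxy).
Qed.

Lemma ext_locally_bounded : locally_bounded_on (Bdelta_op delta) ext.
Proof.
move=> x hx; have [t [eta [t0 t1 e0 h]]] := Bdelta_shrink hx.
exists (M / (1 - t))%:C; split; first by apply/complex_realP; eexists.
move=> K MK; apply/nbhs_ballP; exists eta%:C; rewrite /= ?ltcR //.
move=> y [_ yx] hy /=; rewrite (le_trans _ (ltW MK)) // rnormE lecR.
apply: (ext_bound t0 t1 hy); apply: h => r.
have := yx 0 r; rewrite -ball_normE /ball_ /= distrC rnormE ltcR; exact: ltW.
Qed.

Lemma ext_nc : nc_function_op (Bdelta_op delta) ext.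
Proof. by split; [exact: ext_locally_bounded|move=> L x y; exact: ext_intertwine]. Qed.

Lemma ext_unique (G : 'rV[bop H]_d -> bop H) : nc_function_op (Bdelta_op delta) G ->
  extends u delta f G -> forall x, Bdelta_op delta x -> G x = ext x.
Proof.
move=> [_ ncG] exG x hx; apply: bopP => xi.
have [->|xi0] := eqVneq xi 0; first by rewrite !linear0.
have [eta [eta1 ->]] := normalize xi0; rewrite !linearZ /=; congr (_ *: _).
have [t [e [t0 t1 e0 h]]] := Bdelta_shrink hx.
have hx' : Bdelta_op delta (scale_tuple (t%:C)^-1 x) by apply: h => r;
  rewrite subrr rnorm0 ltW.
set x' := scale_tuple _ x in hx'.
have tC : t%:C != 0 by apply/eqP => /(@complexI R) t0'; move: t0; rewrite t0' ltxx.
have xE : x = scale_tuple t%:C x' by rewrite scale_tupleK.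
have [Gam [GamS [z [kv [[mG zP] [G0 GS0] [rho [r0 r1 hz hzN]] blk _]]]]] :=
  model_exists ou B0 hbal 0 hx' eta1.
have Bz : Bdelta_op delta z by apply/Bdelta_opP; exists rho; split.
(* The powers of [t] make the series converge. Since [Gam j.+1 * z 0 r = x' 0 r * Gam j], moving [z]
   across it leaves one spare factor [t], so [L] intertwines [z] with [t x' = x]. *)
have [|L [LP _]] := @geometric_operator_series R H (fun j => t%:C ^+ j *: Gam j) 1 t ler01
  (ltW t0) t1.
  move=> j v; rewrite bop_scaleE rnormZ rnormX rnorm_real (gtr0_norm t0) mul1r.
  rewrite ler_wpM2l ?exprn_ge0 ?(ltW t0) // rnorm_le_sqn ?rnorm_ge0 //; exact: (sqn_Gam mG).
have {}LP (v : H) : cvs (fun n => \sum_(j < n) t%:C ^+ j *: Gam j v) (L v) := LP v.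
have Lz r : L * z 0 r = x 0 r * L.
  apply: bopP => v; rewrite !bop_mulE; have [_ h1 h0 _] := zP r.
  apply: cvs_unique (cvsS (LP (z 0 r v))) _; move: (cvs_bop (x 0 r) (LP v)); congr (cvs _ _).
  apply/funext => n; rewrite big_ord_recl /= -[Gam 0 _]bop_mulE h0 bop_zeroE scaler0 add0r.
  rewrite linear_sum; apply: eq_bigr => j _ /=.
  rewrite /bump /= add1n -[Gam _ (z 0 r v)]bop_mulE h1 xE mxE exprS.
  by rewrite bop_mulE linearZ /= !scalerA mulrC.
have Lkv : L kv = eta.
  apply: cvs_unique (cvsS (LP kv)) _; apply: (@cvs_near _ _ 0) => n _.
  rewrite big_ord_recl /= G0 expr0 scale1r big1 ?addr0 // => j _.
  by rewrite (Gam_kv mG G0 GS0) /= scaler0.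
have GL : L (G z kv) = G x eta by rewrite -Lkv -!bop_mulE (ncG L z x Bz hx Lz).
rewrite -GL; apply: cvs_unique (LP (G z kv)) _; move: (extP eta hx); congr (cvs _ _).
apply/funext => n; apply: eq_bigr => j _.
rewrite xE hom_part_scale bop_scaleE; congr (_ *: _).
have [m [_ bN]] := blk j.+1.
have hB : Bdelta_op delta (gtrunc Gam GamS z j.+1) by apply/Bdelta_opP; exists rho; split.
have bk := gtrunc_in_block mG zP bN.
rewrite -(lift_gtrunc mG zP G0 GS0 hc (ltn0Sn j) (ltnSn j) bN hB).
(* [Gam j] sees only degrees up to [j], and the projection onto these intertwines [G z] with [G] at
   a truncation, a tuple of matrices where [extends] prescribes the value. *)
have -> : Gam j (G z kv) = Gam j (gproj Gam GamS j.+1 (G z kv)).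
  by rewrite -[RHS]bop_mulE (Gam_gproj mG) ltnSn.
congr (Gam j _).
have E := ncG (gproj Gam GamS j.+1) z _ Bz hB (gtrunc_gproj mG zP j.+1).
rewrite -[RHS]bop_mulE E bop_mulE (gproj_kv mG GS0) //.
have := exG m _ (Bdelta_compress ou bk hB); rewrite (embed_compress bk).
have -> : embed_mx u (1 : 'M[R[i]]_m.+1) = block_proj u m.+1 by exact: embed_rect1.
move=> /(congr1 (fun T : bop H => T kv)); rewrite bop_mulE.
by rewrite (blocks_kv GS0 (ltn0Sn j) bN) => ->.
Qed.

(** * Agreement with [f] on tuples of matrices *)

Lemma in_block_scale n a x : in_block u n x -> in_block u n (scale_tuple a x).
Proof. by move=> xn r; have [h1 h2] := xn r; rewrite mxE -scalerAr -scalerAl h1 h2. Qed.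

Lemma in_block_widen n m (T : bop H) : (n <= m)%N ->
  block_proj u n * T = T /\ T * block_proj u n = T ->
  block_proj u m * T = T /\ T * block_proj u m = T.
Proof.
move=> nm [h1 h2]; split; first by rewrite -h1 mulrA block_proj_mul.
by rewrite -h2 -mulrA block_proj_mulr.
Qed.

Section BlockTuples.
Variables (n : nat) (y0 : 'rV[bop H]_d) (xi : H) (t : R).
Hypotheses (y0n : in_block u n.+1 y0) (By0 : Bdelta_op delta y0).
Hypotheses (xi1 : sqn xi = 1) (Pxi : block_proj u n.+1 xi = xi).
Hypotheses (t0 : 0 < t) (t1 : t < 1).
Let x' := scale_tuple (t%:C)^-1 y0.
Hypothesis Bx' : Bdelta_op delta x'.
Let P := block_proj u n.+1.

Let tC : t%:C != 0.
Proof. by apply/eqP => /(@complexI R) t0'; move: t0; rewrite t0' ltxx. Qed.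

Let y0E r : y0 0 r = t%:C *: x' 0 r.
Proof. by rewrite mxE scalerA divff // scale1r. Qed.

Let x'n : in_block u n.+1 x'. Proof. exact: in_block_scale. Qed.

Let sum_scaled (Gam : nat -> bop H) k : bop H := \sum_(j < k) t%:C ^+ j *: Gam j.

Let sum_scaledE Gam k v : sum_scaled Gam k v = \sum_(j < k) t%:C ^+ j *: Gam j v.
Proof. by rewrite /sum_scaled bop_sumE; apply: eq_bigr => j _. Qed.

(* Couple [y0 = t x'] and the truncated model [zN] of [x'] by the corner
   [gamma x' Gam N'], with [gamma] independent of [N'] so that the sum stays in the
   ball. The tuple is similar to the direct sum through [gamma / t ^ N] times the
   approximate intertwiner [LN], so the bound [M] on [f] forces [LN] to intertwine
   the values of [f] up to [M t ^ N / gamma]. *)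
Lemma lift_fun_approx : exists K : R, forall N,
  rnorm (P (\sum_(j < N.+1) hom_part c j y0 xi) - lift_fun u f n y0 xi) <= K * t ^+ N.
Proof.
have [Gam [GamS [z [kv [[mG zP] [G0 GS0] [rho [r0 r1 hz hzN]] blk off]]]]] :=
  model_exists ou B0 hbal n.+1 Bx' xi1.
have [rho1 [r10 r11 hy0]] := (Bdelta_opP _ _).1 By0.
have [C C0 yC] := tuple_norm_bound y0; have [C' C'0 xC'] := tuple_norm_bound x'.
pose rho2 := Num.max rho1 rho.
have r20 : 0 <= rho2 by rewrite le_max r0 orbT.
have r21 : rho2 < 1 by rewrite gt_max r11.
have CC0 : 0 <= C + C' by rewrite addr_ge0.
have [eta [rho' [e0 r'0 r'1 hp]]] := @delta_contr_perturb R H d I J delta _ _ CC0 r20 r21.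
(* The corner [gamma x' Gam N'] has norm at most [gamma * C' <= eta], whatever [N'] is. *)
pose gamma := eta / (C' + 1).
have C'1 : 0 < C' + 1 by rewrite ltr_wpDl.
have gamma0 : 0 < gamma by rewrite divr_gt0.
exists (M / gamma) => N'; pose N := N'.+1.
have [m [nm bN]] := blk N.
pose Q := gproj Gam GamS N; pose zN := gtrunc Gam GamS z N.
have zNm : in_block u m.+1 zN by exact: (gtrunc_in_block mG zP bN).
have BzN : Bdelta_op delta zN.
  by apply/Bdelta_opP; exists rho; split=> //; exact: hzN.
have PQ : P * Q = 0.
  by rewrite /Q /gproj mulr_sumr big1 // => j _; rewrite mulrA (off j).1 mul0r.
have QP : Q * P = 0.
  by rewrite /Q /gproj mulr_suml big1 // => j _; rewrite -mulrA (off j).2 mulr0.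
have PzN r : P * zN 0 r = 0 by rewrite mxE mulrA PQ mul0r.
have zNP r : zN 0 r * P = 0 by rewrite mxE (gproj_z mG zP) -mulrA QP mulr0.
have y0P r : P * y0 0 r = y0 0 r /\ y0 0 r * P = y0 0 r by exact: y0n.
have x'P r : P * x' 0 r = x' 0 r /\ x' 0 r * P = x' 0 r by exact: x'n.
pose y00 : 'rV[bop H]_d := \row_r (y0 0 r + zN 0 r).
have dy00 : delta_contr delta rho2 y00.
  have pyth v := projection_pythagoras v (block_proj_adj u n.+1) (block_proj_idem ou n.+1).
  apply: (delta_contr_split pyth) => v.
    have hi r : P * y00 0 r = y0 0 r * P.
      by rewrite mxE mulrDr PzN addr0; have [-> ->] := y0P r.
    under eq_bigr do rewrite (delta_vec_intertwine _ _ _ hi).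
    have h : delta_contr delta rho2 y0 by apply: delta_contr_mono hy0; rewrite le_max lexx.
    exact: h.
  have hh w : w - block_proj u n.+1 w = (1 - P) w by [].
  have hi r : (1 - P) * y00 0 r = zN 0 r * (1 - P).
    rewrite [in LHS]mxE mulrBl mul1r mulrDr PzN addr0 mulrBr mulr1 zNP subr0.
    by have [-> _] := y0P r; rewrite addrC addKr.
  under eq_bigr do rewrite hh (delta_vec_intertwine _ _ _ hi).
  have h : delta_contr delta rho2 zN by apply: delta_contr_mono (hzN N);
    rewrite le_max lexx orbT.
  exact: (h (fun j => (1 - P) (v j))).
pose y : 'rV[bop H]_d := \row_r (y0 0 r + zN 0 r + gamma%:C *: (x' 0 r * Gam N')).
have By : Bdelta_op delta y.
  apply/Bdelta_opP; exists rho'; split=> //; apply: (hp y00) => // r.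
    rewrite mxE (le_trans (rnormD _ _)) // lerD //.
    exact: le_trans (rnorm_gtrunc mG zP N r) (xC' r).
  rewrite [y 0 r]mxE [y00 0 r]mxE [X in rnorm X]addrC addKr rnormZ rnorm_real gtr0_norm //.
  rewrite /gamma mulrAC ler_pdivrMr // ler_pM2l // (le_trans (rnorm_bop_mul _ _)) //.
  rewrite (@le_trans _ _ (C' * 1)) //; last by rewrite mulr1 lerDl ler01.
  by rewrite ler_pM ?rnorm_ge0 //; apply: rnorm_le1; exact: sqn_Gam mG _.
have nm' : (n.+1 <= m.+1)%N by exact: leqW.
have [hGS hG] := bN N' (ltnSn N').
have ym : in_block u m.+1 y.
  move=> r; rewrite mxE.
  have [a1 a2] := in_block_widen nm' (y0n r); have [b1 b2] := zNm r.
  have [d1 d2] := in_block_widen nm' (x'n r).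
  by rewrite !mulrDr !mulrDl a1 a2 b1 b2 -scalerAr -scalerAl mulrA d1 -mulrA hG.
have GP : Gam N' * P = 0 by exact: (off N').2.
have yP r : y 0 r * P = y0 0 r.
  rewrite mxE !mulrDl zNP addr0 -scalerAl -mulrA GP mulr0 scaler0 addr0.
  by have [_ ->] := y0P r.
have E1 : P * lift_fun u f n y0 = lift_fun u f m y * P.
  apply: (lift_fun_intertwine ou hf y0n ym By0 By) => [||r].
  - exact: block_proj_mul.
  - exact: block_proj_idem.
  - by rewrite yP; have [-> _] := y0P r.
pose g : R := gamma / t ^+ N.
have g0 : 0 < g by rewrite divr_gt0 // exprn_gt0.
pose LN := P * sum_scaled Gam N.
(* [y LN] exceeds [LN zN] by the top degree term [t ^ N x' Gam N'], and [y Q] exceeds [Q zN] by the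
   corner [gamma x' Gam N']. As [g t ^ N = gamma], the two cancel and [L2] intertwines exactly. *)
pose L2 := Q - g%:C *: LN.
have LNz r : LN * zN 0 r = t%:C *: (x' 0 r * sum_scaled Gam N').
  have [_ h1 h0 _] := zP r.
  have SzN : sum_scaled Gam N * zN 0 r = sum_scaled Gam N * z 0 r.
    rewrite [zN 0 r]mxE mulrA; congr (_ * _); rewrite /sum_scaled mulr_suml.
    by apply: eq_bigr => j _; rewrite -scalerAl (Gam_gproj mG) ltn_ord.
  have Sz : sum_scaled Gam N * z 0 r = t%:C *: (x' 0 r * sum_scaled Gam N').
    rewrite /sum_scaled mulr_suml big_ord_recl -scalerAl h0 scaler0 add0r.
    rewrite mulr_sumr scaler_sumr; apply: eq_bigr => j _.
    by rewrite lift0 -scalerAl h1 -scalerAr scalerA exprS.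
  by rewrite /LN -mulrA SzN Sz -scalerAr mulrA (x'P r).1.
have yLN r : y 0 r * LN = t%:C *: (x' 0 r * sum_scaled Gam N') +
  t%:C ^+ N *: (x' 0 r * Gam N').
  rewrite /LN mulrA yP y0E -scalerAl /sum_scaled big_ord_recr /= mulrDr scalerDr.
  by rewrite -scalerAr scalerA -exprS.
have yQ r : y 0 r * Q = zN 0 r + gamma%:C *: (x' 0 r * Gam N').
  rewrite mxE !mulrDl -(y0P r).2 -mulrA PQ mulr0 add0r -(gtrunc_commute mG zP) (gproj_gtrunc
    mG).
  by rewrite -scalerAl -mulrA (Gam_gproj mG) ltnSn.
have gt : g%:C * t%:C ^+ N = gamma%:C.
  rewrite -rmorphXn -rmorphM /= /g divfK // expf_neq0 // gt_eqF //.
have L2z r : L2 * zN 0 r = y 0 r * L2.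
  rewrite /L2 mulrBl mulrBr -scalerAl LNz -scalerAr yLN yQ (gproj_gtrunc mG).
  by rewrite scalerDr [X in _ - (_ + X)]scalerA gt opprD addrA addrAC addrK.
have E2 : L2 * lift_fun u f m zN = lift_fun u f m y * L2.
  have Pm : block_proj u m.+1 * P = P /\ P * block_proj u m.+1 = P.
    by split; [exact: block_proj_mul|exact: block_proj_mulr].
  have [Qm1 Qm2] := blocks_gproj bN.
  apply: (lift_fun_intertwine ou hf zNm ym BzN By) => //.
    by rewrite /L2 mulrBr Qm1 -scalerAr /LN mulrA Pm.1.
  rewrite /L2 mulrBl Qm2 -scalerAl /LN -mulrA; congr (_ - _ *: (_ * _)).
  rewrite /sum_scaled mulr_suml; apply: eq_bigr => j _.
  by rewrite -scalerAl (bN j (ltn_ord j)).2.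
have kvE : L2 kv = kv - g%:C *: xi.
  rewrite /L2 bop_addE bop_oppE bop_scaleE /Q (gproj_kv mG GS0) // /LN bop_mulE.
  rewrite sum_scaledE big_ord_recl expr0 scale1r G0.
  by rewrite big1 ?addr0 ?Pxi // => j _; rewrite (Gam_kv mG G0 GS0) /= scaler0.
have yxi : lift_fun u f m y xi = lift_fun u f n y0 xi.
  rewrite -{1}Pxi -bop_mulE -E1; have [-> _] := lift_fun_proj ou f n y0.
  by [].
have LNlift : LN (lift_fun u f m zN kv) = P (\sum_(j < N) hom_part c j y0 xi).
  rewrite /LN bop_mulE; congr (P _); rewrite sum_scaledE; apply: eq_bigr => j _.
  rewrite (lift_gtrunc mG zP G0 GS0 hc (ltn0Sn N') (ltn_ord j) bN BzN).
  by rewrite -bop_scaleE -hom_part_scale scale_tupleK.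
(* Apply [E2] to [kv] and project by [P]: since [P Q = 0], what remains is [g] times the wanted
   difference, while [P (f y kv)] has norm at most [M]. *)
have key : P (lift_fun u f m y kv) =
    g%:C *: (lift_fun u f n y0 xi - P (\sum_(j < N) hom_part c j y0 xi)).
  have -> : lift_fun u f m y kv = lift_fun u f m y (L2 kv) + g%:C *: lift_fun u f n y0 xi.
    by rewrite kvE linearB linearZ /= yxi subrK.
  have E3 : lift_fun u f m y (L2 kv) = L2 (lift_fun u f m zN kv).
    by rewrite -[RHS]bop_mulE E2.
  have E4 : P (lift_fun u f n y0 xi) = lift_fun u f n y0 xi.
    by rewrite -[LHS]bop_mulE; have [-> _] := lift_fun_proj ou f n y0.
  have PL2 : P * L2 = - (g%:C *: LN).
    by rewrite /L2 mulrBr PQ sub0r -scalerAr /LN mulrA block_proj_idem.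
  rewrite E3 linearD linearZ /= E4 -[P (L2 _)]bop_mulE PL2 bop_oppE bop_scaleE LNlift.
  by rewrite scalerBr addrC.
have kv1 : rnorm kv <= 1.
  rewrite rnorm_le_sqn // expr1n -xi1 -GS0; exact: (sqn_GamS mG).
have Pn v : rnorm (P v) <= rnorm v.
  rewrite rnorm_le_sqn ?rnorm_ge0 // -[leRHS]/(sqn v).
  by rewrite (projection_pythagoras v (block_proj_adj u n.+1) (block_proj_idem ou n.+1))
    lerDl sqn_ge0.
have fin : g * rnorm (P (\sum_(j < N) hom_part c j y0 xi) - lift_fun u f n y0 xi) <= M.
  rewrite -rnormN opprB -(gtr0_norm g0) -rnorm_real -rnormZ -key.
  rewrite (le_trans (Pn _)) // (le_trans (rnorm_lift_fun ou hM kv ym By)) //.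
  by rewrite ler_piMr.
rewrite -ler_pdivlMl // in fin; apply: (le_trans fin).
rewrite /g invf_div mulrC -mulrA ler_wpM2l // mulrC ler_wpM2l ?invr_ge0 ?(ltW gamma0) //.
by rewrite exprS ler_piMl ?exprn_ge0 // ltW.
Qed.

(** The approximation controls only the part in the block, but [P] commutes with [y0], hence with
    [ext y0], and fixes [xi]. *)
Lemma lift_fun_ext_vec : lift_fun u f n y0 xi = ext y0 xi.
Proof.
have [K KP] := lift_fun_approx.
have c1 : cvs (fun N => P (\sum_(j < N.+1) hom_part c j y0 xi)) (lift_fun u f n y0 xi).
  apply: (cvs_dom KP); rewrite -[0](mulr0 K); apply: cvgM; first exact: cvg_cst.
  by apply: cvg_expr; rewrite ger0_norm // ltW.
have c2 := cvs_bop P (cvsS (extP xi By0)).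
rewrite (cvs_unique c1 c2) -bop_mulE.
rewrite (ext_intertwine By0 By0) ?bop_mulE ?Pxi // => r.
by have [-> ->] := y0n r.
Qed.

End BlockTuples.

Lemma lift_fun_ext n y0 : in_block u n.+1 y0 -> Bdelta_op delta y0 ->
  ext y0 * block_proj u n.+1 = lift_fun u f n y0.
Proof.
move=> y0n By0; apply: bopP => v; have [_ <-] := lift_fun_proj ou f n y0; rewrite !bop_mulE.
set w := block_proj u n.+1 v.
have Pw : block_proj u n.+1 w = w by rewrite -bop_mulE block_proj_idem.
have [->|w0] := eqVneq w 0; first by rewrite !linear0.
have [xi [xi1 wE]] := normalize w0.
have nw : (rnorm w)%:C != 0 by apply: contra_neq w0 => h; apply: rnorm_eq0;
  exact: (@complexI R).
have Pxi : block_proj u n.+1 xi = xi.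
  by apply: (scalerI nw); rewrite -linearZ -wE.
rewrite wE !linearZ /=; congr (_ *: _); symmetry.
have [t [e [t0 t1 e0 h]]] := Bdelta_shrink By0.
apply: (lift_fun_ext_vec y0n By0 xi1 Pxi t0 t1); apply: h => r.
by rewrite subrr rnorm0 ltW.
Qed.

Lemma ext_extends : extends u delta f ext.
Proof.
move=> n X hX; have hB := Bdelta_op_of_mx ou B0 hX.
rewrite -[embed_mx u 1]/(embed_rect u 1%:M) embed_rect1 //.
rewrite (lift_fun_ext (in_block_embed ou X) hB) /lift_fun.
by rewrite compress_embed.
Qed.

End Extension.

(** * Interpolation of [f] when the ball of operators is empty *)

Section EmptyBall.
Variables (R : realType) (H : infHilbertType R) (u : nat -> H).
Hypothesis ou : orthonormal_family u.
Variables (d I J : nat) (delta : 'M[freepoly R d]_(I, J)).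

(* The last basis vector of the larger block is killed by the common tuple, so
   [delta] acts on it through [delta 0], a matrix of scalars. *)
Lemma embed_tuple_smaller n n' (X : 'rV['M[R[i]]_n.+1]_d) (X' : 'rV['M[R[i]]_n'.+1]_d) :
  (n < n')%N -> Bdelta_mx delta X' -> embed_tuple u X = embed_tuple u X' ->
  Bdelta_op delta (0 : 'rV[bop H]_d).
Proof.
move=> nn' /(Bdelta_mxP ou)[rho [r0 r1 h]] XX'; apply/Bdelta_opP; exists rho; split=> // v.
have [g [og gP]] := gram_schmidt v ou.
pose T t := rank_one (u n') (g t).
have Xu r : embed_tuple u X' 0 r (u n') = 0.
  rewrite -XX' -(in_block_embed ou X r).2 bop_mulE block_proj_basis //.
  by rewrite ltnNge nn' linear0.
have T0 t r : T t * (0 : 'rV[bop H]_d) 0 r = embed_tuple u X' 0 r * T t.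
  by rewrite [in LHS]mxE mulr0 mul_rank_one Xu rank_one0.
pose G : bop H := \sum_t rank_one (g t) (g t).
have GE w : G w = \sum_t inner w (g t) *: g t.
  by rewrite /G bop_sumE; apply: eq_bigr => t _; rewrite rank_oneE.
have sG w : sqn (G w) = \sum_t sqn (T t w).
  rewrite GE (sqn_orthonormal xpredT _ og (index_enum_uniq _)); apply: eq_bigr => t _.
  by rewrite rank_oneE sqnZ (orthonormal_sqn n' ou) mulr1.
have Gv j : G (v j) = v j by rewrite GE -gP.
have Gd i : G (delta_vec delta 0 v i) = delta_vec delta 0 v i.
  have G0 r : G * (0 : 'rV[bop H]_d) 0 r = (0 : 'rV[bop H]_d) 0 r * G.
    by rewrite mxE mulr0 mul0r.
  rewrite (delta_vec_intertwine _ _ _ G0); congr delta_vec.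
  by apply/funext => j; exact: Gv.
have -> : \sum_i sqn (delta_vec delta 0 v i) = \sum_t \sum_i sqn (T t (delta_vec delta 0 v i)).
  by rewrite exchange_big; apply: eq_bigr => i _; rewrite -sG Gd.
have -> : \sum_j sqn (v j) = \sum_t \sum_j sqn (T t (v j)).
  by rewrite exchange_big; apply: eq_bigr => j _; rewrite -sG Gv.
rewrite mulr_sumr; apply: ler_sum => t _.
have vT j : vec u (coords u n'.+1 (T t (v j))) = T t (v j).
  by rewrite coordsK -bop_mulE mul_rank_one block_proj_basis // ltnSn.
have := h (fun j => coords u n'.+1 (T t (v j))).
under [X in _ <= _ * X -> _]eq_bigr do rewrite vT.
apply: le_trans; apply: ler_sum => i _.
rewrite (delta_vec_intertwine _ _ _ (T0 t)) le_eqVlt; apply/orP; left; apply/eqP.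
by congr (sqn (delta_vec _ _ _ _)); apply/funext => j; rewrite vT.
Qed.

Lemma embed_tuple_inj n (X X' : 'rV['M[R[i]]_n.+1]_d) :
  embed_tuple u X = embed_tuple u X' -> X = X'.
Proof.
move=> XX'; rewrite -(compress_embed ou X) -(compress_embed ou X').
by rewrite XX'.
Qed.

Lemma extends_empty (f : graded_fun R d) : ~ Bdelta_op delta (0 : 'rV[bop H]_d) ->
  exists F : 'rV[bop H]_d -> bop H, extends u delta f F.
Proof.
move=> B0.
pose Q (T : 'rV[bop H]_d) (S : bop H) := exists n (X : 'rV['M[R[i]]_n.+1]_d),
  [/\ Bdelta_mx delta X, embed_tuple u X = T & S = embed_mx u (@f n X)].
pose F T := if pselect (exists S, Q T S) is left QT then sval (cid QT) else 0.
have FP T : (exists S, Q T S) -> Q T (F T).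
  by rewrite /F; case: pselect => // QT _; exact: (svalP (cid QT)).
exists F => n X hX.
have [|n' [X' [hX' X'X ->]]] := FP (embed_tuple u X).
  by exists (embed_mx u (f n X)), n, X.
case: (ltngtP n n') => nn'.
- by case: B0; exact: embed_tuple_smaller nn' hX' (esym X'X).
- by case: B0; exact: embed_tuple_smaller nn' hX X'X.
subst n'; rewrite (embed_tuple_inj X'X).
have -> : embed_mx u (1 : 'M[R[i]]_n.+1) = block_proj u n.+1 by exact: embed_rect1.
exact: (embed_rect_proj ou (f n X)).2.
Qed.

End EmptyBall.

Theorem corollary6p8 (R : realType) (H : infHilbertType R)
    (B : eqType) (e : B -> H) (he : orthonormal_basis e)
    (s : nat -> B) (hs : injective s)
    (d I J : nat) (hd : (0 < d)%N) (hI : (0 < I)%N) (hJ : (0 < J)%N)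
    (delta : 'M[freepoly R d]_(I, J))
    (hbal : balanced (Bdelta_op (H := H) delta))
    (f : graded_fun R d) (hf : nc_function_mx delta f)
    (hfb : bounded_mx delta f) :
  exists F : 'rV[bop H]_d -> bop H,
    [/\ nc_function_op (Bdelta_op (H := H) delta) F,
        extends (e \o s) delta f F
      & forall G : 'rV[bop H]_d -> bop H,
          nc_function_op (Bdelta_op (H := H) delta) G ->
          extends (e \o s) delta f G ->
          forall x, Bdelta_op (H := H) delta x -> G x = F x].
Proof.
have ou : orthonormal_family (e \o s).
  by move=> m n; rewrite /= he.1 (inj_eq hs).
have [B0|B0] := pselect (Bdelta_op delta (0 : 'rV[bop H]_d)).
  have [c hc] := nilpotent_expansion ou B0 hf.
  have [M hM] := hfb.
  (* [bounded_mx] says nothing about the sign of its bound. *)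
  have hM0 : 0 <= Num.max 0 M by rewrite le_max lexx.
  have hM' n (x : 'rV['M[R[i]]_n.+1]_d) : Bdelta_mx delta x ->
    mx_opnorm (f n x) <= Num.max 0 M.
    by move=> /hM fM; rewrite le_max fM orbT.
  exists (ext ou B0 hbal hM0 hM' hc); split.
  - exact: ext_nc.
  - exact: ext_extends.
  - exact: ext_unique.
have noB x : ~ Bdelta_op delta (x : 'rV[bop H]_d).
  move=> hx; apply: B0; have := hbal 0 _ x hx; rewrite normr0 ler01 => /(_ isT).
  by congr (Bdelta_op delta _); apply/rowP => r; rewrite !mxE scale0r.
have [F FE] := extends_empty ou f B0.
exists F; split=> // [|G _ _ x /noB //].
by split=> [x /noB //|L x y /noB].
Qed.
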